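(* Let $k\ge3$. For every tensor $t\in\mathbb{C}^{d_1}\otimes\cdots\otimes\mathbb{C}^{d_k}$, $$\liminf_{n\to\infty}\mathrm{SR}(t^{\otimes n})^{1/n}\ge\min_{\theta\in\mathcal{P}([k])}2^{E^\theta(t)}.$$
   Context: $t^{\otimes n}$ is viewed as a $k$-tensor in $(\mathbb{C}^{d_1})^{\otimes n}\otimes\cdots\otimes(\mathbb{C}^{d_k})^{\otimes n}$. A slice in $U_1\otimes\cdots\otimes U_k$ is $v\otimes w$ with $v\in U_j$, $w\in\bigotimes_{i\ne j}U_i$ for some $j$; slice rank $\mathrm{SR}$ is the least number of slices summing to the tensor. Upper quantum functional: $E^\theta(t)=\sup\sum_{j=1}^k\theta(j)H(\overline{\lambda^{(j)}})$ over all $m\ge1$ and partitions $\lambda^{(j)}\vdash m$ with $(P_{\lambda^{(1)}}\otimes\cdots\otimes P_{\lambda^{(k)}})t^{\otimes m}\ne0$, where $P_\lambda$ projects $(\mathbb{C}^{d_j})^{\otimes m}$ onto the $\lambda$-isotypic component of the Schur–Weyl decomposition $\bigoplus_{\lambda\vdash m}\mathbb{S}_\lambda(\mathbb{C}^{d_j})\otimes[\lambda]$, $\overline\lambda=(\lambda_1/m,\dots)$, $H$ Shannon entropy base 2; $E^\theta(0)=-\infty$ ($2^{-\infty}=0$). *)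

(* Defs.v *)
From HB Require Import structures.
From mathcomp Require Import all_boot all_order all_fingroup all_algebra.
From mathcomp Require Import complex.
From mathcomp Require Import boolp classical_sets reals ereal sequences exp.

Set Implicit Arguments.
Unset Strict Implicit.
Unset Printing Implicit Defensive.

Import Order.TTheory GRing.Theory Num.Theory.

Local Open Scope ring_scope.
Local Open Scope complex_scope.

(** The vector space C^X with standard basis indexed by X, where C = R[i]. *)
Notation cspace R X := {ffun X -> R[i]^o}.

Definition basis_vec (R : realType) (X : finType) (x : X) : cspace R X :=
  [ffun y => (y == x)%:R].

(** k-tensors in C^(I 0) (x) ... (x) C^(I (k-1)), given by their coordinates in
    the product basis. *)
Notation tensor R I := (cspace R {dffun forall j, I j}).

(** (C^X)^{(x) n} has basis {ffun 'I_n -> X}; the power is again a k-tensor. *)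
Definition tensor_pow (R : realType) (k : nat) (I : 'I_k -> finType) (n : nat)
    (t : tensor R I) : tensor R (fun j => {ffun 'I_n -> I j}) :=
  [ffun x : {dffun forall j, {ffun 'I_n -> I j}} =>
    \prod_(a < n) t [ffun j => x j a]].

Section SliceRank.
Variables (R : realType) (k : nat) (I : 'I_k -> finType).

Definition drop_leg (j : 'I_k) (x : {dffun forall i, I i}) :
    {dffun forall i : {i : 'I_k | i != j}, I (val i)} :=
  [ffun i => x (val i)].

Definition is_slice (s : tensor R I) : Prop :=
  exists (j : 'I_k) (v : cspace R (I j))
         (w : tensor R (fun i : {i : 'I_k | i != j} => I (val i))),
    s = [ffun x : {dffun forall i, I i} => v (x j) * w (drop_leg j x)].

Definition sum_of_slices (t : tensor R I) (r : nat) : Prop :=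
  exists s : 'I_r -> tensor R I,
    (forall i, is_slice (s i)) /\ t = \sum_(i < r) s i.

(* The default value 0 is only ever used when there are no legs (k = 0), see
   [slice_rankP] below. *)
Definition slice_rank (t : tensor R I) : nat :=
  xget 0%N [set r | sum_of_slices t r /\
                    forall r', sum_of_slices t r' -> (r <= r')%N].

End SliceRank.

Definition is_partition (m : nat) (lam : seq nat) : bool :=
  [&& sorted geq lam, 0%N \notin lam & sumn lam == m].

(** Place permutation on (C^X)^{(x) m}:  x_1 (x) ... (x) x_m is sent to
    x_{s^-1 1} (x) ... (x) x_{s^-1 m}. *)
Definition place_perm (R : realType) (X : finType) (m : nat) (s : 'S_m)
    (v : cspace R {ffun 'I_m -> X}) : cspace R {ffun 'I_m -> X} :=
  [ffun x : {ffun 'I_m -> X} => v [ffun a => x (s a)]].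

(** A tabloid of shape lam |- m is the function sending each entry to its row,
    so the permutation module on tabloids lies in (C^(size lam))^{(x) m}, with
    S_m acting by [place_perm]. *)
Notation tabloid_space R m lam :=
  (cspace R {ffun 'I_m -> 'I_(size lam)}).

(** A tableau T sends each entry a to its cell (row, column).  When lam |- m,
    an injective such map into the diagram is bijective onto it. *)
Definition is_tableau (m : nat) (lam : seq nat)
    (T : {ffun 'I_m -> 'I_(size lam) * 'I_m}) : bool :=
  injectiveb T && [forall a, ((T a).2 < nth 0 lam (T a).1)%N].

Definition polytabloid (R : realType) (m : nat) (lam : seq nat)
    (T : {ffun 'I_m -> 'I_(size lam) * 'I_m}) : tabloid_space R m lam :=
  \sum_(s : 'S_m | [forall a, (T (s a)).2 == (T a).2])
    (-1) ^+ s *: basis_vec R [ffun a => (T (s a)).1].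

Definition specht (R : realType) (m : nat) (lam : seq nat) :
    {vspace tabloid_space R m lam} :=
  <<[seq polytabloid R T | T <- enum (@is_tableau m lam)]>>%VS.

Section Isotypic.
Variables (R : realType) (X : finType) (m : nat).
Local Notation V := (cspace R {ffun 'I_m -> X}).

(** W is an S_m-submodule isomorphic to the Specht module; its stability follows
    from the equivariance of f on the Specht module. *)
Definition specht_copy (lam : seq nat) (W : {vspace V}) : Prop :=
  exists f : 'Hom(tabloid_space R m lam, V),
    [/\ forall (s : 'S_m) u, u \in specht R m lam ->
          f (place_perm s u) = place_perm s (f u),
        (lker f :&: specht R m lam)%VS = 0%VS
      & (f @: specht R m lam)%VS = W].

(** The lam-isotypic component: the sum of all submodules isomorphic to the
    Specht module [lam]. *)
Definition isotypic (lam : seq nat) : set V :=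
  [set v | exists Ws : seq {vspace V},
     (forall W, W \in Ws -> specht_copy lam W) /\ v \in (\sum_(W <- Ws) W)%VS].

(** P is the projection onto the lam-summand in the decomposition of the
    S_m-module (C^X)^{(x) m} as the direct sum of its isotypic components,
    which are indexed by the partitions of m.  By Schur-Weyl duality the
    lam-isotypic component for S_m is S_lam(C^X) (x) [lam], and hence also the
    S_lam(C^X)-isotypic component for GL(C^X). *)
Definition is_isotypic_proj (lam : seq nat) (P : 'End(V)) : Prop :=
  [/\ forall v, isotypic lam (P v),
      forall v, isotypic lam v -> P v = v,
      forall mu v, is_partition m mu -> mu != lam -> isotypic mu v -> P v = 0
    & forall (s : 'S_m) v, P (place_perm s v) = place_perm s (P v)].

(* For lam |- m there is exactly one such P, so the default 0 is not used. *)
Definition isotypic_proj (lam : seq nat) : 'End(V) :=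
  xget 0 [set P | is_isotypic_proj lam P].

End Isotypic.

(** (A_1 (x) ... (x) A_k) t, computed by expanding t in the product basis. *)
Definition tensor_map (R : realType) (k : nat) (I : 'I_k -> finType)
    (A : forall j, 'End(cspace R (I j))) (t : tensor R I) : tensor R I :=
  [ffun x : {dffun forall j, I j} => \sum_(y : {dffun forall j, I j})
    t y * \prod_(j < k) A j (basis_vec R (y j)) (x j)].

(* [ln 0 = 0] in the library, so that 0 log 0 = 0. *)
Definition shannon (R : realType) (p : seq R) : R :=
  - \sum_(x <- p) x * (ln x / ln 2).

Definition normalize (R : realType) (m : nat) (lam : seq nat) : seq R :=
  [seq p%:R / m%:R | p <- lam].

Definition is_prob (R : realType) (k : nat) (theta : 'I_k -> R) : Prop :=
  (forall j, 0 <= theta j) /\ \sum_(j < k) theta j = 1.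

(** The supremum of the empty set is -oo, which gives the value -oo at t = 0,
    see [upper_functional0]. *)
Definition upper_functional (R : realType) (k : nat) (I : 'I_k -> finType)
    (theta : 'I_k -> R) (t : tensor R I) : \bar R :=
  ereal_sup [set e | exists (m : nat) (lam : 'I_k -> seq nat),
    [/\ (0 < m)%N,
        forall j, is_partition m (lam j),
        tensor_map (fun j => isotypic_proj R (I j) m (lam j))
                   (tensor_pow m t) != 0
      & e = (\sum_(j < k) theta j * shannon (normalize R m (lam j)))%:E]].

Definition pow2e (R : realType) (x : \bar R) : \bar R :=
  match x with
  | EFin r => (2 `^ r)%:E
  | EPInf => +oo%E
  | ENInf => 0%E
  end.

Lemma sum_of_slices_ex (R : realType) (k : nat) (I : 'I_k -> finType)
    (j : 'I_k) (t : tensor R I) : exists r, sum_of_slices t r.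
Proof.
pose w (a : I j) : tensor R (fun i : {i : 'I_k | i != j} => I (val i)) :=
  [ffun y => \sum_(x : {dffun forall i, I i} |
     (x j == a) && (drop_leg j x == y)) t x].
exists #|I j|; exists (fun i => [ffun x : {dffun forall j, I j} =>
  basis_vec R (enum_val i) (x j) * w (enum_val i) (drop_leg j x)]); split.
  by move=> i; exists j, (basis_vec R (enum_val i)), (w (enum_val i)).
apply/ffunP => x; rewrite sum_ffunE (bigD1 (enum_rank (x j))) //=.
rewrite !ffunE enum_rankK eqxx mul1r [X in _ + X]big1 ?addr0; last first.
  move=> i ne_i; rewrite !ffunE; case: eqP => [e|_]; last by rewrite mul0r.
  by rewrite e enum_valK eqxx in ne_i.
rewrite (big_pred1 x) // => y /=; apply/andP/eqP => [[/eqP ej /eqP ed]|->//].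
apply/ffunP => i; have [->//|ne_i] := eqVneq i j.
by move/ffunP/(_ (Sub i ne_i)): ed; rewrite !ffunE.
Qed.

Lemma slice_rankP (R : realType) (k : nat) (I : 'I_k -> finType)
    (t : tensor R I) : (0 < k)%N ->
  sum_of_slices t (slice_rank t) /\
  forall r, sum_of_slices t r -> (slice_rank t <= r)%N.
Proof.
move=> k0; have ex := sum_of_slices_ex (Ordinal k0) t.
have exb : exists r, `[< sum_of_slices t r >].
  by case: ex => r hr; exists r; apply/asboolP.
rewrite /slice_rank; case: xgetP => [r _ //|none].
case: (ex_minnP exb) => r /asboolP hr min_r; case: (none r); split => // r' hr'.
by apply: min_r; apply/asboolP.
Qed.

Lemma isotypic_projP (R : realType) (X : finType) (m : nat)
    (lam : seq nat) (P : 'End(cspace R {ffun 'I_m -> X})) :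
  is_isotypic_proj lam P -> is_isotypic_proj lam (isotypic_proj R X m lam).
Proof.
by move=> hP; rewrite /isotypic_proj; case: xgetP => [Q _ //|/(_ P)/(_ hP)].
Qed.

Lemma upper_functional0 (R : realType) (k : nat) (I : 'I_k -> finType)
    (theta : 'I_k -> R) : upper_functional theta (0 : tensor R I) = -oo%E.
Proof.
rewrite /upper_functional (_ : [set e | _]%classic = classical_sets.set0).
  by rewrite ereal_sup0.
apply/seteqP; split => // e [m [lam [m0 _ /eqP nz _]]]; case: nz.
apply/ffunP => x; rewrite !ffunE big1 // => y _.
by rewrite ffunE (bigD1 (Ordinal m0)) //= ffunE !mul0r.
Qed.

(* Main.v *)
(* Let P be the set of tuples of normalized shapes occurring in t. Multiplying
   highest weight functionals that do not vanish on the orbit of t (evaluated at a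
   common change of bases g) shows that P is closed under rational convex
   combinations, so with the concavity of entropy a minimax argument gives, for
   each v < min E^theta(t), one tuple of shapes Lam of size m with all entropies
   larger than v.

   For n = qm, the tensor (g t)^(x)n then has a nonzero S_n-invariant projection
   tau to the tensor product of the Specht modules [q Lam_j]. By Schur's lemma the
   reduced state of tau on leg j is maximally mixed. If tau is a sum of slices with
   r_j of them along leg j, the projections killing these slices also kill tau,
   and the union bound gives 1 <= sum_j r_j / dim [q Lam_j]. Hence the slice rank is
   at least min_j dim [q Lam_j], which by the formula for the number of standard
   tableaux is 2^(n H(Lam_j / m)) up to a polynomial factor. *)
Require Import Defs.
From mathcomp Require Import ring lra.
From mathcomp Require Import topology normedtype derive.
From mathcomp Require Import all_boot all_order all_fingroup all_algebra.
From mathcomp Require Import complex.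
From mathcomp Require Import boolp classical_sets reals ereal sequences exp.
Import Order.TTheory GRing.Theory Num.Theory.
Import numFieldNormedType.Exports.
Set Implicit Arguments.
Unset Strict Implicit.
Unset Printing Implicit Defensive.
Local Open Scope ring_scope.

(** * Tensors under operators on one leg *)

Section Hermitian.
Variables (C : numClosedFieldType) (X : finType).
Implicit Types (u v : X -> C) (b : {ffun X -> C}) (bs : seq {ffun X -> C}).

(** A tuple of shapes that is good for $E^\theta(t)$ changes with $\theta$, while the slice bound
    needs one tuple whose Specht modules are large on all legs at once. The minimax step is
    therefore made effective: it returns a finite list of occurring points, each counted once, so
    the mixture has rational weights from the start and only the degrees remain to be equalized. A
    common [g] exists because the functionals are polynomial in the entries of [g], and finitely
    many nonzero polynomials have a common nonzero point. Here [g] is a family of rectangular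
    matrices sending every leg to one alphabet of size [L], so that all legs carry words over the
    same letters. The representation theory rests on one fact: a vector that is antisymmetric along
    the columns of a tableau and has the right content is a multiple of the polytabloid. It yields
    the scalars of Schur's lemma directly, and eigenspaces of the reduced states then take the place
    of the Specht modules. *)

Definition dot u v : C := \sum_x u x * (v x)^*.

Lemma eq_dot u u' v v' : u =1 u' -> v =1 v' -> dot u v = dot u' v'.
Proof. by move=> e e'; apply: eq_bigr => x _; rewrite e e'. Qed.

Lemma dotC u v : dot u v = (dot v u)^*.
Proof.
rewrite /dot rmorph_sum; apply: eq_bigr => x _.
rewrite rmorphM /=. rewrite conjCK mulrC //.
Qed.

Lemma dotB u v w : dot (fun x => u x - v x) w = dot u w - dot v w.
Proof. by rewrite /dot -sumrB; apply: eq_bigr => x _; rewrite mulrBl. Qed.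

Lemma dotZl a u w : dot (fun x => a * u x) w = a * dot u w.
Proof. by rewrite /dot mulr_sumr; apply: eq_bigr => x _; rewrite mulrA. Qed.

Lemma dot0l w : dot (fun=> 0) w = 0.
Proof. by rewrite /dot big1 // => x _; rewrite mul0r. Qed.

Lemma dotBZl a u v w : dot (fun x => u x - a * v x) w = dot u w - a * dot v w.
Proof.
by rewrite dotB dotZl.
Qed.

Lemma dot_suml (I : Type) (r : seq I) (F : I -> X -> C) w :
  dot (fun x => \sum_(i <- r) F i x) w = \sum_(i <- r) dot (F i) w.
Proof. by rewrite /dot exchange_big; apply: eq_bigr => x _;
  rewrite mulr_suml. Qed.

Lemma dot_ge0 u : 0 <= dot u u.
Proof. by apply: sumr_ge0 => x _; apply: mul_conjC_ge0. Qed.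

Lemma dot_eq0 u : dot u u = 0 -> u =1 fun=> 0.
Proof.
move=> /eqP; rewrite /dot psumr_eq0 => [|x _]; last exact: mul_conjC_ge0.
by move=> /allP h x; apply/eqP; rewrite -mul_conjC_eq0; apply: h;
  rewrite mem_index_enum.
Qed.

Fixpoint orthonormal bs : Prop :=
  if bs is b :: bs' then
    [/\ dot b b = 1, forall b', b' \in bs' -> dot b b' = 0 & orthonormal bs']
  else True.

Definition residue bs u : X -> C :=
  fun x => u x - \sum_(b <- bs) dot u b * b x.

Lemma pythagoras bs u : orthonormal bs ->
  dot u u = \sum_(b <- bs) dot u b * (dot u b)^* +
            dot (residue bs u) (residue bs u).
Proof.
elim: bs u => [|b bs IH] u /=.
  by rewrite big_nil add0r => _; apply: eq_dot => x;
    rewrite /residue big_nil subr0.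
case=> b1 bO bsO; pose u' x := u x - dot u b * b x.
have u'b b' : b' \in bs -> dot u' b' = dot u b'.
  by move=> ?; rewrite dotBZl bO // mulr0 subr0.
have -> : dot u u = dot u b * (dot u b)^* + dot u' u'.
  have u'b0 : dot u' b = 0 by rewrite dotBZl b1 mulr1 subrr.
  rewrite dotBZl (dotC b u') u'b0 conjC0 mulr0 subr0.
  by rewrite (dotC u u') dotBZl rmorphB rmorphM /= -!dotC (mulrC (dot b u))
    addrC subrK.
rewrite big_cons -addrA; congr (_ + _); rewrite (IH u') //.
have -> : \sum_(b0 <- bs) dot u' b0 * (dot u' b0)^* =
          \sum_(b0 <- bs) dot u b0 * (dot u b0)^*.
  by rewrite big_seq [RHS]big_seq; apply: eq_bigr => b' ?; rewrite u'b.
congr (_ + _); suff e : residue bs u' =1 residue (b :: bs) u by apply: eq_dot.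
move=> x; rewrite /residue /u' big_cons opprD addrA; congr (_ - _).
by rewrite big_seq [RHS]big_seq; apply: eq_bigr => b' ?; rewrite u'b.
Qed.

Lemma dot_residue bs b u :
  orthonormal bs -> b \in bs -> dot (residue bs u) b = 0.
Proof.
elim: bs u => [|c bs IH] u //= [c1 cO bsO].
pose u' x := u x - dot u c * c x.
have e : residue bs u' =1 residue (c :: bs) u.
  move=> x; rewrite /residue /u' big_cons opprD addrA; congr (_ - _).
  rewrite big_seq [RHS]big_seq; apply: eq_bigr => b' hb'.
  by rewrite dotBZl cO // mulr0 subr0.
rewrite -(eq_dot e (fun=> erefl)) inE => /predU1P[->|]; last exact: IH.
rewrite dotB dot_suml big_seq big1 => [|b' hb'].
  by rewrite dotBZl c1 mulr1 subrr subr0.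
by rewrite dotZl (dotC b') cO // conjC0 mulr0.
Qed.

(** [P] stands for a subspace. The basis has to stay inside it because the marginals are later known
    only for unit vectors of [P]. *)
Lemma gram_schmidt (P : {ffun X -> C} -> Prop)
    (closedP : forall (u v : {ffun X -> C}) a, P u -> P v -> P [ffun x =>
      a * u x + v x])
    (vs : seq {ffun X -> C}) : (forall v : {ffun X -> C}, v \in vs -> P v) ->
  exists bs, [/\ orthonormal bs, (size bs <= size vs)%N,
    forall b, b \in bs -> P b & forall v :
      {ffun X -> C}, v \in vs -> residue bs v =1 fun=> 0].
Proof.
elim: vs => [|v vs IH] Pvs; first by exists [::].
have [|bs [bsO le_bs Pbs res]] := IH.
  by move=> w hw; apply: Pvs; rewrite inE hw orbT.
pose w : {ffun X -> C} := [ffun x => residue bs v x].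
have Pw : P w.
  have Pv : P v by apply: Pvs; rewrite mem_head.
  rewrite /w /residue; elim: bs (dot v) Pbs {bsO le_bs res w} =>
    [|b bs IHb] f Pbs.
    by rewrite (_ : [ffun x => _] = v) //; apply/ffunP => x;
      rewrite ffunE big_nil subr0.
  have -> : [ffun x => v x - \sum_(j <- b :: bs) f j * j x] =
    [ffun x => - f b * b x + [ffun x => v x - \sum_(j <- bs) f j * j x] x].
    by apply/ffunP => x; rewrite !ffunE big_cons mulNr opprD addrCA.
  apply: closedP; first by apply: Pbs; rewrite mem_head.
  by apply: IHb => b' hb'; apply: Pbs; rewrite inE hb' orbT.
have we : w =1 residue bs v by move=> x; rewrite ffunE.
have [w0|w0] := eqVneq (dot w w) 0.
  exists bs; split => //; first exact: leqW.
  move=> u; rewrite inE => /predU1P[->|]; last exact: res.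
  by move=> x; rewrite -we (dot_eq0 w0).
have wbs b : b \in bs -> dot w b = 0.
  by move=> hb; rewrite (eq_dot we (fun=> erefl)) dot_residue.
pose c : C := (sqrtC (dot w w))^-1;
  pose z : {ffun X -> C} := [ffun x => c * w x].
have cR : c^* = c.
  by rewrite geC0_conj // invr_ge0 sqrtC_ge0 dot_ge0.
have zl u : dot z u = c * dot w u.
  by rewrite /dot mulr_sumr; apply: eq_bigr => x _; rewrite ffunE mulrA.
have cw : c * c * dot w w = 1.
  by rewrite /c -invfM -expr2 sqrtCK mulVf.
have zO : orthonormal (z :: bs).
  split=> // [|b' hb']; last by rewrite zl wbs // mulr0.
  by rewrite zl dotC zl rmorphM /= -dotC cR mulrA.
have c0 : c != 0 by rewrite invr_eq0 sqrtC_eq0.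
exists (z :: bs); split => //.
  move=> b; rewrite inE => /predU1P[->|]; last exact: Pbs.
  (* [closedP] adds a multiple to a vector already in [P], so the multiple [c w] is written as
     [(c - 1) w + w]. *)
  suff -> : z = [ffun x => (c - 1) * w x + w x] by apply: closedP.
  by apply/ffunP => x; rewrite !ffunE mulrBl mul1r subrK.
have dz u : dot u z = c * dot u w by rewrite dotC zl rmorphM /= -dotC cR.
have rz u : residue (z :: bs) u =1 (fun x =>
  residue bs u x - c * dot u w * z x).
  by move=> x; rewrite /residue big_cons dz opprD addrCA addrC addrAC.
have dw u : dot u w = dot (residue bs u) w.
  rewrite dotB dot_suml big_seq big1 ?subr0 // => b hb.
  by rewrite dotZl (dotC b) wbs // conjC0 mulr0.
move=> u; rewrite inE => /predU1P[->|hu] x; rewrite rz dw.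
  by rewrite -(eq_dot we (fun=> erefl)) -we [z x]ffunE mulrA (mulrAC c) cw
    mul1r subrr.
by rewrite (eq_dot (res _ hu) (fun=> erefl)) dot0l mulr0 mul0r res // subrr.
Qed.
End Hermitian.

Section Legs.
Variables (C : numClosedFieldType) (X : finType) (k : nat).
Local Notation idx := {ffun 'I_k -> X}.
Implicit Types (z : idx) (s : idx -> C) (K : X -> X -> C) (j : 'I_k).

Definition upd z j (y : X) : idx := [ffun i => if i == j then y else z i].

Lemma updE z j y : upd z j y j = y.
Proof. by rewrite ffunE eqxx. Qed.

Lemma upd_ne z i j y : i != j -> upd z j y i = z i.
Proof. by rewrite ffunE => /negbTE ->. Qed.

Lemma updK z j x y : upd (upd z j x) j y = upd z j y.
Proof. by apply/ffunP => i; rewrite !ffunE; case: eqP. Qed.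

Lemma upd_id z j : upd z j (z j) = z.
Proof. by apply/ffunP => i; rewrite !ffunE; case: eqP => [->|]. Qed.

Lemma updC z i j x y : i != j -> upd (upd z i x) j y = upd (upd z j y) i x.
Proof.
move=> /eqP ne; apply/ffunP => l; rewrite !ffunE.
by case: (l =P j) => [->|//]; case: eqP => // e; case: ne.
Qed.

Lemma sum_swap (V : zmodType) (G : idx -> X -> V) j :
  \sum_z \sum_y G z y = \sum_z \sum_y G (upd z j y) (z j).
Proof.
rewrite !pair_bigA /=.
rewrite (reindex (fun p : idx * X => (upd p.1 j p.2, p.1 j))) //=.
by exists (fun p : idx * X => (upd p.1 j p.2, p.1 j)) => -[z y] _ /=;
  rewrite updE updK upd_id.
Qed.

Lemma sum_upd (V : zmodType) (F : idx -> V) j :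
  \sum_z \sum_y F (upd z j y) = (\sum_z F z) *+ #|X|.
Proof.
rewrite (sum_swap _ j) -sumrMnl; apply: eq_bigr => z _.
by under eq_bigr do rewrite updK upd_id; rewrite sumr_const.
Qed.

Definition leg_op j K s z : C := \sum_y K (z j) y * s (upd z j y).

Lemma eq_leg_op j K s s' : s =1 s' -> leg_op j K s =1 leg_op j K s'.
Proof. by move=> e z; apply: eq_bigr => y _; rewrite e. Qed.

Lemma leg_opC i j K K' s : i != j ->
  leg_op i K (leg_op j K' s) =1 leg_op j K' (leg_op i K s).
Proof.
move=> ne z; rewrite /leg_op.
under eq_bigr do rewrite mulr_sumr; under [RHS]eq_bigr do rewrite mulr_sumr.
rewrite exchange_big; apply: eq_bigr => y _; apply: eq_bigr => x _.
by rewrite !upd_ne // 1?eq_sym // updC // mulrCA.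
Qed.

Definition fiber j s z : X -> C := fun y => s (upd z j y).

(* The contraction of [s] with [u] on leg [j] no longer depends on coordinate
   [j], but it is still summed over it: hence the factors [#|X|] below. *)
Definition marginal j (u : X -> C) s : C :=
  dot (leg_op j (fun _ y => (u y)^*) s) (leg_op j (fun _ y => (u y)^*) s).

Lemma leg_op_dot j u s z :
  leg_op j (fun _ y => (u y)^*) s z = dot (fiber j s z) u.
Proof. by apply: eq_bigr => y _; rewrite mulrC. Qed.

Definition residue_op (bs : seq {ffun X -> C}) : X -> X -> C :=
  fun x y => (x == y)%:R - \sum_(b <- bs) b x * (b y)^*.

Lemma sum_residue_op bs u x :
  \sum_y residue_op bs x y * u y = residue bs u x.
Proof.
rewrite /residue_op; under eq_bigr do rewrite mulrBl.
rewrite sumrB; congr (_ - _).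
  by rewrite (bigD1 x) //= eqxx mul1r big1 ?addr0 // => y /negbTE;
    rewrite eq_sym => ->; rewrite mul0r.
under eq_bigr do rewrite mulr_suml.
rewrite exchange_big /=; apply: eq_bigr => b _; rewrite /dot mulr_suml.
by apply: eq_bigr => y _; rewrite mulrC mulrA mulrAC.
Qed.

Lemma leg_residue bs j s z :
  leg_op j (residue_op bs) s z = residue bs (fiber j s z) (z j).
Proof. by rewrite -sum_residue_op. Qed.

Lemma leg_pythagoras bs j s : orthonormal bs ->
  dot s s *+ #|X| = \sum_(b <- bs) marginal j b s +
    dot (leg_op j (residue_op bs) s) (leg_op j (residue_op bs) s) *+ #|X|.
Proof.
move=> bsO.
rewrite /dot -(sum_upd (fun z => s z * (s z)^*) j).
rewrite -(sum_upd (fun z => leg_op j (residue_op bs) s z *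
  (leg_op j (residue_op bs) s z)^*) j).
have -> : \sum_(b <- bs) marginal j b s =
    \sum_z \sum_(b <- bs) dot (fiber j s z) b * (dot (fiber j s z) b)^*.
  rewrite exchange_big; apply: eq_bigr => b _; apply: eq_bigr => z _.
  by rewrite !leg_op_dot.
rewrite -big_split; apply: eq_bigr => z _ /=.
rewrite -[LHS]/(dot (fiber j s z) (fiber j s z)) (pythagoras _ bsO).
congr (_ + _); apply: eq_bigr => y _; rewrite !leg_residue updE.
suff e : fiber j s (upd z j y) = fiber j s z by rewrite e.
by apply/funext => x; rewrite /fiber updK.
Qed.

Lemma marginal_ge0 j u s : 0 <= marginal j u s.
Proof. exact: dot_ge0. Qed.

Lemma bessel_marginal bs j s : orthonormal bs ->
  \sum_(b <- bs) marginal j b s <= dot s s *+ #|X|.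
Proof.
move=> bsO; rewrite (leg_pythagoras j s bsO) lerDl.
exact: mulrn_wge0 (dot_ge0 _).
Qed.

Lemma leg_residue_le bs j s : orthonormal bs -> (0 < #|X|)%N ->
  dot (leg_op j (residue_op bs) s) (leg_op j (residue_op bs) s) <= dot s s.
Proof.
move=> bsO X0; rewrite -(ler_pMn2r X0) (leg_pythagoras j s bsO) lerDr.
by apply: sumr_ge0 => b _; apply: marginal_ge0.
Qed.

Lemma marginal_residue_le bs i j u s : orthonormal bs -> (0 < #|X|)%N ->
  i != j -> marginal j u (leg_op i (residue_op bs) s) <= marginal j u s.
Proof.
move=> bsO X0 ne; apply: le_trans (leg_residue_le i _ bsO X0).
by rewrite le_eqVlt; apply/orP; left; apply/eqP; apply: eq_dot => z;
  rewrite leg_opC // eq_sym.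
Qed.

Definition leg_ops (K : 'I_k -> X -> X -> C) (js : seq 'I_k) s : idx -> C :=
  foldr (fun j s => leg_op j (K j) s) s js.

(* A quantum union bound: the residue operators of different legs commute and
   are contractions, so the legs can be peeled off one at a time. *)
Lemma union_bound (bs : 'I_k -> seq {ffun X -> C}) (js : seq 'I_k) s :
  (forall j, orthonormal (bs j)) -> (0 < #|X|)%N -> uniq js ->
  dot s s *+ #|X| <= \sum_(j <- js) \sum_(b <- bs j) marginal j b s +
   dot (leg_ops (fun j => residue_op (bs j)) js s)
       (leg_ops (fun j => residue_op (bs j)) js s) *+ #|X|.
Proof.
move=> bsO X0; elim: js => [|j js IH] /=; first by rewrite big_nil add0r.
move=> /andP[nj ujs]; apply: le_trans (IH ujs) _.
set s' := leg_ops _ js s; rewrite (leg_pythagoras j s' (bsO j)) big_cons addrA.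
rewrite lerD2r addrC lerD2r; apply: ler_sum => b _.
rewrite {}/s'; elim: js nj {IH ujs} => [|i js IH] //=.
rewrite inE negb_or => /andP[ne nj]; apply: le_trans (IH nj).
by apply: marginal_residue_le => //; rewrite eq_sym.
Qed.

Definition slice_along j (v : X -> C) s : Prop :=
  exists c : idx -> C, forall z y, s (upd z j y) = c z * v y.

Lemma slice_along_ne i j K v s : i != j ->
  slice_along j v s -> slice_along j v (leg_op i K s).
Proof.
move=> ne [c hc]; exists (leg_op i K c) => z y.
rewrite /leg_op mulr_suml; apply: eq_bigr => x _.
by rewrite upd_ne // -updC // hc mulrA.
Qed.

Lemma slice_along_eq j K v s : slice_along j v s ->
  slice_along j (fun x => \sum_y K x y * v y) (leg_op j K s).
Proof.
move=> [c hc]; exists c => z y.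
rewrite /leg_op mulr_sumr; apply: eq_bigr => x _.
by rewrite updE updK hc mulrCA.
Qed.

(** Operators on other legs leave the vector [v] of the slice alone, so of the whole product only
    [K j] acts on it. *)
Lemma slice_along_ops (K : 'I_k -> X -> X -> C) j v s js :
  uniq js -> j \in js ->
  slice_along j v s ->
  slice_along j (fun x => \sum_y K j x y * v y) (leg_ops K js s).
Proof.
move=> + + hs; elim: js => [|i js IH] //= /andP[ni ujs].
rewrite inE => /predU1P[e|hj].
  rewrite -e; apply: slice_along_eq; rewrite -{}e {ujs IH} in ni.
  elim: js ni => [|l js IH] //=; rewrite inE negb_or => /andP[ne nj].
  by apply: slice_along_ne (IH nj); rewrite eq_sym.
apply: slice_along_ne (IH ujs hj).
by apply: contraNneq ni => ->.
Qed.

Lemma slice_along0 j v s : slice_along j v s -> v =1 (fun=> 0) -> s =1 fun=> 0.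
Proof. by move=> [c hc] v0 z; rewrite -(upd_id z j) hc v0 mulr0. Qed.

Lemma leg_op_sum (I : Type) (r : seq I) (F : I -> idx -> C) j K :
  leg_op j K (fun z => \sum_(i <- r) F i z) =1
  fun z => \sum_(i <- r) leg_op j K (F i) z.
Proof.
move=> z; rewrite /leg_op exchange_big; apply: eq_bigr => y _.
by rewrite mulr_sumr.
Qed.

Lemma leg_ops_sum (I : Type) (r : seq I) (F : I -> idx -> C)
    (K : 'I_k -> X -> X -> C) js :
  leg_ops K js (fun z => \sum_(i <- r) F i z) =1
  fun z => \sum_(i <- r) leg_ops K js (F i) z.
Proof.
elim: js => [|j js IH] //= z.
by rewrite (eq_leg_op _ _ IH) leg_op_sum.
Qed.

Lemma eq_leg_ops (K : 'I_k -> X -> X -> C) js s s' :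
  s =1 s' -> leg_ops K js s =1 leg_ops K js s'.
Proof. by move=> e; elim: js => [|j js IH] //=; apply: eq_leg_op. Qed.

End Legs.

(** * Polytabloids and Schur's lemma *)

Section Tableau.
Variables (n L : nat).
Local Notation word := {ffun 'I_n -> 'I_L}.
Implicit Types (x y : word) (s : 'S_n).

Definition wperm x s : word := [ffun a => x (s a)].

Lemma wpermK s : cancel (wperm^~ s) (wperm^~ s^-1%g).
Proof. by move=> x; apply/ffunP => a; rewrite !ffunE permKV. Qed.

Lemma wpermKV s : cancel (wperm^~ s^-1%g) (wperm^~ s).
Proof. by move=> x; apply/ffunP => a; rewrite !ffunE permK. Qed.

Lemma wpermM x s s' : wperm (wperm x s) s' = wperm x (s' * s)%g.
Proof. by apply/ffunP => a; rewrite !ffunE permM. Qed.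

Lemma wperm1 x : wperm x 1%g = x.
Proof. by apply/ffunP => a; rewrite !ffunE perm1. Qed.

Definition content x : {ffun 'I_L -> nat} := [ffun i => #|[set a | x a == i]|].

Lemma content_wperm x s : content (wperm x s) = content x.
Proof.
apply/ffunP => i; rewrite !ffunE.
rewrite -(card_imset _ (@perm_inj _ s)); apply: eq_card => a.
rewrite [RHS]inE; apply/imsetP/eqP => [[b]|xa].
  by rewrite inE ffunE => /eqP <- ->.
by exists (s^-1%g a); rewrite ?inE ?ffunE permKV // xa.
Qed.

Variables (r : word) (c : {ffun 'I_n -> 'I_n}).

(* The filling of a Young diagram by 'I_n, up to the order of its columns:
   [r a] and [c a] are the row and the column of the entry [a]. *)
Definition tableau : Prop :=
  (forall a b, r a = r b -> c a = c b -> a = b) /\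
  (forall a (i : 'I_L), (i < r a)%N -> exists2 b, c b = c a & r b = i).

(** Compare, in each column, the number of letters below [i] in [x] and in [r]. A column of [r] that
    reaches row [i] contains every letter below [i], and a shorter one has only such letters; as [x]
    does not repeat letters in a column, its count is never larger. Equal contents make the totals
    over all columns agree, so the counts agree column by column. *)
Lemma column_perm x : tableau -> content x = content r ->
  (forall a b, c a = c b -> x a = x b -> a = b) ->
  exists2 s : 'S_n, forall a, c (s a) = c a & x = wperm r s.
Proof.
move=> [injT downT] cx dist.
pose S (w : word) d i := [set a | (c a == d) && (w a < i)%N].
have leS d i : (#|S x d i| <= #|S r d i|)%N.
  have [/existsP[a /andP[/eqP ca ra]]|/existsPn nex] :=
      boolP [exists a, (c a == d) && (i <= r a)%N].
    have injx : {in S x d i &, injective x}.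
      move=> a1 a2; rewrite !inE => /andP[/eqP c1 _] /andP[/eqP c2 _] e.
      by apply: dist => //; rewrite c1 c2.
    rewrite -(card_in_imset injx).
    apply: leq_trans (leq_imset_card r (S r d i)).
    apply/subset_leq_card/fintype.subsetP => l /imsetP[b];
      rewrite inE => /andP[_ lb ->].
    have [|b' cb' rb'] := downT a (x b); first exact: leq_trans lb ra.
    by apply/imsetP; exists b'; rewrite // inE cb' ca eqxx rb'.
  apply/subset_leq_card/fintype.subsetP => a; rewrite !inE => /andP[ca _].
  by have := nex a; rewrite ca /= -ltnNge.
have sumS w i : (\sum_d #|S w d i| = \sum_(l < L | l < i) content w l)%N.
  transitivity #|[set a | (w a < i)%N]|.
    rewrite -[RHS]sum1_card [RHS](partition_big c xpredT) //=;
      apply: eq_bigr => d _.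
    by rewrite -sum1_card; apply: eq_bigl => a; rewrite !inE andbC.
  rewrite -sum1_card (partition_big w (fun l : 'I_L => l < i)%N) => [|a];
    last by rewrite inE.
  apply: eq_bigr => l li; rewrite ffunE -sum1_card; apply: eq_bigl => a.
  by rewrite !inE; case: eqP => [->|]; rewrite ?andbF ?li.
have eqS d i : #|S x d i| = #|S r d i|.
  have h (d' : 'I_n) : true -> (#|S x d' i| <= #|S r d' i| ?= iff
    (#|S x d' i| == #|S r d' i|))%N by move=> _; exact: leqif_eq.
  have [_] := leqif_sum h; rewrite !sumS cx eqxx => /esym/forallP/(_ d).
  by move=> /eqP.
have ex a : exists b, (c b == c a) && (r b == x a).
  have : S x (c a) (x a).+1 != S x (c a) (x a).
    by apply/eqP => /setP/(_ a); rewrite !inE eqxx ltnS leqnn ltnn.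
  have sub w d i : S w d i \subset S w d i.+1.
    by apply/fintype.subsetP => b; rewrite !inE => /andP[-> /leqW].
  rewrite eq_sym eqEcard sub -ltnNge !eqS => lt.
  have : S r (c a) (x a).+1 :\: S r (c a) (x a) != finset.set0.
    by rewrite -card_gt0 cardsDS ?sub // subn_gt0.
  case/set0Pn => b; rewrite !inE; case cb: (c b == c a) => //= /andP[h1 h2].
  exists b; rewrite cb /=; apply/eqP/val_inj/eqP.
  by rewrite eqn_leq -ltnS h2 leqNgt.
pose f a := xchoose (ex a).
have fP a : c (f a) = c a /\ r (f a) = x a.
  by have /andP[/eqP ? /eqP] := xchooseP (ex a).
have injf : injective f.
  move=> a b e; have [ca ra] := fP a; have [cb rb] := fP b.
  by apply: dist; [rewrite -ca -cb e | rewrite -ra -rb e].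
exists (perm injf) => [a|]; first by rewrite permE; case: (fP a).
by apply/ffunP => a; rewrite ffunE permE; case: (fP a).
Qed.

Variable C : numClosedFieldType.

(* The coordinates of the polytabloid of [(r, c)], as a determinant. *)
Definition ptab (x : word) : C :=
  \det (\matrix_(a, b) ((c a == c b) && (x a == r b))%:R).

Lemma ptab_col x s : (forall a, c (s a) = c a) ->
  ptab (wperm x s) = (-1) ^+ s * ptab x.
Proof.
move=> cs; rewrite -det_perm -det_mulmx -row_permE; congr (\det _).
by apply/matrixP => a b; rewrite !mxE ffunE cs.
Qed.

Lemma ptab_row : tableau -> ptab r = 1.
Proof.
move=> [injT _]; rewrite -(det1 C n); congr (\det _).
apply/matrixP => a b; rewrite !mxE; congr (_%:R); congr nat_of_bool.
apply/andP/eqP => [[/eqP ca /eqP ra]|->]; last by rewrite !eqxx.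
exact: injT.
Qed.

Lemma ptab_neq0 x : ptab x != 0 ->
  exists2 s : 'S_n, forall a, c (s a) = c a & x = wperm r s.
Proof.
move=> nz; suff /existsP[s /forallP hs] :
    [exists s : 'S_n, forall a, (c a == c (s a)) && (x a == r (s a))].
  exists s => [a|]; first by have /andP[/eqP] := hs a.
  by apply/ffunP => a; rewrite ffunE; have /andP[_ /eqP] := hs a.
apply: contraNT nz => /existsPn nex; apply/eqP; apply: big1 => s _.
have /forallPn[a ha] := nex s.
by rewrite (bigD1 a) //= mxE (negbTE ha) mul0r mulr0.
Qed.

Lemma ptab_content x : ptab x != 0 -> content x = content r.
Proof. by case/ptab_neq0 => s _ ->; rewrite content_wperm. Qed.

Lemma conj_ptab x : (ptab x)^* = ptab x.
Proof.
rewrite /ptab -det_map_mx; congr (\det _).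
by apply/matrixP => a b; rewrite !mxE rmorph_nat.
Qed.

(* James' submodule argument: up to column permutations, [r] is the only word of
   its content without a repeated letter in some column. *)
Lemma antisymmetric_ptab (u : word -> C) : tableau ->
  (forall x (s : 'S_n), (forall a, c (s a) = c a) ->
     u (wperm x s) = (-1) ^+ s * u x) ->
  (forall x, u x != 0 -> content x = content r) ->
  forall x, u x = u r * ptab x.
Proof.
move=> T anti supp x.
have [cx|cx] := eqVneq (content x) (content r); last first.
  have -> : u x = 0 by apply: contraNeq cx => /supp ->.
  have [->|/ptab_content e] := eqVneq (ptab x) 0; first by rewrite mulr0.
  by rewrite e eqxx in cx.
have [/existsP[a /existsP[b /and3P[ne /eqP cab /eqP xab]]]|nex] :=
    boolP [exists a, exists b, [&& a != b, c a == c b & x a == x b]].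
  have ct a' : c (tperm a b a') = c a' by case: tpermP => [->|->|].
  have xt : wperm x (tperm a b) = x.
    by apply/ffunP => a'; rewrite ffunE; case: tpermP => [->|->|].
  have z (v : word -> C) : v (wperm x (tperm a b)) = (-1) ^+ (tperm a b) * v x
    -> v x = 0.
    rewrite xt odd_tperm ne expr1 mulN1r => /eqP.
    by rewrite -subr_eq0 opprK -mulr2n mulrn_eq0 /= => /eqP.
  have -> : u x = 0 by apply: z; apply: anti.
  have -> : ptab x = 0 by apply: z; apply: ptab_col.
  by rewrite mulr0.
have [a b cab xab|s cs ->] := column_perm T cx.
  apply: contraNeq nex => ne; apply/existsP; exists a; apply/existsP; exists b.
  by rewrite ne cab xab !eqxx.
by rewrite anti // ptab_col // ptab_row // mulr1 mulrC.
Qed.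

Definition equivariant (K : word -> word -> C) :=
  (forall x y s, K (wperm x s) (wperm y s) = K x y) /\
  (forall x y, K x y != 0 -> content x = content r).

Definition scalar_of (K : word -> word -> C) : C := \sum_y K r y * ptab y.

(** [K] commutes with permutations, so the image of the polytabloid keeps the antisymmetry along
    columns, and its content is that of [r]. By [antisymmetric_ptab] it is a multiple of the
    polytabloid, and since [ptab r = 1] the factor is its value at [r]. *)
Lemma schur_ptab K s x : tableau -> equivariant K ->
  \sum_y K x y * ptab (wperm y s) = scalar_of K * ptab (wperm x s).
Proof.
move=> T [eqK suppK].
have -> : \sum_y K x y * ptab (wperm y s) = \sum_y K (wperm x s) y * ptab y.
  rewrite [RHS](reindex (wperm^~ s)) /=.
    by apply: eq_bigr => y _; rewrite eqK.
  by exists (wperm^~ s^-1%g) => y _; [apply: wpermK | apply: wpermKV].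
apply: (@antisymmetric_ptab (fun x => \sum_y K x y * ptab y)) => // {x s} x.
  move=> s cs; rewrite mulr_sumr (reindex (wperm^~ s)) /=.
    by apply: eq_bigr => y _; rewrite eqK ptab_col // mulrCA.
  by exists (wperm^~ s^-1%g) => y _; [apply: wpermK | apply: wpermKV].
apply: contra_neq_eq => cx; rewrite big1 // => y _.
by have [->|/suppK e] := eqVneq (K x y) 0;
  [rewrite mul0r | rewrite e eqxx in cx].
Qed.

(* A multiple of the orthogonal projection onto the Specht module spanned by the
   permuted polytabloids, by Schur's lemma. *)
Definition gram x y : C := \sum_(s : 'S_n) ptab (wperm x s) * ptab (wperm y s).

Lemma gram_equivariant : equivariant gram.
Proof.
split=> [x y s|x y].
  rewrite [RHS](reindex_inj (mulIg s)); apply: eq_bigr => s' _.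
  by rewrite !wpermM.
apply: contra_neq_eq => cx; rewrite /gram big1 // => s _.
have [->|/ptab_content] := eqVneq (ptab (wperm x s)) 0; first by rewrite mul0r.
by rewrite content_wperm => e; rewrite e eqxx in cx.
Qed.

Lemma gramC x y : gram x y = gram y x.
Proof. by apply: eq_bigr => s _; rewrite mulrC. Qed.

(** Pairing [gram] with the polytabloid on both sides gives the sum over [s] of the squares of the
    real numbers [V s], and [V 1] is the positive squared norm of the polytabloid. *)
Lemma scalar_of_gram : tableau -> scalar_of gram != 0.
Proof.
move=> T; pose V s := \sum_x ptab x * ptab (wperm x s).
have V1 : V 1%g != 0.
  rewrite /V psumr_eq0 => [|x _];
    last by rewrite wperm1 -{2}conj_ptab mul_conjC_ge0.
  apply/allPn; exists r; first by rewrite mem_index_enum.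
  by rewrite /= wperm1 ptab_row // mulr1 oner_eq0.
have VV s : 0 <= V s * V s.
  suff e : (V s)^* = V s by rewrite -{2}e mul_conjC_ge0.
  by rewrite /V rmorph_sum; apply: eq_bigr => x _;
    rewrite rmorphM /= !conj_ptab.
have : 0 < \sum_s V s * V s.
  rewrite (bigD1 1%g) //=; apply: ltr_wpDr; first exact: sumr_ge0.
  by rewrite lt_def VV mulf_neq0.
have -> : \sum_s V s * V s = scalar_of gram * V 1%g.
  rewrite /V mulr_sumr; transitivity (\sum_x \sum_y \sum_s
      (ptab x * ptab (wperm x s)) * (ptab y * ptab (wperm y s))); last first.
    apply: eq_bigr => x _.
    rewrite mulrCA -(schur_ptab _ _ T gram_equivariant) mulr_sumr.
    apply: eq_bigr => y _; rewrite wperm1 [gram _ _ * _]mulr_suml mulr_sumr.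
    apply: eq_bigr => s _; rewrite -!mulrA; congr (_ * (_ * _)).
    by rewrite mulrC.
  under [RHS]eq_bigr do rewrite exchange_big /=.
  rewrite [RHS]exchange_big; apply: eq_bigr => s _.
  by rewrite mulr_suml; apply: eq_bigr => x _; rewrite mulr_sumr.
by move=> gt0; apply: contraTneq gt0 => ->; rewrite mul0r ltxx.
Qed.
End Tableau.

(** * Dimension of the Specht module *)

Section Lex.
Variables (n L : nat).
Local Notation word := {ffun 'I_n -> 'I_L}.
Implicit Types (x y z : word).

Definition lexlt x y : bool :=
  [exists a, (x a < y a)%N && [forall b : 'I_n, (b < a)%N ==> (x b == y b)]].

Lemma lexltP x y :
  reflect (exists2 a, (x a < y a)%N & forall b : 'I_n, (b < a)%N -> x b = y b)
          (lexlt x y).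
Proof.
apply: (iffP existsP) => [[a /andP[lt /forallP h]]|[a lt h]]; exists a => //.
  by move=> b lb; apply/eqP; have := h b; rewrite lb.
by rewrite lt; apply/forallP => b; apply/implyP => /h ->.
Qed.

Lemma lexltxx x : lexlt x x = false.
Proof. by apply/lexltP => -[a]; rewrite ltnn. Qed.

Lemma lexlt_trans : transitive lexlt.
Proof.
move=> y x z /lexltP[a lta ha] /lexltP[b ltb hb]; apply/lexltP.
have [ab|ba|/val_inj e] := ltngtP a b.
- exists a => [|d da]; first by rewrite -hb.
  by rewrite ha // hb // (ltn_trans da).
- exists b => [|d db]; first by rewrite ha.
  by rewrite ha ?hb // (ltn_trans db).
- exists a => [|d da]; first by apply: ltn_trans lta _; rewrite e.
  by rewrite ha ?hb // -e.
Qed.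

Lemma lexlt_first x y : y <> x ->
  (forall a : 'I_n, (forall b : 'I_n, (b < a)%N -> y b = x b) -> y a <> x a ->
     (x a < y a)%N) -> lexlt x y.
Proof.
move=> ne h; have /existsP[a0 ha0] : [exists a, y a != x a].
  by apply: contra_notT ne => /existsPn e; apply/ffunP => a; apply/eqP;
    rewrite -[_ == _]negbK.
case: (@arg_minnP _ a0 (fun a => y a != x a) val ha0) => a ha hmin.
apply/lexltP.
have eb (b : 'I_n) : (b < a)%N -> y b = x b.
  by move=> lt; apply/eqP; apply: contraTT lt => /hmin; rewrite -leqNgt.
by exists a => [|b /eb //]; apply: h => //; apply/eqP.
Qed.

Lemma triangular_row_free (F : fieldType) (D : nat) (w : 'I_D -> word)
    (A : 'M[F]_D) : injective w -> (forall i, A i i != 0) ->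
  (forall i j, i != j -> A i j != 0 -> lexlt (w i) (w j)) -> row_free A.
Proof.
move=> winj A1 Alt; rewrite -kermx_eq0; apply/rowV0P => u /sub_kermxP uA.
apply/rowP => i0; rewrite mxE; apply/eqP; apply: contraT => u0.
(* The number of smaller words turns the order [lexlt] into a natural number that can be
   minimized. *)
pose m i := #|[pred x | lexlt x (w i)]|.
case: (@arg_minnP _ i0 (fun i => u 0 i != 0) m u0) => j uj hmin.
have /rowP/(_ j) := uA; rewrite !mxE (bigD1 j) //= big1 ?addr0.
  by move=> /eqP; rewrite mulf_eq0 (negbTE uj) (negbTE (A1 j)).
move=> i ne; have [-> |ui] := eqVneq (u 0 i) 0; first by rewrite mul0r.
have [-> |/(Alt _ _ ne) lt] := eqVneq (A i j) 0; first by rewrite mulr0.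
have := hmin i ui; rewrite leqNgt => /negP[]; apply: proper_card.
apply/properP; split; last by exists (w i); rewrite !inE ?lexltxx.
by apply/fintype.subsetP => x; rewrite !inE => /lexlt_trans; apply.
Qed.

Definition prefix_count x (a : 'I_n) (i : 'I_L) := #|[set b :
  'I_n | (b <= a)%N && (x b == i)]|.

Definition ballot x : Prop := forall (a : 'I_n) (i j : 'I_L), (i < j)%N ->
  (prefix_count x a j <= prefix_count x a i)%N.

(** When a ballot word is read as the standard tableau with the entry [a] in row [x a], this is the
    column of [a], counted from 0. *)
Definition occ x (a : 'I_n) := #|[set b : 'I_n | (b < a)%N && (x b == x a)]|.

Lemma prefix_count_occ x a : prefix_count x a (x a) = (occ x a).+1.
Proof.
transitivity #|a |: [set b : 'I_n | (b < a)%N && (x b == x a)]|;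
  last by rewrite cardsU1 inE ltnn.
apply: eq_card => b.
rewrite !inE leq_eqVlt; case: eqP => [/val_inj ->|]; rewrite ?eqxx //=.
by move/eqP => ne; rewrite (_ : (b == a) = false) //; apply/negbTE.
Qed.

Lemma prefix_count_lt x (a b : 'I_n) : (b < a)%N ->
  (prefix_count x b (x a) <= occ x a)%N.
Proof.
move=> lt; apply/subset_leq_card/fintype.subsetP => d;
  rewrite !inE => /andP[h ->].
by rewrite (leq_ltn_trans h lt).
Qed.

Lemma occ_lt x (a b : 'I_n) : (b < a)%N -> x a = x b -> (occ x b < occ x a)%N.
Proof. by move=> lt e; rewrite -prefix_count_occ -e prefix_count_lt. Qed.

Lemma occ_inj x a b : x a = x b -> occ x a = occ x b -> a = b.
Proof.
move=> e eo; apply/val_inj; case: (ltngtP a b) => // lt.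
  by have := occ_lt lt (esym e); rewrite eo ltnn.
by have := occ_lt lt e; rewrite eo ltnn.
Qed.

Lemma occ_content x a : (occ x a < content x (x a))%N.
Proof.
rewrite ffunE -prefix_count_occ; apply/subset_leq_card/fintype.subsetP => b.
by rewrite !inE => /andP[].
Qed.
End Lex.

Section Standard.
Variables (n L : nat).
Local Notation word := {ffun 'I_n -> 'I_L}.
Variables (r : word) (c : {ffun 'I_n -> 'I_n}).

Definition height (d : 'I_n) := \max_(b | c b == d) (r b).+1.

(** The columns of a [tableau] come in no particular order. Sorting them by decreasing height, with
    ties broken by index, straightens the filling into a Young diagram in which [rank_col] is the
    column number. *)
Definition before (d' d : 'I_n) :=
  (height d < height d')%N || ((height d == height d') && (d' < d)%N).

Definition rank_col d := #|[set d' | before d' d]|.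

Lemma rank_col_inj : injective rank_col.
Proof.
have tr : transitive before.
  move=> y x z; rewrite /before =>
    /orP[h1|/andP[/eqP -> h1]] /orP[h2|/andP[/eqP -> h2]].
  - by rewrite (ltn_trans h2 h1).
  - by rewrite h1.
  - by rewrite h2.
  - by rewrite eqxx (ltn_trans h1 h2) orbT.
have lt d d' : before d' d -> (rank_col d' < rank_col d)%N.
  move=> h; apply: proper_card; apply/properP; split.
    by apply/fintype.subsetP => e; rewrite !inE => /tr; apply.
  by exists d'; rewrite !inE // /before !ltnn andbF.
move=> d d' e; apply/eqP; apply: contraT => ne.
suff /orP[/lt|/lt] : before d d' || before d' d by rewrite e ltnn.
rewrite /before; case: (ltngtP (height d) (height d')) => //= _.
by rewrite -neq_ltn.
Qed.

(** The columns sorted before [c a] are at least as high as [c a], so all of them meet the row of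
    [a]. *)
Lemma rank_col_lt a : tableau r c -> (rank_col (c a) < content r (r a))%N.
Proof.
move=> [_ downT].
have ni : c a \notin [set d' | before d' (c a)] by rewrite inE /before !ltnn
  andbF.
suff : (#|c a |: [set d' | before d' (c a)]| <= content r (r a))%N
  by rewrite cardsU1 ni.
rewrite ffunE.
apply: leq_trans (leq_imset_card c _).
apply/subset_leq_card/fintype.subsetP => d hd.
have hh : (height (c a) <= height d)%N.
  move: hd; rewrite !inE => /orP[/eqP ->//|/orP[/ltnW //|/andP[/eqP -> //]]].
have lt : (r a < height d)%N.
  by apply: leq_trans hh; rewrite /height;
    apply: (@leq_bigmax_cond _ _ (fun b => (r b).+1)).
have [b cb rb] : exists2 b, c b = d & (r a <= r b)%N.
  have [/existsP[b /andP[/eqP cb rb]]|/existsPn nex] :=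
    boolP [exists b, (c b == d) && (r a <= r b)%N]; first by exists b.
  move: lt; rewrite ltnNge /height => /negP[]; apply/bigmax_leqP => b cb.
  by have := nex b; rewrite cb /= -ltnNge.
have [e|lt'] := leqP (r b) (r a).
  have e' : r b = r a by apply/val_inj/eqP; rewrite eqn_leq e rb.
  by apply/imsetP; exists b; rewrite ?inE ?e' ?cb.
have [b' cb' rb'] := downT b (r a) lt'.
by apply/imsetP; exists b'; rewrite ?inE ?rb' ?eqxx // cb' cb.
Qed.

(** The entries of row [i] have distinct column ranks, all below the length of the row, so every
    such rank is taken. *)
Lemma cell_ex (i : 'I_L) p : tableau r c -> (p < content r i)%N ->
  exists a, (r a == i) && (rank_col (c a) == p).
Proof.
move=> T lt; have [injT _] := T.
pose R := [set a | r a == i]; pose f a : 'I_n.+1 := inord (rank_col (c a)).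
have fE a : f a = rank_col (c a) :> nat.
  by rewrite inordK // ltnS; apply: leq_trans (max_card _) _; rewrite card_ord.
have cR : content r i = #|R| by rewrite ffunE.
have fR : {in R &, injective f}.
  move=> a b; rewrite !inE => /eqP ra /eqP rb e; apply: injT;
    first by rewrite ra.
  by apply: rank_col_inj; rewrite -!fE e.
have leR : (#|R| <= n)%N by apply: leq_trans (max_card _) _; rewrite card_ord.
have ltp : (p < n.+1)%N by rewrite ltnS (leq_trans (ltnW lt)) // cR.
have : f @: R == [set q : 'I_n.+1 | (q < #|R|)%N].
  rewrite eqEcard; apply/andP; split.
    apply/fintype.subsetP => q /imsetP[a]; rewrite !inE => /eqP ra ->.
    by rewrite fE -cR -ra rank_col_lt.
  rewrite card_in_imset //.
  have -> : [set q : 'I_n.+1 | (q < #|R|)%N] = (fun q : 'I_#|R| =>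
    inord q) @: [set: 'I_#|R|].
    apply/setP => q; rewrite inE; apply/idP/imsetP => [h|[q' _ ->]].
      by exists (Ordinal h); rewrite ?inE //; apply: val_inj; rewrite /= inordK.
    by rewrite inordK // ltnS (leq_trans _ leR) // ltnW.
  by apply: leq_trans (leq_imset_card _ _) _; rewrite cardsT card_ord.
move=> /eqP/setP/(_ (Ordinal ltp)); rewrite inE -cR lt => /imsetP[a].
rewrite inE => /eqP ra e; exists a; rewrite ra eqxx -fE /=; apply/eqP.
by rewrite -e.
Qed.

Variable C : numClosedFieldType.

(** The permutation [s] puts the entry [a] into the cell [(x a, occ x a)]. The ballot condition
    makes this filling standard, so letters increase along each column. Another word [y] in the
    support arises from a column permutation [g]. If at the first difference [a] the letter of [y]
    were smaller, then [g a] would precede [a], hence be a place where [x] and [y] agree, and this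
    would force [g] to fix [g a]. *)
Lemma standard_word (x : word) : tableau r c -> content x = content r ->
  ballot x ->
  exists s : 'S_n, ptab r c C (wperm x s) = 1 /\
    forall y, y <> x -> ptab r c C (wperm y s) != 0 -> lexlt x y.
Proof.
move=> T cx bx; have [injT _] := T.
have ex a : exists a', (r a' == x a) && (rank_col (c a') == occ x a).
  by apply: cell_ex => //; rewrite -cx occ_content.
pose f a := xchoose (ex a).
have fP a : r (f a) = x a /\ rank_col (c (f a)) = occ x a.
  by have /andP[/eqP ? /eqP] := xchooseP (ex a).
have injf : injective f.
  move=> a b e; have [ra oa] := fP a; have [rb ob] := fP b.
  by apply: (@occ_inj _ _ x); rewrite -?ra -?rb -?oa -?ob e.
pose s := perm injf; have sE a : s a = f a by rewrite permE.
have xE : x = wperm r s.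
  by apply/ffunP => a; rewrite ffunE sE; case: (fP a).
exists s^-1%g; split; first by rewrite xE wpermK ptab_row.
move=> y ne /ptab_neq0[q cq yq].
pose g a := (s^-1)%g (q (s a)).
have yE a : y a = x (g a).
  by rewrite -(@wpermKV _ _ s y) yq xE !ffunE /g permKV.
have cg a : c (s (g a)) = c (s a) by rewrite /g permKV cq.
have ginj : injective g by move=> a b /perm_inj/perm_inj/perm_inj.
have incr a b : c (s a) = c (s b) -> (x a < x b)%N -> (a < b)%N.
  move=> e lt; have eo : occ x a = occ x b.
    by have [_ <-] := fP a; have [_ <-] := fP b; rewrite -!sE e.
  rewrite ltnNge leq_eqVlt; apply/negP => /orP[/eqP/val_inj ab|ba].
    by rewrite ab ltnn in lt.
  have := bx b _ _ lt; rewrite prefix_count_occ -eo leqNgt ltnS.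
  by rewrite prefix_count_lt.
have inj a b : c (s a) = c (s b) -> x a = x b -> a = b.
  move=> e xab; apply: (@perm_inj _ s); apply: injT => //.
  by move: xab; rewrite xE !ffunE.
apply: lexlt_first => // a first nea; rewrite ltnNge leq_eqVlt.
apply/negP => /orP[/eqP/val_inj //|lt].
have ga : (g a < a)%N by apply: incr; rewrite ?cg // -yE.
have : g (g a) = g a by apply: inj; rewrite ?cg // -yE first.
by move=> /ginj e; rewrite e ltnn in ga.
Qed.

(** The permuted polytabloids chosen for the words of [ws] have a triangular matrix of coordinates
    at these words, hence rank [size ws]. Expanding them in an orthonormal family [bs] factors this
    matrix through dimension [size bs]. *)
Lemma many_orthonormal (P : {ffun word -> C} -> Prop)
    (closedP : forall (u v : {ffun word -> C}) a,
       P u -> P v -> P [ffun x => a * u x + v x])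
    (ws : seq word) : tableau r c -> uniq ws ->
  (forall x, x \in ws -> content x = content r /\ ballot x) ->
  (forall s, P [ffun x => ptab r c C (wperm x s)]) ->
  exists bs, [/\ orthonormal bs, (size ws <= size bs)%N &
                 forall b, b \in bs -> P b].
Proof.
move=> T uws bws Ps.
have ex (x : word) : exists s : 'S_n, x \in ws -> ptab r c C (wperm x s) = 1 /\
    forall y, y <> x -> ptab r c C (wperm y s) != 0 -> lexlt x y.
  have [/bws[cx bx]|] := boolP (x \in ws); last by exists 1%g.
  by have [s hs] := standard_word T cx bx; exists s.
have [sg sgP] := choice ex.
pose v x : {ffun word -> C} := [ffun y => ptab r c C (wperm y (sg x))].
have [|bs [bsO _ Pbs res]] := gram_schmidt closedP (vs := map v ws).
  by move=> w /mapP[x _ ->]; apply: Ps.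
exists bs; split => //; pose D := size ws; pose e := size bs.
case: (posnP (size ws)) => [->//|ws0].
have x0 : word by case: (ws) ws0.
pose w (i : 'I_D) := nth x0 ws i.
have wws i : w i \in ws by apply: mem_nth.
pose A : 'M[C]_D := \matrix_(i, j) v (w i) (w j).
have frA : row_free A.
  apply: (@triangular_row_free _ _ _ _ w).
  - by move=> i j /eqP; rewrite nth_uniq // => /eqP/val_inj.
  - by move=> i; rewrite mxE ffunE; have [-> _] := sgP _ (wws i);
    rewrite oner_eq0.
  - move=> i j ne; rewrite mxE ffunE; have [_] := sgP _ (wws i); apply.
    by apply/eqP; rewrite nth_uniq // eq_sym.
have AE : A = (\matrix_(i < D, l < e) dot (v (w i)) bs`_l) *m (\matrix_(l < e,
  j < D) bs`_l (w j)).
  apply/matrixP => i j; rewrite !mxE.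
  have := res (v (w i)) (map_f v (wws i)) (w j); rewrite /residue.
  move/eqP; rewrite subr_eq0 => /eqP ->; rewrite (big_nth 0) big_mkord.
  by apply: eq_bigr => l _; rewrite !mxE.
apply: (@leq_trans (\rank A)); first by rewrite (eqP frA).
by rewrite AE; apply: mulmx_max_rank.
Qed.
End Standard.

(** * Slices of an invariant tensor *)

Section Pairing.
Variables (C : numClosedFieldType) (X : finType) (k : nat).
Local Notation idx := {ffun 'I_k -> X}.
Implicit Types (s : idx -> C) (u : 'I_k -> X -> C) (K : X -> X -> C).

Definition pairing s u : C := \sum_z s z * \prod_i u i (z i).

Lemma pairing_leg_op j K g s u :
  (forall y, \sum_x K x y * u j x = g * u j y) ->
  pairing (leg_op j K s) u = g * pairing s u.
Proof.
move=> eig; rewrite /pairing mulr_sumr; under eq_bigr do rewrite mulr_suml.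
rewrite (sum_swap _ j); apply: eq_bigr => z _.
transitivity (\sum_y (K y (z j) * u j y) * (s z * \prod_(i | i != j) u i (z
  i))).
  apply: eq_bigr => y _; rewrite updE updK upd_id (bigD1 j) //= updE.
  rewrite -mulrA mulrCA !mulrA; congr (_ * _); last first.
    by apply: eq_bigr => i ne; rewrite upd_ne.
  by rewrite -mulrA mulrC.
rewrite -mulr_suml eig [in RHS](bigD1 j) //= -mulrA; congr (_ * _).
by rewrite mulrCA.
Qed.
End Pairing.

Section Core.
Variables (C : numClosedFieldType) (n L k : nat).
Local Notation word := {ffun 'I_n -> 'I_L}.
Local Notation idx := {ffun 'I_k -> word}.
Variables (r : 'I_k -> word) (c : 'I_k -> {ffun 'I_n -> 'I_n}).

Definition zperm (z : idx) (s : 'S_n) : idx := [ffun j => wperm (z j) s].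

Lemma zperm_upd z s j y : zperm (upd z j y) s = upd (zperm z s) j (wperm y s).
Proof. by apply/ffunP => i; rewrite !ffunE; case: eqP. Qed.

Definition invariant_tensor (t : idx -> C) := forall z s, t (zperm z s) = t z.

Lemma sum_wperm (F : word -> C) s : \sum_y F (wperm y s) = \sum_y F y.
Proof.
rewrite [RHS](reindex (fun y : word => wperm y s)) //=.
by exists (fun y : word => wperm y s^-1%g) => y _;
  [apply: wpermK | apply: wpermKV].
Qed.

Lemma sum_zperm (F : idx -> C) s : \sum_z F (zperm z s) = \sum_z F z.
Proof.
rewrite [RHS](reindex (zperm^~ s)) //=.
by exists (zperm^~ s^-1%g) => z _; apply/ffunP => j;
  rewrite !ffunE ?wpermK ?wpermKV.
Qed.

Lemma invariant_leg_op j (K : word -> word -> C) t :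
  (forall x y s, K (wperm x s) (wperm y s) = K x y) ->
  invariant_tensor t -> invariant_tensor (leg_op j K t).
Proof.
move=> eqK inv z s; rewrite /leg_op -(sum_wperm _ s); apply: eq_bigr => y _.
by rewrite ffunE eqK -zperm_upd inv.
Qed.

Definition marginal_kernel j (t : idx -> C) (x y : word) : C :=
  \sum_z t (upd z j x) * (t (upd z j y))^*.

Lemma marginalE j t u :
  marginal j u t = \sum_x (u x)^* * \sum_y marginal_kernel j t x y * u y.
Proof.
transitivity (\sum_z \sum_x \sum_y (u x)^* * (t (upd z j x) * (t (upd z j
  y))^* * u y)).
  apply: eq_bigr => z _; rewrite /leg_op mulr_suml; apply: eq_bigr => x _.
  rewrite rmorph_sum mulr_sumr; apply: eq_bigr => y _.
  by rewrite rmorphM /= conjCK -!mulrA; do 2 congr (_ * _); rewrite mulrC.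
rewrite exchange_big; apply: eq_bigr => x _.
rewrite exchange_big mulr_sumr; apply: eq_bigr => y _.
by rewrite mulr_suml mulr_sumr.
Qed.

Definition content_on j (t : idx -> C) :=
  forall z, t z != 0 -> content (z j) = content (r j).

Lemma marginal_equivariant j t : invariant_tensor t -> content_on j t ->
  equivariant (r j) (marginal_kernel j t).
Proof.
move=> inv supp; split=> [x y s|x y].
  rewrite /marginal_kernel -(sum_zperm _ s); apply: eq_bigr => z _.
  by rewrite -!zperm_upd !inv.
apply: contra_neq_eq => cx; apply: big1 => z _.
have [->|/supp] := eqVneq (t (upd z j x)) 0; first by rewrite mul0r.
by rewrite updE => e; rewrite e eqxx in cx.
Qed.

Lemma content_on_leg_op i j (K : word -> word -> C) t :
  content_on j t -> i != j -> content_on j (leg_op i K t).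
Proof.
move=> supp ne z; apply: contra_neq_eq => cz; apply: big1 => y _.
have [->|/supp] := eqVneq (t (upd z i y)) 0; first by rewrite mulr0.
by rewrite upd_ne 1?eq_sym // => e; rewrite e eqxx in cz.
Qed.

Lemma content_on_leg_eq j (K : word -> word -> C) t :
  equivariant (r j) K -> content_on j (leg_op j K t).
Proof.
move=> [_ supp] z; apply: contra_neq_eq => cz; apply: big1 => y _.
have [->|/supp e] := eqVneq (K (z j) y) 0; first by rewrite mul0r.
by rewrite e eqxx in cz.
Qed.

(* Irreducibility makes the reduced state of the projected tensor on each leg a
   multiple [cc j] of the identity of a space of dimension at least [D], so in the
   union bound each slice accounts for at most a fraction [1 / D] of the norm. *)
Lemma slices_lower_bound (t : idx -> C) (e D : nat) (S : 'I_e -> idx -> C)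
    (leg : 'I_e -> 'I_k) (v : 'I_e -> word -> C) (ws : 'I_k -> seq word) :
  (0 < k)%N -> (forall j, tableau (r j) (c j)) -> invariant_tensor t ->
  pairing t (fun j => ptab (r j) (c j) C) != 0 ->
  (forall i, slice_along (leg i) (v i) (S i)) ->
  t =1 (fun z => \sum_i S i z) ->
  (forall j, [/\ uniq (ws j), (D <= size (ws j))%N &
     forall x, x \in ws j -> content x = content (r j) /\ ballot x]) ->
  (D <= e)%N.
Proof.
move=> k0 T inv nz Sv tS wsP.
pose G j := gram (r j) (c j) C.
have GE j : equivariant (r j) (G j) by apply: gram_equivariant.
pose js := index_enum 'I_k.
have ujs : uniq js by apply: index_enum_uniq.
have mjs j : j \in js by rewrite mem_index_enum.
pose q := leg_ops G js t.
have qinv : invariant_tensor q.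
  rewrite /q; elim: js {ujs mjs q} => //= j js IH.
  by apply: invariant_leg_op => //; case: (GE j).
have qsupp j : content_on j q.
  move: (mjs j); rewrite /q;
    elim: js ujs {mjs q qinv} => //= i js IH /andP[ni ujs].
  rewrite inE => /predU1P[->|hj]; first exact: content_on_leg_eq.
  by apply: content_on_leg_op (IH ujs hj) _; apply: contraNneq ni => ->.
have qnz : pairing q (fun j => ptab (r j) (c j) C) != 0.
  rewrite /q; elim: js {ujs mjs q qinv qsupp} => //= j js IH.
  rewrite (@pairing_leg_op _ _ _ _ _ (scalar_of (r j) (c j) (G j))).
    by rewrite mulf_neq0 // scalar_of_gram.
  move=> y; have := schur_ptab 1%g y (T j) (GE j); rewrite wperm1 => <-.
  by apply: eq_bigr => x _; rewrite wperm1 /G gramC.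
pose N := dot q q *+ #|word|.
have X0 : (0 < #|word|)%N by apply/card_gt0P; exists (r (Ordinal k0)).
have N0 : 0 < N.
  rewrite pmulrn_lgt0 // lt_def dot_ge0 andbT; apply: contraNneq qnz.
  by move/dot_eq0 => q0; rewrite /pairing big1 // => z _; rewrite q0 mul0r.
pose K j := marginal_kernel j q.
have KE j : equivariant (r j) (K j) by apply: marginal_equivariant.
pose cc j := scalar_of (r j) (c j) (K j).
(* This eigenspace of the reduced state replaces the Specht module: it is closed under combinations,
   contains the permuted polytabloids by [schur_ptab], and each of its unit vectors has marginal
   [cc j]. *)
pose P j (u : {ffun word -> C}) := forall x, \sum_y K j x y * u y = cc j * u x.
have closedP j (u w : {ffun word -> C}) a : P j u -> P j w ->
    P j [ffun x => a * u x + w x].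
  move=> Pu Pw x; rewrite ffunE mulrDr mulrCA -Pu -Pw mulr_sumr -big_split.
  by apply: eq_bigr => y _; rewrite ffunE mulrDr mulrCA.
have Pptab j s : P j [ffun x => ptab (r j) (c j) C (wperm x s)].
  move=> x; rewrite ffunE -(schur_ptab s x (T j) (KE j)).
  by apply: eq_bigr => y _; rewrite ffunE.
have margP j b : P j b -> dot b b = 1 -> marginal j b q = cc j.
  move=> Pb b1; rewrite marginalE -[RHS]mulr1 -b1 mulr_sumr.
  by apply: eq_bigr => x _; rewrite Pb mulrCA (mulrC (b x)).
have orth_unit bs b : orthonormal bs -> b \in bs -> dot b b = 1.
  elim: bs => //= b' bs IH [h1 _ h2]; rewrite inE => /predU1P[->//|].
  exact: IH.
have ccD j : cc j *+ D <= N.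
  have [uws leD hws] := wsP j.
  have [bs [bsO le_bs Pbs]] := many_orthonormal (closedP j) (T j) uws hws
    (Pptab j).
  apply: le_trans (bessel_marginal j q bsO).
  have -> : \sum_(b <- bs) marginal j b q = cc j *+ size bs.
    rewrite big_seq (eq_bigr (fun=> cc j)) => [|b hb]; last first.
      by apply: margP; [apply: Pbs | apply: orth_unit hb].
    by rewrite -big_seq big_const_seq count_predT iter_addr_0.
  have [-> |D0] := posnP D.
    rewrite mulr0n; case: bs bsO Pbs {le_bs} => [|b bs] bsO Pbs.
      by rewrite mulr0n.
    rewrite mulrn_wge0 // -(margP j b) ?marginal_ge0 //.
      by apply: Pbs; rewrite mem_head.
    by case: bsO.
  apply: ler_wpMn2l; last exact: leq_trans leD le_bs.
  case: bs bsO Pbs le_bs => [|b bs] bsO Pbs le_bs.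
    by move: (leq_trans leD le_bs); rewrite leqNgt D0.
  rewrite -(margP j b) ?marginal_ge0 //; first by apply: Pbs; rewrite mem_head.
  by case: bsO.
(* The slice vectors are taken after applying the Gram operators. They are then combinations of
   permuted polytabloids, hence lie in [P j], and so does the orthonormal basis of their span; each
   basis vector costs exactly [cc j] in the union bound. *)
pose vs j : seq {ffun word -> C} :=
  [seq [ffun x => \sum_y G j x y * v i y] | i <- enum 'I_e & leg i == j].
have ex j : exists bs, [/\ orthonormal bs, (size bs <= size (vs j))%N,
    forall b, b \in bs -> P j b &
    forall w : {ffun word -> C}, w \in vs j -> residue bs w =1 fun=> 0].
  apply: gram_schmidt; first exact: closedP.
  move=> w /mapP[i _ ->].
  pose a s := dot (v i) (fun y => ptab (r j) (c j) C (wperm y s)).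
  move=> x; rewrite ffunE.
  have vE x' : \sum_y G j x' y * v i y =
      \sum_s a s * ptab (r j) (c j) C (wperm x' s).
    under eq_bigr do rewrite [G _ _ _ * _]mulr_suml.
    rewrite exchange_big; apply: eq_bigr => s _; rewrite mulr_suml.
    by apply: eq_bigr => y _; rewrite conj_ptab mulrC mulrA mulrAC.
  rewrite vE mulr_sumr; transitivity (\sum_y \sum_s
      a s * (K j x y * ptab (r j) (c j) C (wperm y s))).
    apply: eq_bigr => y _; rewrite ffunE vE mulr_sumr.
    by apply: eq_bigr => s _; rewrite mulrCA.
  rewrite exchange_big; apply: eq_bigr => s _.
  by rewrite -mulr_sumr (schur_ptab s x (T j) (KE j)) mulrCA.
have [bs bsP] := choice ex.
have bsO j : orthonormal (bs j) by case: (bsP j).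
have res0 : leg_ops (fun j => residue_op (bs j)) js q =1 fun=> 0.
  move=> z; have qS : q =1 fun z => \sum_i leg_ops G js (S i) z.
    by move=> z'; rewrite /q (eq_leg_ops _ _ tS) leg_ops_sum.
  rewrite (eq_leg_ops _ _ qS) leg_ops_sum big1 // => i _.
  have sl1 := slice_along_ops G ujs (mjs (leg i)) (Sv i).
  have sl2 := slice_along_ops (fun j =>
    residue_op (bs j)) ujs (mjs (leg i)) sl1.
  apply: (slice_along0 sl2) => x; rewrite sum_residue_op.
  have [_ _ _ res] := bsP (leg i).
  rewrite -[RHS](res [ffun x => \sum_y G (leg i) x y * v i y] _ x).
    by congr residue; apply/funext => y; rewrite ffunE.
  by apply/mapP; exists i; rewrite // mem_filter eqxx mem_enum.
have := union_bound q bsO X0 ujs.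
rewrite -/N (eq_dot res0 res0) dot0l mul0rn addr0 => le1.
have le2 : N *+ D <= N *+ (\sum_(j <- js) size (bs j)).
  apply: le_trans (ler_wMn2r D le1) _.
  rewrite -sumrMnl -sumrMnr; apply: ler_sum => j _.
  rewrite big_seq (eq_bigr (fun=> cc j)) => [|b hb]; last first.
    have [_ _ Pbs _] := bsP j.
    by apply: margP; [apply: Pbs | apply: orth_unit hb].
  rewrite -big_seq big_const_seq count_predT iter_addr_0 mulrnAC.
  exact: ler_wMn2r.
rewrite -(ler_pMn2l N0); apply: le_trans le2 _; rewrite ler_pMn2l //.
apply: leq_trans (_ : \sum_j size (vs j) <= e)%N.
  by apply: leq_sum => j _; case: (bsP j).
rewrite -[leqRHS]card_ord -sum1_card (partition_big leg xpredT) //=.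
apply: leq_sum => j _; rewrite size_map size_filter.
by rewrite -sum1_count /index_enum -enumT big_enum_cond.
Qed.
End Core.

(** * Counting ballot words by the formula of Frobenius *)

Section BallotCount.
Variable L : nat.
Implicit Types (lam : {ffun 'I_L -> nat}) (i j l : 'I_L).

Definition extend n (w : {ffun 'I_n -> 'I_L}) i : {ffun 'I_n.+1 -> 'I_L} :=
  [ffun a => if unlift ord_max a is Some b then w b else i].

Lemma extend_max n (w : {ffun 'I_n -> 'I_L}) i : extend w i ord_max = i.
Proof. by rewrite ffunE unlift_none. Qed.

Lemma extend_lift n (w : {ffun 'I_n -> 'I_L}) i b :
  extend w i (lift ord_max b) = w b.
Proof. by rewrite ffunE liftK. Qed.

Lemma extend_inj n (w w' : {ffun 'I_n -> 'I_L}) i i' :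
  extend w i = extend w' i' -> w = w' /\ i = i'.
Proof.
move=> /ffunP e; split; last by have := e ord_max; rewrite !extend_max.
by apply/ffunP => b; have := e (lift ord_max b); rewrite !extend_lift.
Qed.

Lemma content_extend n (w : {ffun 'I_n -> 'I_L}) i l :
  content (extend w i) l = (content w l + (i == l))%N.
Proof.
rewrite !ffunE -!sum1_card [LHS]big_mkcond big_ord_recr /=; congr (_ + _)%N.
  rewrite [RHS]big_mkcond; apply: eq_bigr => b _; rewrite !inE.
  suff -> : widen_ord (leqnSn n) b = lift ord_max b by rewrite extend_lift.
  by apply: val_inj; rewrite /= /bump leqNgt ltn_ord.
by rewrite inE extend_max; case: eqP.
Qed.

Lemma prefix_count_max n (w : {ffun 'I_n.+1 -> 'I_L}) l :
  prefix_count w ord_max l = content w l.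
Proof. by rewrite ffunE; apply: eq_card => b; rewrite !inE -ltnS ltn_ord. Qed.

Lemma prefix_count_lift n (w : {ffun 'I_n -> 'I_L}) i b l :
  prefix_count (extend w i) (lift ord_max b) l = prefix_count w b l.
Proof.
rewrite /prefix_count -[RHS](card_imset _ (@lift_inj _ ord_max)).
apply: eq_card => a; rewrite inE; apply/idP/imsetP.
  case: (unliftP ord_max a) => [a' -> /andP[h1 h2]|-> /andP[]].
    exists a' => //; rewrite inE; move: h1 h2; rewrite extend_lift !lift_max.
    by move=> -> ->.
  by rewrite lift_max /= leqNgt ltn_ord.
by move=> [a' + ->]; rewrite inE extend_lift !lift_max.
Qed.

Definition removable lam i : bool :=
  (0 < lam i)%N && [forall j : 'I_L, (i < j)%N ==> (lam j < lam i)%N].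

Definition remove lam i : {ffun 'I_L -> nat} := [ffun j =>
  (lam j - (j == i))%N].

(** The last letter marks a corner of the diagram, whose removal leaves a shorter ballot word. This
    is the branching rule for standard tableaux. *)
Fixpoint ballot_words n lam : seq {ffun 'I_n -> 'I_L} :=
  if n is n'.+1 then
    [seq extend w i | i <- [seq i <- enum 'I_L | removable lam i],
                      w <- ballot_words n' (remove lam i)]
  else [:: ffun0 (card_ord 0)].

Definition nonincr lam : Prop := forall i j, (i <= j)%N -> (lam j <= lam i)%N.

Lemma nonincr_remove lam i :
  nonincr lam -> removable lam i -> nonincr (remove lam i).
Proof.
move=> ni /andP[_ /forallP rm] j l jl; rewrite !ffunE.
have [ei|ne] := eqVneq j i; last by apply: leq_trans (leq_subr _ _) _;
  rewrite subn0 ni.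
rewrite -{i}ei in rm *; have [->//|nl] := eqVneq l j.
have := rm l; rewrite ltn_neqAle jl (inj_eq (@ord_inj _)) eq_sym nl /= subn0
  subn1.
by case: (lam j).
Qed.

Lemma sum_remove lam i n : removable lam i -> (\sum_j lam j = n.+1)%N ->
  (\sum_j remove lam i j = n)%N.
Proof.
move=> /andP[pos _]; rewrite (bigD1 i) //= => e.
rewrite (bigD1 i) //= ffunE eqxx (eq_bigr lam) => [|j /negbTE ne].
  by case: (lam i) pos e => // m _; rewrite addSn subn1 => -[].
by rewrite ffunE ne subn0.
Qed.

Lemma ballot_wordsP n lam w : nonincr lam -> (\sum_j lam j = n)%N ->
  w \in ballot_words n lam -> content w = lam /\ ballot w.
Proof.
elim: n lam w => [|n IH] lam w ni sumE.
  move=> _; split=> [|a]; last by case: a.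
  apply/ffunP => i; rewrite ffunE.
  have -> : lam i = 0%N.
    by apply/eqP; move/eqP: sumE; rewrite sum_nat_eq0 => /forallP/(_ i).
  by apply: eq_card0 => -[].
move=> /allpairsPdep[i [w' [hi hw ->]]].
have {}hi : removable lam i by move: hi; rewrite mem_filter => /andP[].
have [cw bw] := IH _ _ (nonincr_remove ni hi) (sum_remove hi sumE) hw.
have cE : content (extend w' i) = lam.
  apply/ffunP => l; rewrite content_extend cw ffunE (eq_sym l).
  case: eqP => [<-|_]; last by rewrite subn0 addn0.
  by case/andP: hi => h _; rewrite subnK.
split=> // a j l jl; case: (unliftP ord_max a) => [b ->|->].
  by rewrite !prefix_count_lift bw.
by rewrite !prefix_count_max cE; apply/ni/ltnW.
Qed.

Lemma ballot_words_uniq n lam : uniq (ballot_words n lam).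
Proof.
elim: n lam => //= n IH lam; apply: allpairs_uniq_dep.
- by rewrite filter_uniq // enum_uniq.
- by move=> i _; apply: IH.
- by move=> [i w] [i' w'] _ _ /= /extend_inj[-> ->].
Qed.

Lemma ballot_words_gt0 n lam : nonincr lam -> (\sum_j lam j = n)%N ->
  (0 < size (ballot_words n lam))%N.
Proof.
elim: n lam => //= n IH lam ni sumE.
have [i0 pos0] : exists i, (0 < lam i)%N.
  apply/existsP; apply: contra_eqT sumE => /existsPn h.
  by rewrite big1 // => i _; apply/eqP; rewrite eqn0Ngt h.
case: (@arg_maxnP _ i0 (fun i => (0 < lam i)%N) val pos0) => i pos imax.
have rm : removable lam i.
  rewrite /removable pos; apply/forallP => j; apply/implyP => ij.
  apply: leq_trans pos; rewrite ltnS leqNgt; apply: contraTN ij => /imax.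
  by rewrite -leqNgt.
have := IH _ (nonincr_remove ni rm) (sum_remove rm sumE).
rewrite -!has_predT => /hasP[w hw _]; apply/hasP.
exists (extend w i) => //; apply/allpairsPdep; exists i, w.
by rewrite mem_filter rm mem_enum.
Qed.

(* [lam + (L-1, ..., 1, 0)], as in the formula
   [f^lam = n! det (x_i (x_i - 1) ...) / prod x_i!] of Frobenius. *)
Definition shifted lam i : nat := (lam i + (L.-1 - i))%N.

Definition falling_mx (x : 'I_L -> nat) : 'M[int]_L :=
  \matrix_(i, j) (x i ^_ (L.-1 - j))%:Z.

Definition lower (x : 'I_L -> nat) i : 'I_L -> nat := fun j =>
  (x j - (j == i))%N.

(** In the Leibniz expansion, lowering [x i] and multiplying by it turns the factor
    $x^{\underline{p}}$ into $x^{\underline{p+1}} = x^{\underline{p}}(x - p)$ with $p = L - 1 -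
    s(i)$. The sum over [i] of these extra factors does not depend on the permutation [s]. *)
Lemma falling_mx_recursion (x : 'I_L -> nat) :
  \sum_i (x i)%:Z * \det (falling_mx (lower x i)) =
  (\sum_i (x i)%:Z - \sum_(i < L) (L.-1 - i)%:Z) * \det (falling_mx x).
Proof.
rewrite /determinant mulr_sumr.
under eq_bigr do rewrite mulr_sumr.
rewrite exchange_big; apply: eq_bigr => s _.
rewrite [\sum_(i < L) (L.-1 - i)%:Z](reindex_inj (@perm_inj _ s)) -sumrB
  mulr_suml.
apply: eq_bigr => i _; rewrite [LHS]mulrCA [RHS]mulrCA; congr (_ * _).
rewrite (bigD1 i) //= [in RHS](bigD1 i) //= !mulrA; congr (_ * _); last first.
  by apply: eq_bigr => j /negbTE ne; rewrite !mxE /lower ne subn0.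
rewrite !mxE /lower eqxx subn1 -PoszM -ffactnS ffactnSr PoszM mulrC.
case: (leqP (L.-1 - s i) (x i)) => h; first by rewrite subzn.
by rewrite ffact_small // !mulr0.
Qed.

(** If the next row has the same length, lowering row [i] makes its shifted length equal to that of
    the next row, and the determinant has two equal rows. Otherwise [i] is the last row and is
    empty, and the factor in front is 0. *)
Lemma falling_mx_nonremovable lam i : nonincr lam -> ~~ removable lam i ->
  (shifted lam i)%:Z * \det (falling_mx (lower (shifted lam) i)) = 0.
Proof.
move=> ni nrm.
have [/existsP[j /andP[ij ge]]|/existsPn nex] :=
    boolP [exists j : 'I_L, (i < j)%N && (lam i <= lam j)%N].
  have Si : (i.+1 < L)%N := leq_ltn_trans ij (ltn_ord j).
  pose i' := Ordinal Si.
  have e : lam i' = lam i.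
    by apply/eqP; rewrite eqn_leq ni //= (leq_trans ge) // ni.
  rewrite (@determinant_alternate _ _ _ i i') ?mulr0 //.
    by rewrite -(inj_eq (@ord_inj _)) /= neq_ltn ltnSn.
  move=> l; rewrite !mxE /lower eqxx (_ : (i' == i) = false); last first.
    by rewrite -(inj_eq (@ord_inj _)) /= gtn_eqF.
  rewrite subn0 /shifted e subn1 /= -subn1 -addnBA ?subn1; last first.
    by rewrite subn_gt0 -ltnS prednK // (leq_ltn_trans _ Si).
  by rewrite subnS.
have i0 : lam i = 0%N.
  apply/eqP; rewrite eqn0Ngt; apply: contra nrm => pos; rewrite /removable pos.
  by apply/forallP => j; apply/implyP => ij; have := nex j; rewrite ij -ltnNge.
have iL : (i = L.-1 :> nat)%N.
  apply/eqP; rewrite eqn_leq -ltnS (ltn_predK (ltn_ord i)) ltn_ord /= leqNgt.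
  apply/negP => lt; have Si : (i.+1 < L)%N by move: lt;
    rewrite -ltnS (ltn_predK (ltn_ord i)).
  by have := nex (Ordinal Si); rewrite i0 /= ltnSn.
by rewrite /shifted i0 iL subnn mul0r.
Qed.

(** Both sides satisfy the branching recursion. On the determinant side the sum extends from the
    removable rows to all rows because the other terms vanish, and [falling_mx_recursion] then
    produces the factor [n + 1], the size of [lam]. *)
Lemma ballot_count n lam : nonincr lam -> (\sum_j lam j = n)%N ->
  ((size (ballot_words n lam) * \prod_i (shifted lam i)`!)%N%:Z =
   n`!%:Z * \det (falling_mx (shifted lam)))%R.
Proof.
elim: n lam => [|n IH] lam ni sumE /=.
  have l0 i : lam i = 0%N.
    by apply/eqP; move/eqP: sumE; rewrite sum_nat_eq0 => /forallP/(_ i).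
  rewrite mul1n mul1r -det_tr det_trig.
    rewrite -[LHS]natz natr_prod; apply: eq_bigr => i _.
    by rewrite !mxE /shifted l0 add0n ffactnn natz.
  apply/is_trig_mxP => i j ij; rewrite !mxE /shifted l0 add0n ffact_small //.
  by rewrite ltn_sub2l // -ltnS (ltn_predK (ltn_ord j)) (leq_ltn_trans ij).
rewrite size_allpairs_dep sumnE big_map big_filter big_enum_cond /=.
rewrite big_distrl /= -[LHS]natz natr_sum.
transitivity (\sum_(i | removable lam i)
    n`!%:Z * ((shifted lam i)%:Z * \det (falling_mx (lower (shifted lam) i)))).
  apply: eq_bigr => i rm.
  have sE : shifted (remove lam i) =1 lower (shifted lam) i.
    move=> j; rewrite /shifted /lower ffunE; case: eqP => [->|_];
      last by rewrite !subn0.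
    by rewrite addnBAC //; case/andP: rm.
  rewrite mulrCA (_ : falling_mx (lower _ _) = falling_mx (shifted (remove lam
    i)));
    last by apply/matrixP => j l; rewrite !mxE sE.
  rewrite -IH; [|exact: nonincr_remove|exact: sum_remove].
  rewrite natz -PoszM mulnCA; congr (Posz (_ * _)).
  rewrite (bigD1 i) //= [in RHS](bigD1 i) //= mulnA; congr (_ * _)%N.
    rewrite sE /lower eqxx subn1; case/andP: rm => pos _.
    have : (0 < shifted lam i)%N by rewrite /shifted addn_gt0 pos.
    by case: (shifted lam i) => // m _; rewrite factS.
  by apply: eq_bigr => j /negbTE ne; rewrite sE /lower ne subn0.
rewrite -mulr_sumr big_mkcond /=.
transitivity (n`!%:Z * \sum_i ((shifted lam i)%:Z * \det (falling_mx (lower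
  (shifted lam) i)))).
  congr (_ * _); apply: eq_bigr => i _; case: ifPn => // nrm.
  by rewrite falling_mx_nonremovable.
rewrite falling_mx_recursion mulrA factS PoszM [_ * (n`!)%:Z]mulrC;
  congr (_ * _ * _).
rewrite -sumrB -sumE -[RHS]natz natr_sum; apply: eq_bigr => i _.
by rewrite /shifted PoszD addrK natz.
Qed.

(* The determinant in [ballot_count] is positive as ballot words exist, and being
   an integer it is at least 1. *)
Lemma ballot_words_ge n lam : nonincr lam -> (\sum_j lam j = n)%N ->
  (n`! <= size (ballot_words n lam) * \prod_i (shifted lam i)`!)%N.
Proof.
move=> ni sumE; have := ballot_count ni sumE; set d := \det _ => e.
have pos : 0 < (size (ballot_words n lam) * \prod_i (shifted lam i)`!)%N%:Z.
  rewrite ltz_nat muln_gt0 ballot_words_gt0 //=.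
  by apply: prodn_gt0 => i; apply: fact_gt0.
have d1 : 1 <= d.
  by move: pos; rewrite e pmulr_rgt0 ?ltz_nat ?fact_gt0 // -gtz0_ge1.
by rewrite -lez_nat e ler_peMr.
Qed.
End BallotCount.

(** * From isotypic projections to highest weight functionals *)

Section Polarization.
Variables (C : numClosedFieldType) (m : nat).

(* Ryser's formula for the permanent, with the signs
   [(-1) ^ (m - #|S|)] written as products. *)
Lemma ryser (x : 'I_m -> 'I_m -> C) :
  \sum_(p : 'S_m) \prod_a x a (p a) =
  \sum_(S : {set 'I_m})
    (\prod_b (-1) ^+ (b \notin S)) * \prod_a \sum_b (b \in S)%:R * x a b.
Proof.
under [RHS]eq_bigr do rewrite bigA_distr_bigA mulr_sumr.
rewrite exchange_big /=.
transitivity (\sum_(h : {ffun 'I_m -> 'I_m}) (injectiveb h)%:R * \prod_a x a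
  (h a)).
  under [RHS]eq_bigr do rewrite mulr_natl mulrb.
  rewrite -big_mkcond /= (reindex (fun p : 'S_m => pval p)) /=.
    by apply: eq_big => p; [rewrite (valP p) | move=> _;
      apply: eq_bigr => a _; rewrite pvalE].
  pose dflt : 'S_m := 1%g.
  exists (fun h => insubd dflt h) => [p _|h]; first exact: valKd.
  by rewrite inE => hi; rewrite insubdK.
apply: eq_bigr => h _.
transitivity ((\sum_(S : {set 'I_m})
   (\prod_b (-1) ^+ (b \notin S)) * \prod_a (h a \in S)%:R) * \prod_a x a (h
     a)); last first.
  by rewrite mulr_suml; apply: eq_bigr => S _; rewrite -mulrA -big_split.
congr (_ * _).
have [hi|nhi] := boolP (injectiveb h).
  rewrite (bigD1 [set: 'I_m]) //= [X in _ * X]big1 => [|a _];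
    last by rewrite inE.
  rewrite big1 => [|b _]; last by rewrite inE.
  rewrite big1 ?mulr1 ?addr0 // => S;
    rewrite finset.eqEsubset finset.subsetT /=.
  case/fintype.subsetPn => b _ nb; have [g hg gh] := injF_bij (injectiveP _ hi).
  by rewrite [X in _ * X](bigD1 (g b)) //= gh (negbTE nb) mul0r mulr0.
have [b hb] : exists b, forall a, h a != b.
  have [/existsP[b /forallP hb]|/existsPn nb] := boolP [exists b, forall a, h
    a != b].
    by exists b.
  case/negP: nhi; apply/injectiveP.
  have sur y : exists x, h x == y.
    by have /forallPn[a] := nb y; rewrite negbK; exists a.
  have gK : cancel (fun y => xchoose (sur y)) h.
    by move=> y; apply/eqP/(xchooseP (sur y)).
  have [k kg gk] := injF_bij (can_inj gK).
  by move=> a1 a2 e; rewrite -(gk a1) -(gk a2) -(gK (k a1)) -(gK (k a2)) !gk e.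
(* A map [h] that misses [b] contributes nothing: toggling [b] in [S] is an involution that reverses
   the sign. *)
pose tog (S : {set 'I_m}) := if b \in S then S :\ b else b |: S.
have togK : involutive tog.
  move=> S; apply/setP => b'; rewrite /tog; case: (boolP (b \in S)) => bS;
    by rewrite !inE eqxx /= !inE; case: eqP => [->|//];
      rewrite ?bS ?(negbTE bS).
have togb S : (b \in tog S) = (b \notin S).
  by rewrite /tog; case: ifP => bS; rewrite !inE eqxx.
have togn S b' : b' != b -> (b' \in tog S) = (b' \in S).
  by move=> ne; rewrite /tog; case: ifP => bS; rewrite !inE (negbTE ne).
set Z := \sum_(S : {set _}) _; have : Z = - Z.
  rewrite {1}/Z (reindex_inj (inv_inj togK)) /Z -sumrN; apply: eq_bigr => S _.
  rewrite -mulNr; congr (_ * _); last by apply: eq_bigr => a _; rewrite togn.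
  rewrite (bigD1 b) //= [in RHS](bigD1 b) //= -mulNr togb; congr (_ * _).
    by case: (b \in S); rewrite ?expr0 ?expr1 ?opprK.
  by apply: eq_bigr => b' ne; rewrite togn.
by move=> /eqP; rewrite -subr_eq0 opprK -mulr2n mulrn_eq0 /= => /eqP ->.
Qed.

Lemma sum_ffun_perm (T : finType) (F : {ffun 'I_m -> T} -> C) (p : 'S_m) :
  \sum_(w : {ffun 'I_m -> T}) F [ffun a => w (p a)] = \sum_w F w.
Proof.
rewrite [RHS](reindex (fun w : {ffun 'I_m -> T} => [ffun a => w (p a)])) //=.
exists (fun w : {ffun 'I_m -> T} => [ffun a => w ((p^-1)%g a)]) => w _;
by apply/ffunP => a; rewrite !ffunE ?permK ?permKV.
Qed.

(* By Ryser's formula, symmetrized elementary kernels are combinations of m-th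
   tensor powers. *)
Lemma polarization (I J : finType)
    (A B : {ffun 'I_m -> I} -> {ffun 'I_m -> J} -> C) :
  (forall (w : {ffun 'I_m -> I}) (y : {ffun 'I_m -> J}) (p : 'S_m),
    A [ffun a => w (p a)] [ffun a => y (p a)] = A w y) ->
  \sum_w \sum_y B w y * A w y != 0 ->
  exists g : I -> J -> C,
    \sum_(w : {ffun 'I_m -> I}) \sum_(y :
      {ffun 'I_m -> J}) B w y * \prod_a g (w a) (y a) != 0.
Proof.
move=> eqA; apply: contra_neqP => /forallNP nex.
have {}nex (g : I -> J -> C) :
    \sum_(w : {ffun 'I_m -> I}) \sum_(y :
      {ffun 'I_m -> J}) B w y * \prod_a g (w a) (y a) = 0.
  by apply/eqP/negbNE/negP; exact: nex.
(* The symmetrization of [B] at a pair of words is the pairing of [B] with a symmetrized elementary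
   kernel. By [ryser] that kernel is a combination of tensor powers, and on these [B] vanishes. *)
have key (w' : {ffun 'I_m -> I}) (y' : {ffun 'I_m -> J}) :
    \sum_(p : 'S_m) B [ffun a => w' (p a)] [ffun a => y' (p a)] = 0.
  transitivity (\sum_(w : {ffun 'I_m -> I}) \sum_(y :
    {ffun 'I_m -> J}) B w y * \sum_(p : 'S_m)
      \prod_a ((w' (p a) == w a) && (y' (p a) == y a))%:R).
    under [RHS]eq_bigr do under eq_bigr do rewrite mulr_sumr.
    under [RHS]eq_bigr do rewrite exchange_big /=.
    rewrite [RHS]exchange_big; apply: eq_bigr => p _ /=.
    rewrite (bigD1 [ffun a => w' (p a)]) //= (bigD1 [ffun a => y' (p a)]) //=.
    rewrite [X in _ * X]big1 => [|a _]; last by rewrite !ffunE !eqxx.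
    rewrite mulr1 !big1 ?addr0 // => [w ne|y ne].
      apply: big1 => y _; have [a] : exists a, w' (p a) != w a.
        apply/existsP; apply: contraR ne => /existsPn e; apply/eqP/ffunP => a.
        by rewrite ffunE; apply/esym/eqP; rewrite -[_ == _]negbK e.
      by move=> /negbTE ea; rewrite (bigD1 a) //= ea mul0r mulr0.
    have [a] : exists a, y' (p a) != y a.
      apply/existsP; apply: contraR ne => /existsPn e; apply/eqP/ffunP => a.
      by rewrite ffunE; apply/esym/eqP; rewrite -[_ == _]negbK e.
    by move=> /negbTE ea; rewrite (bigD1 a) //= ea andbF mul0r mulr0.
  under eq_bigr => w _. under eq_bigr => y _.
    rewrite (ryser (fun a b => ((w' b == w a) && (y' b == y a))%:R)) mulr_sumr.
    over. rewrite exchange_big /=. over.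
  rewrite exchange_big; apply: big1 => S _.
  pose g i j : C := \sum_b (b \in S)%:R * ((w' b == i) && (y' b == j))%:R.
  transitivity (\prod_b (-1) ^+ (b \notin S) *
    (\sum_(w : {ffun 'I_m -> I}) \sum_(y : {ffun 'I_m -> J})
       B w y * \prod_a g (w a) (y a))); last by rewrite nex mulr0.
  rewrite mulr_sumr.
  apply: eq_bigr => w _; rewrite mulr_sumr; apply: eq_bigr => y _.
  by rewrite mulrCA.
have : (\sum_w \sum_y B w y * A w y) *+ m`! = 0.
  have -> : (m`! = #|'S_m|)%N by rewrite card_Sn.
  rewrite -sumr_const.
  transitivity (\sum_(p : 'S_m) \sum_(w : {ffun 'I_m -> I}) \sum_(y :
    {ffun 'I_m -> J})
      B [ffun a => w (p a)] [ffun a => y (p a)] * A w y).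
    apply: eq_bigr => p _; rewrite -(sum_ffun_perm _ p); apply: eq_bigr => w _.
    rewrite -(sum_ffun_perm _ p); apply: eq_bigr => y _.
    by rewrite eqA.
  rewrite exchange_big; apply: big1 => w _; rewrite exchange_big;
    apply: big1 => y _.
  by rewrite -mulr_suml key mul0r.
by move/eqP; rewrite mulrn_eq0 -leqn0 leqNgt fact_gt0 => /eqP.
Qed.
End Polarization.

(** The matrix is block diagonal along the columns of the tableau, so the determinant is a product
    of minors, the classical form of a highest weight polynomial. *)
Lemma ptab_sum (C : numClosedFieldType) n L (r : {ffun 'I_n -> 'I_L})
    (c : {ffun 'I_n -> 'I_n}) (G : 'I_L -> 'I_n -> C) :
  \sum_(w : {ffun 'I_n -> 'I_L}) ptab r c C w * \prod_a G (w a) a =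
  \det (\matrix_(a, b) ((c a == c b)%:R * G (r b) a)).
Proof.
rewrite /ptab /determinant; under eq_bigr do rewrite mulr_suml.
rewrite exchange_big; apply: eq_bigr => s _ /=.
under eq_bigr do rewrite -mulrA -big_split /=.
rewrite -mulr_sumr; congr (_ * _).
transitivity (\prod_a \sum_i ((c a == c (s a)) && (i == r (s a)))%:R * G i a).
  rewrite bigA_distr_bigA; apply: eq_bigr => w _.
  by apply: eq_bigr => a _; rewrite mxE.
apply: eq_bigr => a _; rewrite mxE (bigD1 (r (s a))) //= eqxx andbT.
by rewrite big1 ?addr0 // => i /negbTE ->; rewrite andbF mul0r.
Qed.

Section Isotypic.
Variables (R : realType) (m : nat) (lam : seq nat).
Local Notation C := R[i]%C.
Implicit Types (T : {ffun 'I_m -> 'I_(size lam) * 'I_m}).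

Definition rows T : {ffun 'I_m -> 'I_(size lam)} := [ffun a => (T a).1].
Definition cols T : {ffun 'I_m -> 'I_m} := [ffun a => (T a).2].

Lemma polytabloidE T : polytabloid R T = [ffun w => ptab (rows T) (cols T) C w].
Proof.
apply/ffunP => w; rewrite /polytabloid sum_ffunE ffunE big_mkcond.
apply: eq_bigr => s _; case: ifP => [/forallP cs|/negbT/forallPn[a ca]].
  rewrite !ffunE; congr (_ * _).
  have [->|ne] := eqVneq w [ffun a => (T (s a)).1].
    by rewrite big1 // => a _; rewrite mxE !ffunE (eqP (cs a)) !eqxx.
  have [a ha] : exists a, w a != (T (s a)).1.
    apply/existsP; apply: contraR ne => /existsPn e; apply/eqP/ffunP => a.
    by rewrite ffunE; apply/eqP; rewrite -[_ == _]negbK e.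
  by rewrite (bigD1 a) //= mxE !ffunE (negbTE ha) andbF mul0r.
by rewrite (bigD1 a) //= mxE !ffunE eq_sym (negbTE ca) mul0r mulr0.
Qed.

Hypothesis lamP : is_partition m lam.

Lemma partition_nth i j : (i <= j)%N -> (nth 0 lam j <= nth 0 lam i)%N.
Proof.
move=> ij; have [h|h] := leqP (size lam) j; first by rewrite (nth_default _ h).
case/and3P: lamP => so _ _.
have := sorted_leq_nth (leT := geq) _ _ 0%N so.
by apply => //; [move=> x y z /= h1 h2;
  apply: leq_trans h2 h1 | exact: leqnn | rewrite inE (leq_ltn_trans ij)].
Qed.

Lemma partition_le i : (nth 0 lam i <= m)%N.
Proof.
case/and3P: lamP => _ _ /eqP sumE.
have [h|h] := leqP (size lam) i; first by rewrite nth_default.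
by rewrite -sumE sumnE (big_nth 0) (bigD1_seq i) ?leq_addr ?mem_iota
  ?iota_uniq //= subn0 add0n.
Qed.

Lemma card_below (i : nat) : #|[set q :
  'I_m | (q < nth 0 lam i)%N]| = nth 0 lam i.
Proof.
rewrite -sum1_card (eq_bigl (fun q : 'I_m => (q < nth 0 lam i)%N)) => [|q];
  last by rewrite inE.
by rewrite (big_ord_narrow (partition_le i)) sum1_card card_ord.
Qed.

Lemma card_shape : #|[set p :
  'I_(size lam) * 'I_m | (p.2 < nth 0 lam p.1)%N]| = m.
Proof.
case/and3P: lamP => _ _ /eqP sumE.
rewrite -[RHS]sumE sumnE (big_nth 0) big_mkord.
rewrite -sum1_card (partition_big fst xpredT) //=; apply: eq_bigr => i _.
rewrite (eq_bigl (fun p : 'I_(size lam) * 'I_m =>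
  (p.2 < nth 0 lam i)%N && (p.1 == i))); last first.
  by move=> p; rewrite inE; case: eqP => [->|]; rewrite ?andbF.
rewrite (reindex_onto (fun q : 'I_m => (i, q)) snd) =>
  [|[i' q] /= /andP[_ /eqP -> //]].
rewrite (eq_bigl (fun q : 'I_m => (q < nth 0 lam i)%N)) => [|q];
  last by rewrite !eqxx !andbT.
by rewrite -[RHS](card_below i) -sum1_card; apply: eq_bigl => q; rewrite inE.
Qed.


Lemma tableau_cells T : is_tableau T ->
  forall (i : 'I_(size lam)) (q :
    'I_m), (q < nth 0 lam i)%N -> exists a, T a = (i, q).
Proof.
move=> /andP[/injectiveP injT /forallP inT] i q lt.
have : T @: [set: 'I_m] == [set p :
  'I_(size lam) * 'I_m | (p.2 < nth 0 lam p.1)%N].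
  rewrite eqEcard card_shape card_imset // cardsT card_ord leqnn andbT.
  by apply/fintype.subsetP => p /imsetP[a _ ->]; rewrite inE.
move/eqP/setP/(_ (i, q)); rewrite !inE /= lt => /imsetP[a _ ->].
by exists a.
Qed.

Lemma is_tableauP T : is_tableau T -> tableau (rows T) (cols T).
Proof.
move=> hT; have /andP[/injectiveP injT /forallP inT] := hT; split.
  move=> a b; rewrite !ffunE => e1 e2; apply: injT.
  by rewrite (surjective_pairing (T a)) e1 e2 -surjective_pairing.
move=> a i; rewrite !ffunE => lt.
have lt' : ((T a).2 < nth 0 lam i)%N.
  by apply: leq_trans (inT a) _; apply/partition_nth/ltnW.
by have [b hb] := tableau_cells hT lt'; exists b; rewrite ffunE hb.
Qed.

Lemma content_rows T i : is_tableau T -> content (rows T) i = nth 0 lam i.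
Proof.
move=> hT; have /andP[/injectiveP injT /forallP inT] := hT.
rewrite ffunE -(card_imset _ injT) -[RHS]card_below.
have injp : injective (fun q : 'I_m => (i, q)) by move=> q q' [].
rewrite -(card_imset _ injp); apply: eq_card => -[i' q].
apply/imsetP/imsetP => [[a]|[q']]; rewrite inE ?ffunE.
  move=> /eqP ea e; exists q; last by move: ea; rewrite -e /= => ->.
  by rewrite inE; have := inT a; rewrite -e /= -ea -e.
move=> lt [-> ->]; have [a ha] := tableau_cells hT lt.
by exists a; rewrite // inE ffunE ha.
Qed.

Section Functional.
Variables (X : finType).
Local Notation V := (cspace R {ffun 'I_m -> X}).

Lemma dot_place_perm (Y : finType) (s : 'S_m) (u v :
  cspace R {ffun 'I_m -> Y}) :
  dot (place_perm s u : _ -> C) (place_perm s v) = dot (u : _ -> C) v.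
Proof.
rewrite /dot -(sum_ffun_perm (fun x => u x * (v x)^*) s).
by apply: eq_bigr => x _; rewrite !ffunE.
Qed.

Lemma place_perm_sum (Y I : finType) (s : 'S_m) (F :
  I -> cspace R {ffun 'I_m -> Y}) :
  place_perm s (\sum_i F i) = \sum_i place_perm s (F i).
Proof.
by apply/ffunP => x; rewrite ffunE !sum_ffunE; apply: eq_bigr => i _;
  rewrite ffunE.
Qed.

Lemma place_permZ (Y : finType) (s : 'S_m) a (u : cspace R {ffun 'I_m -> Y}) :
  place_perm s (a *: u) = a *: place_perm s u.
Proof. by apply/ffunP => x; rewrite !ffunE. Qed.

Lemma place_permM (Y : finType) (s s' : 'S_m) (u : cspace R {ffun 'I_m -> Y}) :
  place_perm s (place_perm s' u) = place_perm (s' * s)%g u.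
Proof.
apply/ffunP => x; rewrite !ffunE; congr (u _).
by apply/ffunP => a; rewrite !ffunE permM.
Qed.

Lemma place_perm1 (Y : finType) (u : cspace R {ffun 'I_m -> Y}) :
  place_perm 1%g u = u.
Proof.
apply/ffunP => x; rewrite !ffunE; congr (u _).
by apply/ffunP => a; rewrite !ffunE perm1.
Qed.

Lemma place_perm_basis (Y : finType) (s : 'S_m) (w : {ffun 'I_m -> Y}) :
  basis_vec R [ffun a => w (s a)] = place_perm s^-1%g (basis_vec R w).
Proof.
apply/ffunP => x; rewrite !ffunE; congr (nat_of_bool _)%:R.
apply/eqP/eqP => [->|<-]; apply/ffunP => a; rewrite !ffunE.
  by rewrite permKV.
by rewrite permK.
Qed.

Lemma basis_expansion (Y : finType) (u : cspace R Y) :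
  u = \sum_y u y *: basis_vec R y.
Proof.
apply/ffunP => x; rewrite sum_ffunE (bigD1 x) //= !ffunE eqxx big1 ?addr0.
  by rewrite /GRing.scale /= mulr1.
by move=> y ne; rewrite !ffunE eq_sym (negbTE ne) /GRing.scale /= mulr0.
Qed.

Lemma place_perm_polytabloid (s : 'S_m) T : is_tableau T ->
  place_perm s (polytabloid R T) \in specht R m lam.
Proof.
move=> /andP[/injectiveP injT /forallP inT].
pose T' : {ffun 'I_m -> 'I_(size lam) * 'I_m} := [ffun a => T (s^-1 a)%g].
have -> : place_perm s (polytabloid R T) = polytabloid R T'.
  rewrite !polytabloidE; apply/ffunP => w; rewrite !ffunE.
  have -> : [ffun a => w (s a)] = wperm w s by [].
  rewrite /ptab; set A := \matrix_(a, b) _; set B := \matrix_(a, b) _.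
  have -> : A = row_perm s (col_perm s B).
    by apply/matrixP => a b; rewrite !mxE /wperm !ffunE !permK.
  rewrite row_permE col_permE !det_mulmx !det_perm odd_permV mulrCA -signr_addb.
  by rewrite addbb mulr1.
apply/memv_span/map_f; rewrite mem_enum; apply/andP; split.
  by apply/injectiveP => a b; rewrite !ffunE => /injT /perm_inj.
by apply/forallP => a; rewrite ffunE; apply: inT.
Qed.

Lemma dot_combl (I : finType) (a : I -> C) (F : I -> V) (u : V) :
  dot (\sum_i a i *: F i : V) u = \sum_i a i * dot (F i : _ -> C) u.
Proof.
rewrite /dot; under eq_bigr do rewrite sum_ffunE mulr_suml.
rewrite exchange_big; apply: eq_bigr => i _; rewrite mulr_sumr.
by apply: eq_bigr => x _; rewrite ffunE mulrA.
Qed.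

Lemma dot_sum_vspace (Ws : seq {vspace V}) (w0 w : V) :
  (forall W, W \in Ws -> forall u, u \in W -> dot (u : _ -> C) w0 = 0) ->
  w \in (\sum_(W <- Ws) W)%VS -> dot (w : _ -> C) w0 = 0.
Proof.
elim: Ws w => [|W Ws IH] w h.
  by rewrite big_nil memv0 => /eqP ->; rewrite /dot big1 // => x _;
    rewrite ffunE mul0r.
rewrite big_cons => /memv_addP[u hu [u' hu' ->]].
have e1 : dot (u : _ -> C) w0 = 0 by apply: h hu; rewrite mem_head.
have e2 : dot (u' : _ -> C) w0 = 0.
  by apply: IH => // W' hW'; apply: h; rewrite inE hW' orbT.
transitivity (dot (u : _ -> C) w0 + dot (u' : _ -> C) w0);
  last by rewrite e1 e2 addr0.
rewrite /dot -big_split.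
by apply: eq_bigr => x _; rewrite ffunE mulrDl.
Qed.

(** [w] lies in the span of the images of polytabloids under equivariant maps, so if it were
    orthogonal to all of these images it would be orthogonal to itself. *)
Lemma isotypic_polytabloid (w : V) : isotypic lam w -> w != 0 ->
  exists T (f : 'Hom(tabloid_space R m lam, V)),
   [/\ is_tableau T,
       forall (s : 'S_m) u, u \in specht R m lam -> f (place_perm s u) =
         place_perm s (f u)
     & dot (f (polytabloid R T) : _ -> C) w != 0].
Proof.
move=> [Ws [copies wWs]] w0; apply: contrapT => nex; case/eqP: w0.
have ww : dot (w : _ -> C) w = 0.
  apply: dot_sum_vspace wWs => W /copies[f [eqf _ <-]] u /memv_imgP[p].
  rewrite /specht; set Ts := [seq _ | _ <- _] => hp ->.
  rewrite (coord_span (X := in_tuple Ts) hp) linear_sum /dot.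
  under eq_bigr do rewrite sum_ffunE mulr_suml.
  rewrite exchange_big big1 // => i _.
  have /mapP[T hT ->] : (in_tuple Ts)`_i \in Ts by apply: mem_nth.
  transitivity (coord (in_tuple Ts) i p * dot (f (polytabloid R T) : _ -> C) w).
    by rewrite mulr_sumr; apply: eq_bigr => x _; rewrite linearZ ffunE mulrA.
  rewrite mem_enum in hT; apply/eqP; rewrite mulf_eq0; apply/orP; right.
  by apply: contraT => nz; case: nex; exists T, f.
by apply/ffunP => x; rewrite ffunE (dot_eq0 ww).
Qed.

(* The polytabloid is antisymmetric in each column, so its image vanishes at every
   word with fewer letters than the first column has cells. *)
Lemma specht_copy_size T (f : 'Hom(tabloid_space R m lam, V)) : is_tableau T ->
  (forall (s : 'S_m) u, u \in specht R m lam ->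
      f (place_perm s u) = place_perm s (f u)) ->
  f (polytabloid R T) != 0 -> (size lam <= #|X|)%N.
Proof.
move=> hT eqf nz.
have [x fx] : exists x, f (polytabloid R T) x != 0.
  apply: contrapT => /forallNP h; case/eqP: nz; apply/ffunP => x.
  by rewrite ffunE; apply/eqP/negbNE/negP.
have m0 (i : 'I_(size lam)) : (0 < m)%N.
  apply: leq_trans (partition_le i); rewrite lt0n.
  by case/and3P: lamP => _ n0 _; apply: contraNneq n0 => <-; apply: mem_nth.
have cell0 (i : 'I_(size lam)) : exists a, T a == (i, Ordinal (m0 i)).
  have lt : (Ordinal (m0 i) < nth 0 lam i)%N.
    rewrite /= lt0n.
    by case/and3P: lamP => _ n0 _; apply: contraNneq n0 => <-; apply: mem_nth.
  by have [a ea] := tableau_cells hT lt; exists a; rewrite ea.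
pose h i := xchoose (cell0 i).
have hE i : T (h i) = (i, Ordinal (m0 i)) by apply/eqP/(xchooseP (cell0 i)).
rewrite -[leqLHS]card_ord; apply: (@leq_card _ _ (fun i => x (h i))) => i j e.
apply/eqP; apply: contraT => ne.
pose p := tperm (h i) (h j).
have nh : h i != h j.
  by apply: contraNneq ne => eh; have := hE i; rewrite eh hE => -[->].
have cp a : cols T (p a) = cols T a.
  rewrite /p; case: tpermP => [->|->|//]; rewrite !ffunE !hE; exact: val_inj.
have eT : place_perm p (polytabloid R T) = (-1) *: polytabloid R T.
  rewrite polytabloidE; apply/ffunP => w; rewrite !ffunE.
  have := @ptab_col _ _ (rows T) (cols T) C w p cp; rewrite /wperm => ->.
  by rewrite odd_tperm nh expr1.
have hTS : polytabloid R T \in specht R m lam.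
  by rewrite -[polytabloid R T]place_perm1 place_perm_polytabloid.
have := eqf p _ hTS; rewrite eT linearZ => /ffunP/(_ x); rewrite !ffunE.
have -> : [ffun a => x (p a)] = x.
  by apply/ffunP => a; rewrite ffunE /p; case: tpermP => [->|->|].
rewrite /GRing.scale /= mulN1r => /eqP; rewrite eq_sym -subr_eq0 opprK -mulr2n.
by rewrite mulrn_eq0 /= (negbTE fx).
Qed.

(** Some equivariant image of a polytabloid has a nonzero inner product with [P v]. As [P] is
    equivariant as well, this product is, up to conjugation, the pairing of the polytabloid and [v]
    through an [S_m]-invariant kernel, which [polarization] allows to replace by a tensor power of
    one matrix [g]. *)
Lemma isotypic_functional (P : 'End(V)) (v : V) : is_isotypic_proj lam P ->
  P v != 0 -> (size lam <= #|X|)%N /\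
  exists T, is_tableau T /\ exists g : 'I_(size lam) -> X -> C,
    \sum_y v y * \det (\matrix_(a, b)
      ((cols T a == cols T b)%:R * g (rows T b) (y a))) != 0.
Proof.
move=> [Piso _ _ Peq] Pv; have [T [f [hT eqf fT]]] := isotypic_polytabloid
  (Piso v) Pv.
split.
  apply: (specht_copy_size hT eqf); apply: contraNneq fT => ->.
  by rewrite /dot big1 // => x _; rewrite ffunE mul0r.
exists T; split => //.
pose S := specht R m lam; pose eT := polytabloid R T.
have m0 : (m`!)%:R != 0 :> C by rewrite pnatr_eq0 -lt0n fact_gt0.
(* averaging over S_m extends [f] from the Specht module to an equivariant map *)
pose h (u : tabloid_space R m lam) : V :=
  (m`!)%:R^-1 *: \sum_(s : 'S_m) place_perm s^-1%g (f (projv S (place_perm s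
    u))).
have hT' : h eT = f eT.
  rewrite /h (eq_bigr (fun=> f eT)) => [|s _].
    by rewrite sumr_const card_Sn -(scaler_nat m`! (f eT)) scalerA mulVf
      ?scale1r.
  rewrite projv_id ?place_perm_polytabloid // eqf.
    by rewrite place_permM mulgV place_perm1.
  by rewrite -[eT]place_perm1 place_perm_polytabloid.
have heq (p : 'S_m) u : h (place_perm p u) = place_perm p (h u).
  rewrite /h place_permZ place_perm_sum; congr (_ *: _).
  rewrite [RHS](reindex_inj (mulgI p)); apply: eq_bigr => s _.
  by rewrite !place_permM invMg mulgKV.
have hsum u : h u = \sum_w u w *: h (basis_vec R w).
  rewrite /h {1}(basis_expansion u).
  under [RHS]eq_bigr do rewrite scalerA mulrC -scalerA scaler_sumr.
  rewrite -scaler_sumr exchange_big; congr (_ *: _); apply: eq_bigr => s _.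
  rewrite place_perm_sum !linear_sum place_perm_sum; apply: eq_bigr => w _.
  by rewrite place_permZ !linearZ place_permZ.
pose A (w : {ffun 'I_m -> 'I_(size lam)}) (y : {ffun 'I_m -> X}) : C :=
  dot (P (basis_vec R y) : _ -> C) (h (basis_vec R w)).
pose B (w : {ffun 'I_m -> 'I_(size lam)}) (y : {ffun 'I_m -> X}) : C :=
  ptab (rows T) (cols T) C w * v y.
have Aeq (w : {ffun 'I_m -> 'I_(size lam)}) (y : {ffun 'I_m -> X}) (p : 'S_m) :
    A [ffun a => w (p a)] [ffun a => y (p a)] = A w y.
  by rewrite /A !place_perm_basis heq Peq dot_place_perm.
have [|g hg] := @polarization C m _ _ A B Aeq.
  suff -> : \sum_w \sum_y B w y * A w y = (dot (f eT : _ -> C) (P v))^*.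
    by rewrite conjC_eq0.
  have PvE : P v = \sum_y v y *: P (basis_vec R y).
    rewrite {1}(basis_expansion v) linear_sum.
    by apply: eq_bigr => y _; rewrite linearZ.
  rewrite -dotC -hT' (hsum eT) PvE.
  rewrite dot_combl; under [RHS]eq_bigr do rewrite dotC dot_combl rmorph_sum
    mulr_sumr.
  rewrite exchange_big; apply: eq_bigr => y _; apply: eq_bigr => w _.
  rewrite rmorphM /= -dotC /A /B /eT polytabloidE ffunE conj_ptab.
  by rewrite mulrA (mulrC (v y)).
exists g; apply: contraNneq hg => z; apply/eqP.
rewrite exchange_big /= -[RHS]z; apply: eq_bigr => y _.
rewrite -(ptab_sum (rows T) (cols T) (fun i a => g i (y a))) mulr_sumr.
by apply: eq_bigr => w _; rewrite /B mulrAC mulrC.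
Qed.
End Functional.
End Isotypic.

(** * Powers, contractions and weights *)

Section Multilinear.
Variables (R : realType) (k : nat).
Local Notation C := R[i]%C.

(** With the other factors frozen, the sum is linear in the factor on leg [j], so the factors can be
    exchanged one leg at a time. *)
Lemma replace_factors (X : 'I_k -> finType) (s : {dffun forall j, X j} -> C)
    (phi : forall j, X j -> C) (F : forall j, (X j -> C) -> Prop) :
  (forall j (v : X j -> C), \sum_a v a * phi j a != 0 ->
     exists2 psi, F j psi & \sum_a v a * psi a != 0) ->
  \sum_(y : {dffun forall j, X j}) s y * \prod_j phi j (y j) != 0 ->
  exists2 psi : forall j, X j -> C, forall j, F j (psi j) &
    \sum_(y : {dffun forall j, X j}) s y * \prod_j psi j (y j) != 0.
Proof.
move=> rep nz.
suff /(_ _ (enum_uniq 'I_k))[psi [Fpsi _ nz']] : forall js, uniq js ->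
    exists psi : forall j, X j -> C,
    [/\ forall j, j \in js -> F j (psi j),
        forall j, j \notin js -> psi j = phi j &
        \sum_(y : {dffun forall j, X j}) s y * \prod_j psi j (y j) != 0].
  by exists psi => // j; apply: Fpsi; rewrite mem_enum.
elim=> [|j js IH] /=.
  by move=> _; exists phi; split=> // j; rewrite in_nil.
move=> /andP[nj /IH[psi [Fpsi ephi nz']]].
pose v (a : X j) := \sum_(y : {dffun forall j, X j} | y j == a)
  s y * \prod_(i | i != j) psi i (y i).
have vE (u : X j -> C) : \sum_a v a * u a = \sum_(y : {dffun forall j, X j})
    s y * (u (y j) * \prod_(i | i != j) psi i (y i)).
  rewrite (partition_big (fun y : {dffun forall j, X j} => y j) xpredT) //=.
  apply: eq_bigr => a _; rewrite mulr_suml; apply: eq_bigr => y /eqP <-.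
  by rewrite -mulrA; congr (_ * _); rewrite mulrC.
have [|u Fu nzu] := rep j v.
  rewrite vE; apply: contraNneq nz' => z; rewrite -[X in _ == X]z; apply/eqP.
  by apply: eq_bigr => y _; rewrite (bigD1 j) //= ephi.
exists (dfwith psi u); split.
- move=> i; rewrite inE; have [-> _|ne] := eqVneq i j;
  first by rewrite dfwith_in.
  by move=> /= hi; rewrite dfwith_out 1?eq_sym //; apply: Fpsi.
- move=> i; rewrite inE negb_or => /andP[ne hi].
  by rewrite dfwith_out 1?eq_sym // ephi.
apply: contraNneq nzu => z; rewrite vE -[X in _ == X]z; apply/eqP.
apply: eq_bigr => y _; rewrite [in RHS](bigD1 j) //= dfwith_in.
congr (_ * (_ * _)).
by apply: eq_bigr => i ne; rewrite dfwith_out // eq_sym.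
Qed.

Variable I : 'I_k -> finType.
Implicit Types (t : tensor R I).

Lemma sum_transpose n (F : {dffun forall j, {ffun 'I_n -> I j}} -> C) :
  \sum_x F x = \sum_(u : {ffun 'I_n -> {dffun forall j, I j}})
    F [ffun j => [ffun a => u a j]].
Proof.
rewrite (reindex (fun u : {ffun 'I_n -> {dffun forall j, I j}} =>
  [ffun j => [ffun a => u a j]] : {dffun forall j, {ffun 'I_n -> I j}})) //=.
exists (fun x : {dffun forall j, {ffun 'I_n -> I j}} =>
  [ffun a => [ffun j => x j a]]) => u _.
  by apply/ffunP => a; apply/ffunP => j; rewrite !ffunE.
by apply/ffunP => a; rewrite !ffunE; apply/ffunP => j; rewrite !ffunE.
Qed.

Lemma tensor_pow_contract n t (H : 'I_n -> forall j, I j -> C) :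
  \sum_x tensor_pow n t x * \prod_j \prod_a H a j (x j a) =
  \prod_a \sum_y t y * \prod_j H a j (y j).
Proof.
rewrite bigA_distr_bigA sum_transpose; apply: eq_bigr => u _.
rewrite ffunE exchange_big -big_split; apply: eq_bigr => a _ /=.
congr (t _ * _); first by apply/ffunP => j; rewrite !ffunE.
by apply: eq_bigr => j _; rewrite !ffunE.
Qed.

Variable L : nat.
Local Notation gens := (forall j, 'I_L -> I j -> C).
Implicit Types (g : gens).

Definition contract g t (u : {ffun 'I_k -> 'I_L}) : C :=
  \sum_y t y * \prod_j g j (u j) (y j).

Definition tpow n (t' : {ffun 'I_k -> 'I_L} -> C)
    (z : {ffun 'I_k -> {ffun 'I_n -> 'I_L}}) : C :=
  \prod_a t' [ffun j => z j a].

(** Written on [t] itself, so that it is visibly polynomial in the entries of [g]; [poly_formE]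
    identifies it with the highest weight functional at the power of [contract g t]. *)
Definition poly_form n t (r : 'I_k -> {ffun 'I_n -> 'I_L})
    (c : 'I_k -> {ffun 'I_n -> 'I_n}) g : C :=
  \sum_y tensor_pow n t y * \prod_j
    \det (\matrix_(a, b) ((c j a == c j b)%:R * g j (r j b) (y j a))).

Lemma tpow_contract n g t z :
  tpow (contract g t) z =
  \sum_x tensor_pow n t x * \prod_j \prod_a g j (z j a) (x j a).
Proof.
rewrite (tensor_pow_contract t (fun a j => g j (z j a))); apply: eq_bigr => a _.
by apply: eq_bigr => y _; congr (_ * _); apply: eq_bigr => j _; rewrite ffunE.
Qed.

Lemma poly_formE n t r c g :
  poly_form t r c g = pairing (tpow (n := n) (contract g t)) (fun j =>
    ptab (r j) (c j) C).
Proof.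
rewrite /pairing; under [RHS]eq_bigr do rewrite tpow_contract mulr_suml.
rewrite exchange_big; apply: eq_bigr => x _.
under [RHS]eq_bigr do rewrite -mulrA -big_split.
rewrite -mulr_sumr; congr (_ * _).
rewrite -(bigA_distr_bigA (fun j (w : {ffun 'I_n -> 'I_L}) =>
  \prod_a g j (w a) (x j a) * ptab (r j) (c j) C w)).
apply: eq_bigr => j _.
rewrite -(ptab_sum (r j) (c j) (fun i a => g j i (x j a))).
by apply: eq_bigr => w _; rewrite mulrC.
Qed.

(** A nonzero coordinate of the projected tensor is the pairing of the tensor power with a product
    of functionals, one per leg. [replace_factors] trades each of them for a determinant from
    [isotypic_functional], rewritten over the common alphabet ['I_L]. *)
Lemma projection_point t (m : nat) (lam : 'I_k -> seq nat) :
  (forall j, #|I j| <= L)%N -> (forall j, is_partition m (lam j)) ->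
  tensor_map (fun j => isotypic_proj R (I j) m (lam j)) (tensor_pow m t) != 0 ->
  (forall j, size (lam j) <= #|I j|)%N /\
  exists (r : 'I_k -> {ffun 'I_m -> 'I_L}) (c : 'I_k -> {ffun 'I_m -> 'I_m}) g,
    [/\ forall j, tableau (r j) (c j),
        forall j (i : 'I_L), content (r j) i = nth 0%N (lam j) i
      & poly_form t r c g != 0].
Proof.
move=> leL lamP nz.
have [x nzx] : exists x, tensor_map (fun j => isotypic_proj R (I j) m (lam j))
    (tensor_pow m t) x != 0.
  apply: contrapT => /forallNP h; case/eqP: nz; apply/ffunP => x.
  by rewrite [RHS]ffunE; apply/eqP/negbNE/negP.
rewrite ffunE in nzx.
pose phi j (a : {ffun 'I_m -> I j}) : C :=
  isotypic_proj R (I j) m (lam j) (basis_vec R a) (x j).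
pose F j (psi : {ffun 'I_m -> I j} -> C) := (size (lam j) <= #|I j|)%N /\
  exists (r : {ffun 'I_m -> 'I_L}) (c : {ffun 'I_m -> 'I_m}) (g :
    'I_L -> I j -> C),
   [/\ tableau r c, forall i, content r i = nth 0%N (lam j) i &
     forall y, psi y = \det (\matrix_(a, b) ((c a == c b)%:R * g (r b) (y a)))].
have [|psi Fpsi nzpsi] := @replace_factors _ (tensor_pow m t) phi F _ nzx.
  move=> j v nzv; pose v' : cspace R {ffun 'I_m -> I j} := [ffun a => v a].
  pose P := isotypic_proj R (I j) m (lam j).
  have Pv : P v' != 0.
    apply: contraNneq nzv => z; apply/eqP.
    transitivity (P v' (x j)); last by rewrite z ffunE.
    rewrite {1}(basis_expansion v') linear_sum sum_ffunE; apply: eq_bigr => a _.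
    by rewrite linearZ !ffunE.
  (* The default value of [isotypic_proj] is 0, which [Pv] excludes. *)
  have isoP : is_isotypic_proj (lam j) P.
    move: Pv; rewrite /P /isotypic_proj; case: xgetP => [Q _ hQ _ //|_].
    by rewrite lfunE eqxx.
  have [szj [T [hT [g hg]]]] := isotypic_functional (lamP j) isoP Pv.
  have leS : (size (lam j) <= L)%N := leq_trans szj (leL j).
  pose r : {ffun 'I_m -> 'I_L} := [ffun a => widen_ord leS (rows T a)].
  pose g' (i : 'I_L) (y : I j) : C := if (insub (i : nat) :
    option 'I_(size (lam j))) is Some i' then g i' y else 0.
  have g'E a y : g' (r a) y = g (rows T a) y.
    rewrite /g' ffunE insubT //= => h.
    by congr g; apply: val_inj.
  exists (fun y : {ffun 'I_m -> I j} =>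
    \det (\matrix_(a, b) ((cols T a == cols T b)%:R * g' (r b) (y a)))).
    split=> //; exists r, (cols T), g'; split => //.
      have [injT downT] := is_tableauP (lamP j) hT; split.
        move=> a b; rewrite [r a]ffunE [r b]ffunE => e; apply: injT.
        exact/val_inj/(congr1 val e).
      move=> a i; rewrite ffunE => lt.
      have [b cb rb] := downT a (Ordinal (ltn_trans lt (ltn_ord (rows T a))))
        lt.
      by exists b => //; apply: val_inj; rewrite ffunE rb.
    move=> i; have [lt|ge] := ltnP i (size (lam j)).
      rewrite -(content_rows (lamP j) (Ordinal lt) hT) !ffunE.
      apply: eq_card => a; rewrite !inE ffunE.
      by rewrite -(inj_eq val_inj) -[RHS](inj_eq val_inj).
    rewrite nth_default // ffunE; apply/eq_card0 => a; rewrite inE ffunE.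
    by apply/eqP => /(congr1 val) /= e; have := ltn_ord (rows T a);
      rewrite e ltnNge ge.
  apply: contraNneq hg => z; rewrite -[X in _ == X]z; apply/eqP.
  apply: eq_bigr => y _; rewrite ffunE; congr (_ * \det _).
  by apply/matrixP => a b; rewrite !mxE g'E.
split=> [j|]; first by case: (Fpsi j).
have ex j := proj2 (Fpsi j).
have [r hr] := choice ex; have [c hc] := choice hr.
have exg j : exists g : 'I_L -> I j -> C, [/\ tableau (r j) (c j),
   forall i, content (r j) i = nth 0%N (lam j) i &
     forall y, psi j y = \det (\matrix_(a, b) ((c j a == c j b)%:R * g (r j b)
       (y a)))].
  exact: hc.
exists r, c, (fun j => projT1 (cid (exg j))).
split=> [j|j|]; [by case: (exg j) => g []|by case: (exg j) => g []|].
apply: contraNneq nzpsi => z; rewrite -[X in _ == X]z; apply/eqP.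
apply: eq_bigr => y _; congr (_ * _); apply: eq_bigr => j _.
by have [_ _] := projT2 (cid (exg j)).
Qed.

End Multilinear.

Section SliceTransfer.
Variables (R : realType) (k : nat) (X : 'I_k -> finType) (Y : finType).
Local Notation C := R[i]%C.

(** Maps applied leg by leg send slices to slices. The target has the same index type [Y] on every
    leg, as the operators on legs require. *)
Lemma slice_transfer (s : tensor R X) e (G : forall j, Y -> X j -> C) :
  sum_of_slices s e ->
  exists (leg : 'I_e -> 'I_k) (v : 'I_e -> Y -> C)
         (S : 'I_e -> {ffun 'I_k -> Y} -> C),
    (forall i, slice_along (leg i) (v i) (S i)) /\
    forall z : {ffun 'I_k -> Y}, \sum_x s x * \prod_j G j (z j) (x j) = \sum_i
      S i z.
Proof.
move=> [sl [slP ->]].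
pose S i (z : {ffun 'I_k -> Y}) : C := \sum_x sl i x * \prod_j G j (z j) (x j).
suff ex i : exists jv : 'I_k * (Y -> C), slice_along jv.1 jv.2 (S i).
  have [jv hjv] := choice ex.
  exists (fun i => (jv i).1), (fun i => (jv i).2), S; split => // z.
  rewrite /S exchange_big; apply: eq_bigr => x _.
  by rewrite sum_ffunE mulr_suml.
have [j [v [w e_sl]]] := slP i.
exists (j, fun y => \sum_a G j y a * v a) => /=.
exists (fun z => \sum_(u : {dffun forall i : {i : 'I_k | i != j}, X (val i)})
    w u * \prod_i G (val i) (z (val i)) (u i)) => z y.
rewrite mulrC mulr_suml /S.
rewrite (partition_big (fun x : {dffun forall j, X j} => x j) xpredT) //=.
apply: eq_bigr => a _; rewrite mulr_sumr.
rewrite (partition_big (@drop_leg k X j) xpredT) //=.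
apply: eq_bigr => u _.
(* The only index with coordinate [a] on leg [j] and [u] on the other legs. *)
pose x0 : {dffun forall j, X j} := [ffun l =>
  match pselect (l = j) with
  | left e => ecast l (X l) (esym e) a
  | right ne => u (exist _ l (introN (l =P j) ne))
  end].
have x0j : x0 j = a.
  rewrite ffunE; case: pselect => [e0|//].
  by rewrite (eq_irrelevance e0 erefl).
have x0d : drop_leg j x0 = u.
  apply/ffunP => -[l ne]; rewrite !ffunE /=; case: pselect => [e0|ne'].
    by exfalso; move: ne; rewrite e0 eqxx.
  by congr (u (exist _ _ _)); apply: bool_irrelevance.
rewrite (big_pred1 x0) => [|x /=]; last first.
  apply/andP/eqP => [[/eqP ej /eqP ed]|->]; last by rewrite x0j x0d !eqxx.
  apply/ffunP => l; have [->|ne] := eqVneq l j; first by rewrite ej x0j.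
  have := congr1 (fun f : {dffun forall i : {i :
    'I_k | i != j}, X (val i)} => f (Sub l ne)) (etrans ed (esym x0d)).
  by rewrite !ffunE.
rewrite e_sl ffunE x0j x0d (bigD1 j) //= updE x0j.
have -> : \prod_(i0 < k | i0 != j) G i0 (upd z j y i0) (x0 i0) =
    \prod_i0 G (val i0) (z (val i0)) (u i0).
  rewrite (big_sub (fun l : 'I_k => l != j)); apply: eq_bigr => l _.
  rewrite upd_ne; last exact: (valP l).
  have := congr1 (fun f : {dffun forall i : {i :
    'I_k | i != j}, X (val i)} => f l) x0d.
  by rewrite ffunE => <-.
by rewrite [G j y a * v a]mulrC -!mulrA; congr (_ * _); rewrite mulrCA.
Qed.
End SliceTransfer.

(** * The semigroup of weights of a tensor *)

Section Concat.
Variables (R : realType) (k L : nat).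
Local Notation C := R[i]%C.
Local Notation word n := {ffun 'I_n -> 'I_L}.
Implicit Types (t : {ffun 'I_k -> 'I_L} -> C).

Section Two.
Variables (n1 n2 : nat).

Definition cat_word (w1 : word n1) (w2 : word n2) : word (n1 + n2) :=
  [ffun a => match split a with inl a' => w1 a' | inr b => w2 b end].

Definition cat_col (c1 : {ffun 'I_n1 -> 'I_n1}) (c2 : {ffun 'I_n2 -> 'I_n2}) :
    {ffun 'I_(n1 + n2) -> 'I_(n1 + n2)} :=
  [ffun a => match split a with
             | inl a' => lshift n2 (c1 a') | inr b => rshift n1 (c2 b) end].

Lemma cat_word_l w1 w2 a : cat_word w1 w2 (lshift n2 a) = w1 a.
Proof. by rewrite ffunE -[lshift _ _]/(unsplit (inl a)) unsplitK. Qed.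

Lemma cat_word_r w1 w2 a : cat_word w1 w2 (rshift n1 a) = w2 a.
Proof. by rewrite ffunE -[rshift _ _]/(unsplit (inr a)) unsplitK. Qed.

Lemma cat_col_l c1 c2 a : cat_col c1 c2 (lshift n2 a) = lshift n2 (c1 a).
Proof. by rewrite ffunE -[lshift _ a]/(unsplit (inl a)) unsplitK. Qed.

Lemma cat_col_r c1 c2 a : cat_col c1 c2 (rshift n1 a) = rshift n1 (c2 a).
Proof. by rewrite ffunE -[rshift _ a]/(unsplit (inr a)) unsplitK. Qed.

Definition catE := (cat_word_l, cat_word_r, cat_col_l, cat_col_r).

(** [tableau] constrains the order of cells only within columns, so two diagrams may be set side by
    side without sorting the columns again. *)
Lemma tableau_cat r1 c1 r2 c2 : tableau r1 c1 -> tableau r2 c2 ->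
  tableau (cat_word r1 r2) (cat_col c1 c2).
Proof.
move=> [inj1 down1] [inj2 down2]; split.
  move=> a b; rewrite -(splitK a) -(splitK b).
  case: (split a) => a'; case: (split b) => b'; rewrite !catE.
  - by move=> e /lshift_inj e'; rewrite (inj1 _ _ e e').
  - by move=> _ /eqP; rewrite eq_lrshift.
  - by move=> _ /eqP; rewrite eq_rlshift.
  - by move=> e /rshift_inj e'; rewrite (inj2 _ _ e e').
move=> a i; rewrite -(splitK a); case: (split a) => a'; rewrite !catE => lt.
  by have [b cb rb] := down1 _ _ lt; exists (lshift n2 b); rewrite !catE ?cb.
by have [b cb rb] := down2 _ _ lt; exists (rshift n1 b); rewrite !catE ?cb.
Qed.

Lemma content_cat w1 w2 i :
  content (cat_word w1 w2) i = (content w1 i + content w2 i)%N.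
Proof.
rewrite !ffunE -!sum1_card [LHS]big_mkcond big_split_ord /=.
by congr (_ + _)%N; rewrite [RHS]big_mkcond; apply: eq_bigr => a _;
  rewrite !inE catE.
Qed.

Lemma ptab_cat r1 c1 r2 c2 w1 w2 :
  ptab (cat_word r1 r2) (cat_col c1 c2) C (cat_word w1 w2) =
  ptab r1 c1 C w1 * ptab r2 c2 C w2.
Proof.
rewrite /ptab -(det_ublock _ 0); congr (\det _); apply/matrixP => a b.
rewrite -(splitK a) -(splitK b).
case: (split a) => a'; case: (split b) => b' /=;
  rewrite ?(block_mxEul, block_mxEur, block_mxEdl, block_mxEdr) !mxE !catE.
- by rewrite (inj_eq (@lshift_inj _ _)).
- by rewrite eq_lrshift.
- by rewrite eq_rlshift.
- by rewrite (inj_eq (@rshift_inj _ _)).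
Qed.

Definition cat_idx (z1 : {ffun 'I_k -> word n1}) (z2 : {ffun 'I_k -> word n2}) :
    {ffun 'I_k -> word (n1 + n2)} := [ffun j => cat_word (z1 j) (z2 j)].

Lemma sum_cat_idx (F : {ffun 'I_k -> word (n1 + n2)} -> C) :
  \sum_z F z = \sum_z1 \sum_z2 F (cat_idx z1 z2).
Proof.
rewrite pair_bigA /= (reindex (fun p :
  {ffun 'I_k -> word n1} * {ffun 'I_k -> word n2} =>
   cat_idx p.1 p.2)) //=.
exists (fun z : {ffun 'I_k -> word (n1 + n2)} =>
  ([ffun j => [ffun a => z j (lshift n2 a)]],
                  [ffun j => [ffun b => z j (rshift n1 b)]])) =>
                    [[z1 z2] _|z _] /=.
  by congr pair; apply/ffunP => j; rewrite ffunE; apply/ffunP => a;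
    rewrite ffunE ffunE catE.
apply/ffunP => j; rewrite ffunE; apply/ffunP => a.
by rewrite -(splitK a); case: (split a) => a'; rewrite catE !ffunE.
Qed.

Lemma tpow_cat t z1 z2 : tpow t (cat_idx z1 z2) = tpow t z1 * tpow t z2.
Proof.
rewrite /tpow big_split_ord; congr (_ * _); apply: eq_bigr => a _; congr t;
  by apply/ffunP => j; rewrite ffunE ffunE [RHS]ffunE catE.
Qed.
End Two.

(* [t] admits a nonvanishing highest weight functional of degree [n] and
   weight [Lam]. *)
Definition has_weight t (n : nat) (Lam : 'I_k -> 'I_L -> nat) : Prop :=
  exists (r : 'I_k -> word n) (c : 'I_k -> {ffun 'I_n -> 'I_n}),
    [/\ forall j, tableau (r j) (c j), forall j i, content (r j) i = Lam j i
      & pairing (tpow t) (fun j => ptab (r j) (c j) C) != 0].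

Lemma has_weight0 t : has_weight t 0 (fun _ _ => 0%N).
Proof.
exists (fun=> ffun0 (card_ord 0)), (fun=> ffun0 (card_ord 0)); split.
- by move=> j; split; case.
- by move=> j i; rewrite ffunE; apply: eq_card0; case.
rewrite /pairing (big_pred1 [ffun=> ffun0 (card_ord 0)]) => [|z]; last first.
  apply/esym/eqP/ffunP => j; apply/ffunP; case=> //.
rewrite /tpow big_ord0 mul1r big1 ?oner_eq0 // => j _.
by rewrite /ptab det_mx00.
Qed.

(** Both the tensor power and the polytabloids factor over concatenation, the latter as block
    diagonal determinants, so the pairing is the product of two nonzero numbers. *)
Lemma has_weightD t n1 n2 Lam1 Lam2 :
  has_weight t n1 Lam1 -> has_weight t n2 Lam2 ->
  has_weight t (n1 + n2) (fun j i => Lam1 j i + Lam2 j i)%N.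
Proof.
move=> [r1 [c1 [T1 L1 nz1]]] [r2 [c2 [T2 L2 nz2]]].
exists (fun j => cat_word (r1 j) (r2 j)), (fun j => cat_col (c1 j) (c2 j));
  split.
- by move=> j; apply: tableau_cat.
- by move=> j i; rewrite content_cat L1 L2.
suff -> : pairing (tpow t) (fun j =>
  ptab (cat_word (r1 j) (r2 j)) (cat_col (c1 j) (c2 j)) C) =
   pairing (tpow t) (fun j => ptab (r1 j) (c1 j) C) *
   pairing (tpow t) (fun j => ptab (r2 j) (c2 j) C) by rewrite mulf_neq0.
rewrite /pairing sum_cat_idx mulr_suml; apply: eq_bigr => z1 _.
rewrite mulr_sumr; apply: eq_bigr => z2 _.
rewrite tpow_cat (eq_bigr (fun j =>
  ptab (r1 j) (c1 j) C (z1 j) * ptab (r2 j) (c2 j) C (z2 j))).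
  by rewrite big_split mulrACA.
by move=> j _; rewrite ffunE ptab_cat.
Qed.

Lemma eq_has_weight t n Lam Lam' : (forall j i, Lam j i = Lam' j i) ->
  has_weight t n Lam -> has_weight t n Lam'.
Proof. by move=> e [r [c [T hL nz]]]; exists r, c; split => // j i;
  rewrite hL. Qed.

Lemma has_weight_sum t N (n : nat -> nat) (Lam : nat -> 'I_k -> 'I_L -> nat) :
  (forall p, (p < N)%N -> has_weight t (n p) (Lam p)) ->
  has_weight t (\sum_(p < N) n p) (fun j i => \sum_(p < N) Lam p j i)%N.
Proof.
elim: N => [|N IH] h.
  rewrite big_ord0; apply: eq_has_weight (has_weight0 t) => j i.
  by rewrite big_ord0.
rewrite big_ord_recr /=; apply:
  eq_has_weight (has_weightD (IH _) (h N _)) => //.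
  by move=> j i; rewrite big_ord_recr.
by move=> p lt; apply: h; apply: ltnW.
Qed.

Lemma has_weightM t N n Lam : has_weight t n Lam ->
  has_weight t (N * n) (fun j i => N * Lam j i)%N.
Proof.
move=> h; have := @has_weight_sum t N (fun=> n) (fun=> Lam) (fun _ _ => h).
rewrite sum_nat_const card_ord => h'; apply: eq_has_weight h' => j i.
by rewrite sum_nat_const card_ord.
Qed.
End Concat.

(** * Common nonzeros of polynomial functions *)

Section Generic.
Variables (C : numClosedFieldType) (k L : nat) (I : 'I_k -> finType).
Local Notation gens := (forall j, 'I_L -> I j -> C).
Implicit Types (F : gens -> C) (g h : gens).

Definition line g h (x : C) : gens := fun j i y => g j i y + x * h j i y.

(* A weak notion of polynomiality, sufficient to find common non-zeros. *)
Definition poly_on_lines F : Prop :=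
  forall g h, exists p : {poly C}, forall x, F (line g h x) = p.[x].

Lemma poly_on_linesM F1 F2 : poly_on_lines F1 -> poly_on_lines F2 ->
  poly_on_lines (fun g => F1 g * F2 g).
Proof.
move=> h1 h2 g h; have [p1 e1] := h1 g h; have [p2 e2] := h2 g h.
by exists (p1 * p2) => x; rewrite hornerM e1 e2.
Qed.

Lemma poly_on_lines_prod (J : Type) (s : seq J) (F : J -> gens -> C) :
  (forall i, poly_on_lines (F i)) -> poly_on_lines (fun g =>
    \prod_(i <- s) F i g).
Proof.
move=> hF g h; have [p hp] := choice (fun i => hF i g h).
exists (\prod_(i <- s) p i) => x; rewrite horner_prod.
by apply: eq_bigr => i _; rewrite hp.
Qed.

Lemma poly_on_lines_sum (J : Type) (s : seq J) (F : J -> gens -> C) :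
  (forall i, poly_on_lines (F i)) -> poly_on_lines (fun g =>
    \sum_(i <- s) F i g).
Proof.
move=> hF g h; have [p hp] := choice (fun i => hF i g h).
exists (\sum_(i <- s) p i) => x; rewrite horner_sum.
by apply: eq_bigr => i _; rewrite hp.
Qed.

Lemma poly_on_lines_cst a : poly_on_lines (fun=> a).
Proof. by move=> g h; exists a%:P => x; rewrite hornerC. Qed.

Lemma poly_on_lines_coord j i y : poly_on_lines (fun g => g j i y).
Proof.
move=> g h; exists ((g j i y)%:P + 'X * (h j i y)%:P) => x.
by rewrite hornerD hornerC hornerM hornerX hornerC.
Qed.

Lemma poly_nonroot (p : {poly C}) : p != 0 -> exists x, p.[x] != 0.
Proof.
move=> p0; apply: contrapT => /forallNP nex.
pose s := [seq (i%:R : C) | i <- iota 0 (size p)].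
have us : uniq s by rewrite map_inj_uniq ?iota_uniq //; apply: mulrIn;
  rewrite oner_eq0.
have rs : all (root p) s.
  by apply/allP => x _; rewrite /root; apply/negbNE/negP; apply: nex.
by have := max_poly_roots p0 rs us; rewrite size_map size_iota ltnn.
Qed.

(** On the line through [g1] and [g2] both functions are nonzero polynomials in one variable, and so
    is their product. *)
Lemma common_nonzero2 F1 F2 g1 g2 : poly_on_lines F1 -> poly_on_lines F2 ->
  F1 g1 != 0 -> F2 g2 != 0 -> exists g, F1 g * F2 g != 0.
Proof.
move=> P1 P2 nz1 nz2; pose h : gens := fun j i y => g2 j i y - g1 j i y.
have [p1 e1] := P1 g1 h; have [p2 e2] := P2 g1 h.
have l0 : line g1 h 0 = g1.
  by apply: functional_extensionality_dep => j; apply/funext => i;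
    apply/funext => y;
  rewrite /line mul0r addr0.
have l1 : line g1 h 1 = g2.
  by apply: functional_extensionality_dep => j; apply/funext => i;
    apply/funext => y;
  rewrite /line mul1r addrC subrK.
have p10 : p1 != 0 by apply: contraNneq nz1 => p0; rewrite -l0 e1 p0 horner0.
have p20 : p2 != 0 by apply: contraNneq nz2 => p0; rewrite -l1 e2 p0 horner0.
have [x nzx] := poly_nonroot (mulf_neq0 p10 p20).
by exists (line g1 h x); rewrite e1 e2 -hornerM.
Qed.

Lemma common_nonzero N (F : nat -> gens -> C) :
  (forall p, poly_on_lines (F p)) -> (forall p, (p < N)%N -> exists g, F p g
    != 0) ->
  exists g, forall p, (p < N)%N -> F p g != 0.
Proof.
move=> PF ex; suff [g hg] : exists g, \prod_(p < N) F p g != 0.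
  exists g => p lt; move: hg; rewrite (bigD1 (Ordinal lt)) //= mulf_eq0.
  by rewrite negb_or => /andP[].
elim: N ex => [|N IH] ex; first by exists (fun _ _ _ => 0);
  rewrite big_ord0 oner_eq0.
have [|g1 h1] := IH; first by move=> p lt; apply: ex; apply: ltnW.
have [g2 h2] := ex N (ltnSn N).
have [g hg] := common_nonzero2 (poly_on_lines_prod (index_enum 'I_N) (fun p =>
  PF p)) (PF N) h1 h2.
by exists g; rewrite big_ord_recr.
Qed.
End Generic.

Lemma poly_form_poly_on_lines (R : realType) (k : nat) (I :
  'I_k -> finType) (L n : nat)
    (t : tensor R I) (r : 'I_k -> {ffun 'I_n -> 'I_L}) (c :
      'I_k -> {ffun 'I_n -> 'I_n}) :
  poly_on_lines (poly_form t r c).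
Proof.
apply: poly_on_lines_sum => y; apply: poly_on_linesM;
  first exact: poly_on_lines_cst.
apply: poly_on_lines_prod => j; apply: poly_on_lines_sum => s.
apply: poly_on_linesM; first exact: poly_on_lines_cst.
apply: poly_on_lines_prod => a g h.
have [p hp] := poly_on_lines_coord (r j (s a)) (y j a) g h.
exists (((c j a == c j (s a))%:R)%:P * p) => x.
by rewrite mxE hornerM hornerC -hp.
Qed.

(** Entries of row [j] lie in distinct columns, and each of these columns also meets row [i]. *)
Lemma content_nonincr n L (r : {ffun 'I_n -> 'I_L}) (c : {ffun 'I_n -> 'I_n}) :
  tableau r c -> nonincr (content r).
Proof.
move=> [injT downT] i j ij.
have [->//|ne] := eqVneq i j.
have lt : (i < j)%N by rewrite ltn_neqAle ij andbT (inj_eq (@ord_inj _)).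
have injc : {in [set a | r a == j] &, injective c}.
  by move=> a b; rewrite !inE => /eqP ra /eqP rb; apply: injT; rewrite ra.
rewrite !ffunE -(card_in_imset injc).
apply: leq_trans (leq_imset_card c [set a | r a == i]).
apply/subset_leq_card/fintype.subsetP => d /imsetP[a];
  rewrite inE => /eqP ra ->.
have [|b <- rb] := downT a i; first by rewrite ra.
by apply/imsetP; exists b; rewrite // inE rb.
Qed.

Lemma sum_content n L (r : {ffun 'I_n -> 'I_L}) : (\sum_i content r i = n)%N.
Proof.
rewrite -[RHS]card_ord -sum1_card (partition_big r xpredT) //=.
by apply: eq_bigr => i _; rewrite ffunE -sum1_card; apply: eq_bigl => a;
  rewrite inE.
Qed.

(** * Slice rank of a power from one weight *)

Section LowerBound.
Variables (R : realType) (k : nat) (I : 'I_k -> finType) (L : nat).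
Local Notation C := R[i]%C.

Lemma tpow_invariant n (t' : {ffun 'I_k -> 'I_L} -> C) :
  invariant_tensor (tpow (n := n) t').
Proof.
move=> z s; rewrite /tpow [RHS](reindex_inj (@perm_inj _ s)).
by apply: eq_bigr => a _; congr t'; apply/ffunP => j; rewrite !ffunE.
Qed.

Lemma slice_alongZ (X : finType) (j : 'I_k) (v : X -> C) (s :
  {ffun 'I_k -> X} -> C) a :
  slice_along j v s -> slice_along j v (fun z => a * s z).
Proof. by move=> [c hc]; exists (fun z => a * c z) => z y;
  rewrite hc mulrA. Qed.

(** Weights are available only in multiples of a fixed degree, whereas the exponent is arbitrary.
    The [n2] surplus factors are contracted with the coordinate [y0], at the price of a scalar that
    is nonzero once [t y0] is. *)
Lemma contract_last n1 n2 (t : tensor R I) (g : forall j, 'I_L -> I j -> C)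
    (y0 : {dffun forall j, I j}) (z : {ffun 'I_k -> {ffun 'I_n1 -> 'I_L}}) :
  \sum_x tensor_pow (n1 + n2) t x * \prod_j
     (\prod_(a < n1) g j (z j a) (x j (lshift n2 a)) *
      \prod_(b < n2) (x j (rshift n1 b) == y0 j)%:R) =
  tpow (contract g t) z * t y0 ^+ n2.
Proof.
pose H (a : 'I_(n1 + n2)) j (y : I j) : C := match split a with
  | inl a' => g j (z j a') y | inr _ => (y == y0 j)%:R end.
have HE (x : {dffun forall j, {ffun 'I_(n1 + n2) -> I j}}) j :
    \prod_(a < n1) g j (z j a) (x j (lshift n2 a)) *
      \prod_(b < n2) (x j (rshift n1 b) == y0 j)%:R = \prod_a H a j (x j a).
  rewrite big_split_ord; congr (_ * _); apply: eq_bigr => a _; rewrite /H.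
    by rewrite (unsplitK (inl a)).
  by rewrite (unsplitK (inr a)).
under eq_bigr do under eq_bigr do rewrite HE.
rewrite tensor_pow_contract big_split_ord /=; congr (_ * _).
  apply: eq_bigr => a _; rewrite /contract; apply: eq_bigr => y _;
    congr (_ * _).
  by apply: eq_bigr => j _; rewrite /H (unsplitK (inl a)) ffunE.
rewrite -[in RHS](card_ord n2) -prodr_const; apply: eq_bigr => b _.
rewrite (bigD1 y0) //= !big1 ?mulr1 ?addr0 // => [y ne|j _]; last first.
  by rewrite /H (unsplitK (inr b)) eqxx.
have [j hj] : exists j, y j != y0 j.
  apply/existsP; apply: contraR ne => /existsPn e; apply/eqP/ffunP => j.
  by apply/eqP; rewrite -[_ == _]negbK e.
by rewrite (bigD1 j) //= /H (unsplitK (inr b)) (negbTE hj) mul0r mulr0.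
Qed.

Lemma slice_rank_ge (t : tensor R I) (g : forall j, 'I_L -> I j -> C) y0
    n1 n2 (Lam : 'I_k -> {ffun 'I_L -> nat}) D :
  (0 < k)%N -> t y0 != 0 -> has_weight (contract g t) n1 (fun j => Lam j) ->
  (forall j, nonincr (Lam j) -> \sum_i Lam j i = n1 ->
     D <= size (ballot_words n1 (Lam j)))%N ->
  (D <= slice_rank (tensor_pow (n1 + n2) t))%N.
Proof.
move=> k0 nz0 [r [c [T rL nz]]] hD.
have [hs _] := slice_rankP (tensor_pow (n1 + n2) t) k0.
pose G j (w : {ffun 'I_n1 -> 'I_L}) (x : {ffun 'I_(n1 + n2) -> I j}) : C :=
  \prod_(a < n1) g j (w a) (x (lshift n2 a)) *
  \prod_(b < n2) (x (rshift n1 b) == y0 j)%:R.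
have [leg [v [S [Sv eS]]]] := slice_transfer G hs.
have Lr j : content (r j) = Lam j by apply/ffunP => i; rewrite rL.
have ni j : nonincr (Lam j) by rewrite -Lr; apply: content_nonincr (T j).
have sumL j : (\sum_i Lam j i = n1)%N by rewrite -Lr sum_content.
apply: (@slices_lower_bound _ _ _ _ r c (tpow (contract g t)) _ D
  (* The scalar left by the surplus factors is divided out inside each slice. *)
  (fun i z => (t y0 ^- n2) * S i z) leg v (fun j =>
    ballot_words n1 (Lam j)) k0 T).
- exact: tpow_invariant.
- exact: nz.
- by move=> i; apply: slice_alongZ.
- move=> z; rewrite -mulr_sumr -eS contract_last mulrC mulfK //.
  by rewrite expf_neq0.
- move=> j; split; [exact: ballot_words_uniq | exact: hD |].
  by move=> x hx; rewrite Lr; apply: ballot_wordsP hx.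
Qed.
End LowerBound.

(** * Entropy estimates and the minimax argument *)

Section Entropy.
Variable R : realType.


Lemma ln_tangent (x y : R) : 0 < x -> 0 < y -> y * (ln x - ln y) <= x - y.
Proof.
move=> x0 y0; rewrite -ln_div ?posrE // -{2}(mulfVK (lt0r_neq0 y0) x).
rewrite mulrC -[X in _ - X]mul1r -mulrBl ler_pM2r //.
have -> : x / y = 1 + (x / y - 1) by rewrite addrC subrK.
rewrite [X in _ <= X]addrC addKr; apply: le_ln1Dx.
by rewrite ltrBrDl subrr divr_gt0.
Qed.

Lemma natr_ln_succ n : n%:R * ln (n.+1%:R : R) <= n%:R * ln n%:R + 1.
Proof.
case: n => [|n]; first by rewrite !mul0r add0r.
have := @ln_tangent n.+2%:R n.+1%:R (ltr0Sn _ _) (ltr0Sn _ _).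
rewrite mulrBr -natrB // subSnn => h; lra.
Qed.

Lemma ln_fact_ge n : n%:R * ln n%:R - n%:R <= ln (n`!%:R : R).
Proof.
elim: n => [|n IH]; first by rewrite mul0r subr0 fact0 ln1.
rewrite factS natrM lnM ?posrE ?ltr0n ?fact_gt0 //.
have h := natr_ln_succ n; have e1 : n.+1%:R = n%:R + 1 :> R by rewrite natr1.
move: IH h; set a := ln n`!%:R; set b := ln n.+1%:R; rewrite e1 => IH h.
by rewrite mulrDl mul1r; lra.
Qed.

Lemma ln_fact_le n : ln (n`!%:R : R) <= n.+1%:R * ln n.+1%:R - n%:R.
Proof.
elim: n => [|n IH]; first by rewrite fact0 ln1 mulr0 subr0.
rewrite factS natrM lnM ?posrE ?ltr0n ?fact_gt0 //.
have h := @ln_tangent n.+1%:R n.+2%:R (ltr0Sn _ _) (ltr0Sn _ _).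
have e1 : n.+2%:R = n.+1%:R + 1 :> R by rewrite natr1.
have e0 : n.+1%:R = n%:R + 1 :> R by rewrite natr1.
move: IH h; set a := ln n`!%:R; set b := ln n.+1%:R; set c := ln n.+2%:R.
rewrite e1 e0; set N := n%:R => IH h.
have : (N + 1 + 1) * (b - c) = (N+1) * b + b - (N + 1 + 1) * c by ring.
lra.
Qed.

(** When [Lam] sums to [n], this is [n] times the entropy of [Lam / n] in nats. In this scaling it
    is homogeneous, as [nentropyM] shows. *)
Definition nentropy (L n : nat) (Lam : 'I_L -> nat) : R :=
  \sum_i (Lam i)%:R * (ln n%:R - ln (Lam i)%:R).

Lemma nentropy_ge0 L n (Lam : 'I_L -> nat) : (\sum_i Lam i = n)%N ->
  0 <= nentropy n Lam.
Proof.
move=> e; apply: sumr_ge0 => i _; have [->|pos] := posnP (Lam i).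
  by rewrite mul0r.
apply: mulr_ge0 => //; rewrite subr_ge0 ler_ln ?posrE ?ltr0n //; last first.
  by rewrite -e (bigD1 i) //= addn_gt0 pos.
by rewrite ler_nat -e (bigD1 i) //= leq_addr.
Qed.

Lemma nentropyM L n (Lam : 'I_L -> nat) N : (0 < n)%N ->
  nentropy (N * n) (fun i => N * Lam i)%N = N%:R * nentropy n Lam.
Proof.
move=> n0; have [->|N0] := posnP N.
  by rewrite mul0r /nentropy big1 // => i _; rewrite mul0n mul0r.
rewrite /nentropy mulr_sumr; apply: eq_bigr => i _; rewrite natrM -mulrA.
have [->|pos] := posnP (Lam i); first by rewrite !mul0r.
by rewrite !natrM !lnM ?posrE ?ltr0n // opprD addrACA subrr add0r.
Qed.

(* The log-sum inequality. *)
Lemma nentropy_sum L M T (Lam : nat -> 'I_L -> nat) : (0 < M)%N ->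
  \sum_(p < T) nentropy M (Lam p) <=
  nentropy (T * M) (fun i => \sum_(p < T) Lam p i)%N.
Proof.
move=> M0; rewrite /nentropy exchange_big; apply: ler_sum => i _ /=.
have [T0|T0] := posnP T; first by rewrite T0 !big_ord0 mul0r.
set y := (\sum_(p < T) Lam p i)%N.
rewrite natr_sum mulr_suml -subr_ge0 -sumrB.
have [y0|y0] := posnP y.
  rewrite big1 // => p _; move: y0; rewrite /y => /eqP.
  by rewrite sum_nat_eq0 => /forallP/(_ p)/eqP /= ->; rewrite !mul0r subrr.
have yR : 0 < y%:R :> R by rewrite ltr0n.
have TR : 0 < T%:R :> R by rewrite ltr0n.
(* Comparing each [Lam p i] with the average [y / T] by [ln_tangent] leaves linear errors, which
   cancel in this sum. *)
have z : \sum_(p < T) ((Lam p i)%:R - y%:R / T%:R) = 0 :> R.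
  rewrite sumrB sumr_const card_ord -natr_sum -/y -[_ *+ T]mulr_natr divfK
    ?subrr //.
  exact: lt0r_neq0.
rewrite -[leLHS]z; apply: ler_sum => p _; rewrite natrM lnM ?posrE ?ltr0n //.
have [->|pos] := posnP (Lam p i).
  by rewrite !mul0r subrr sub0r oppr_le0 divr_ge0 // ltW.
have pR : 0 < (Lam p i)%:R :> R by rewrite ltr0n.
have := @ln_tangent (y%:R / T%:R) _ (divr_gt0 yR TR) pR.
rewrite ln_div ?posrE //; move: pR.
set a := (Lam p i)%:R; set b := ln a; set c := ln y%:R;
  set d := ln T%:R => pR h.
rewrite -natr_sum -/y -/c; set f := ln M%:R; set g := y%:R / T%:R in h *; lra.
Qed.

Lemma ln_prod (I : finType) (F : I -> nat) : (forall i, 0 < F i)%N ->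
  ln (\prod_i F i)%:R = \sum_i ln (F i)%:R :> R.
Proof.
move=> F0; suff [] : (0 < \prod_i F i)%N /\ ln (\prod_i F i)%:R = \sum_i ln (F
  i)%:R :> R by [].
elim/big_ind2: _ => [|m x n y [m0 <-] [n0 <-]|i _]; rewrite ?ln1 //.
by rewrite muln_gt0 m0 natrM lnM ?posrE ?ltr0n.
Qed.

Lemma ln_fact_shift x l M : (x + l <= M)%N -> (0 < M)%N ->
  ln ((x + l)`!%:R : R) <= ln x`!%:R + l%:R * ln M%:R.
Proof.
elim: l => [|l IH] le M0; first by rewrite addn0 mul0r addr0.
rewrite addnS factS natrM lnM ?posrE ?ltr0n ?fact_gt0 //.
rewrite addnS in le; have {}IH := IH (ltnW le) M0.
have h : ln (x + l).+1%:R <= ln M%:R :> R by rewrite ler_ln ?posrE ?ltr0n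
  ?ler_nat.
have e1 : l.+1%:R = l%:R + 1 :> R by rewrite natr1.
rewrite e1 mulrDl mul1r; move: IH h; set a := ln _; set b := ln _;
  set c := ln _.
by set d := ln _ => *; lra.
Qed.

(** With $M = n + L$, the shift of a row costs at most a factor $M^L$, and Stirling's upper bound
    for $x!$ costs another $1 + \ln M$ over $x\ln x - x$. That is $1 + (L+1)\ln M$ for each of the
    [L] rows. *)
Lemma ln_ballot_words_ge L n (Lam : {ffun 'I_L -> nat}) : nonincr Lam ->
  (\sum_i Lam i = n)%N -> (0 < L)%N ->
  nentropy n Lam - L%:R * (1 + L.+1%:R * ln (n + L)%:R) <=
  ln (size (ballot_words n Lam))%:R :> R.
Proof.
move=> ni e L0; have := ballot_words_ge ni e.
have pp : (0 < \prod_i (shifted Lam i)`!)%N by apply: prodn_gt0 => i;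
  apply: fact_gt0.
have sp := ballot_words_gt0 ni e.
rewrite -(ler_nat R) => h0.
have : ln n`!%:R <= ln (size (ballot_words n Lam) * \prod_i (shifted Lam
  i)`!)%:R :> R.
  by rewrite ler_ln ?posrE ?ltr0n ?fact_gt0 ?muln_gt0 ?sp ?pp.
rewrite natrM lnM ?posrE ?ltr0n // ln_prod => [|i]; last exact: fact_gt0.
have := ln_fact_ge n; set lnf := ln n`!%:R; set lns := ln (size _)%:R => h1 h2.
set M := (n + L)%N; have M0 : (0 < M)%N by rewrite addn_gt0 L0 orbT.
have leLam i : (Lam i <= n)%N by rewrite -e (bigD1 i) //= leq_addr.
have h3 i : ln (shifted Lam i)`!%:R <= (Lam i)%:R * ln (Lam i)%:R - (Lam i)%:R +
    (1 + L.+1%:R * ln M%:R) :> R.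
  have hs : (shifted Lam i <= Lam i + L)%N.
    by rewrite leq_add2l (leq_trans (leq_subr _ _)) // leq_pred.
  apply: (@le_trans _ _ (ln (Lam i + L)`!%:R)).
    by rewrite ler_ln ?posrE ?ltr0n ?fact_gt0 // ler_nat leq_fact.
  apply: le_trans (@ln_fact_shift _ _ M _ M0) _; first by rewrite leq_add2r.
  have := ln_fact_le (Lam i); have := natr_ln_succ (Lam i).
  have : ln (Lam i).+1%:R <= ln M%:R :> R.
    rewrite ler_ln ?posrE ?ltr0n // ler_nat /M -addn1 leq_add //.
  have e1 : (Lam i).+1%:R = (Lam i)%:R + 1 :> R by rewrite natr1.
  set b := ln (Lam i).+1%:R; rewrite -[L.+1%:R]natr1 e1 !mulrDl !mul1r.
  set a := ln (Lam i)%:R; set c := ln M%:R; set d := ln _; lra.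
have h4 : \sum_i ln (shifted Lam i)`!%:R <= \sum_i (Lam i)%:R * ln (Lam i)%:R
  - n%:R +
    L%:R * (1 + L.+1%:R * ln M%:R) :> R.
  apply: le_trans (ler_sum _ (fun i _ => h3 i)) _.
  by rewrite big_split /= sumrB -natr_sum e sumr_const card_ord -[_ *+
    L]mulr_natl.
have h5 : nentropy n Lam = n%:R * ln n%:R - \sum_i (Lam i)%:R * ln (Lam i)%:R.
  rewrite /nentropy; under eq_bigr do rewrite mulrBr.
  by rewrite sumrB -mulr_suml -natr_sum e.
rewrite h5; move: h1 h2 h4; set s1 := \sum_i _; set s2 := \sum_i _; lra.
Qed.
End Entropy.

(** * Approachability as an effective minimax argument *)

Section Approachability.
Variables (R : realType) (k : nat) (A : ('I_k -> R) -> Prop) (v B : R).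

(* Blackwell's approachability argument: always answering the direction of the
   current deficit keeps the squared norm of its positive part linear in time. *)
Lemma approachability (e : R) : (0 < k)%N -> 0 < e ->
  (forall a j, A a -> `|v - a j| <= B) ->
  (forall theta, is_prob theta -> exists2 a, A a & v <= \sum_j theta j * a j) ->
  exists T (a : nat -> 'I_k -> R), [/\ (0 < T)%N, forall p, A (a p) &
    forall j, T%:R * (v - e) <= \sum_(p < T) a p j].
Proof.
move=> k0 e0 bd ans.
pose pos x : R := Num.max x 0.
have pos_ge0 x : 0 <= pos x by rewrite le_max lexx orbT.
have ex (S : 'I_k -> R) : exists a, A a /\ \sum_j pos (S j) * (v - a j) <= 0.
  have [s0|s0] := eqVneq (\sum_j pos (S j)) 0.
    pose th (j : 'I_k) : R := (j == Ordinal k0)%:R.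
    have [|a Aa _] := ans th.
      split=> [j|]; first by rewrite /th ler0n.
      by rewrite (bigD1 (Ordinal k0)) //= /th eqxx big1 ?addr0 // =>
        j /negbTE ->.
    exists a; split => //; rewrite big1 // => j _.
    move: s0 => /eqP; rewrite psumr_eq0 // => /allP/(_ j).
    by rewrite mem_index_enum => /(_ isT) /eqP /= ->; rewrite mul0r.
  set s := \sum_j pos (S j) in s0.
  have sp : 0 < s by rewrite lt_def s0 sumr_ge0.
  have [|a Aa va] := ans (fun j => pos (S j) / s).
    split=> [j|]; first by rewrite divr_ge0 // ltW.
    by rewrite -mulr_suml divff.
  exists a; split => //; under eq_bigr do rewrite mulrBr.
  rewrite sumrB -mulr_suml -/s subr_le0 mulrC -ler_pdivlMr //.
  apply: le_trans va _; rewrite mulr_suml; apply: ler_sum => j _.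
  by rewrite mulrAC.
have [sel selP] := choice ex.
pose S := fix S p : 'I_k -> R := if p is p'.+1 then fun j =>
  S p' j + (v - sel (S p') j)
  else fun=> 0.
have SE T j : S T j = \sum_(p < T) (v - sel (S p) j).
  by elim: T => [|T IH]; [rewrite big_ord0 | rewrite big_ord_recr /= -IH].
have qS T : \sum_j pos (S T j) ^+ 2 <= T%:R * (k%:R * B ^+ 2).
  elim: T => [|T IH].
    by rewrite mul0r big1 // => j _; rewrite /pos /= maxxx expr0n.
  have [Aa dec] := selP (S T).
  (* By the choice of [sel] the cross terms have a nonpositive sum, so a round adds at most $B^2$
     per coordinate. *)
  apply: (@le_trans _ _ (\sum_j (pos (S T j) ^+ 2 + 2 * (pos (S T j) * (v -
    sel (S T) j))
    + B ^+ 2))).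
    apply: ler_sum => j _ /=; have := bd _ j Aa.
    move: (S T j) (v - sel (S T) j) => x u ub.
    have u2 : u ^+ 2 <= B ^+ 2.
      rewrite -[u ^+ 2]ger0_norm ?sqr_ge0 // normrX lerXn2r ?nnegrE //.
      exact: le_trans ub.
    have -> : pos x ^+ 2 + 2 * (pos x * u) + B ^+ 2 =
       (pos x + u) ^+ 2 + (B ^+ 2 - u ^+ 2) by ring.
    have : pos (x + u) ^+ 2 <= (pos x + u) ^+ 2; last lra.
    have px : x <= pos x by rewrite le_max lexx.
    rewrite /pos; case: (lerP (x + u) 0) => h; first by rewrite expr0n sqr_ge0.
    rewrite -/(pos x) lerXn2r ?nnegrE //; lra.
  rewrite !big_split /= -mulr_sumr sumr_const card_ord -[_ *+ k]mulr_natl.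
  rewrite -natr1 mulrDl mul1r.
  move: IH dec; set a := \sum_j _; set b := \sum_j _; lra.
have K0 : 0 <= k%:R * B ^+ 2 by rewrite mulr_ge0 // sqr_ge0.
(* Large enough that $\sqrt{T k B^2} \le T e$, so each coordinate of the deficit is at most
   [T e]. *)
pose T := (Num.Def.truncn (k%:R * B ^+ 2 / e ^+ 2)).+1.
have TK : k%:R * B ^+ 2 <= T%:R * e ^+ 2.
  by rewrite -ler_pdivrMr ?exprn_gt0 //; apply/ltW; rewrite /T truncnS_gt.
exists T, (fun p => sel (S p)); split => // [p|j]; first by case: (selP (S p)).
have : S T j <= T%:R * e.
  apply: le_trans (_ : pos (S T j) <= _); first by rewrite le_max lexx.
  rewrite -ler_sqr ?nnegrE ?mulr_ge0 ?ler0n ?(ltW e0) //.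
  apply: le_trans (le_trans (qS T) _) => [|];
    first by rewrite (bigD1 j) //= lerDl sumr_ge0 // => i _; apply: sqr_ge0.
  by rewrite exprMn expr2 -mulrA ler_pM2l ?ltr0n.
rewrite SE sumrB sumr_const card_ord -[_ *+ T]mulr_natl => h; lra.
Qed.
End Approachability.

Lemma limn_einf_ge (R : realType) (u : nat -> \bar R) (c : \bar R) N :
  (forall n, (N <= n)%N -> (c <= u n)%E) -> (c <= limn_einf u)%E.
Proof.
move=> h; rewrite limn_einf_lim.
rewrite (topology_theory.separation_axioms.cvg_lim _ (@cvg_einfs_sup R u)) //.
apply: le_trans (_ : einfs u N <= _)%E; last by apply: ereal_sup_ubound;
  exists N.
by apply: le_ereal_inf_tmp => _ [n /= Nn <-]; apply: h.
Qed.

(** * Logarithmic errors and Shannon entropy *)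

Section Rates.
Variable R : realType.

Lemma ln2_gt0 : 0 < ln 2 :> R.
Proof. by rewrite ln_gt0 // ltr1n. Qed.

Lemma log_negligible (d K1 K2 : R) (L : nat) : 0 < d -> 0 <= K2 ->
  (* The slope [c] is chosen so that the tangent of [ln] at [1 / c] spends at most half of [d]; the
     other half absorbs the constant [K3]. The summand 1 in the denominator covers [K2 = 0]. *)
  exists N, forall n, (N <= n)%N -> (0 < n)%N -> K1 + K2 * ln (n + L)%:R <= d
    * n%:R.
Proof.
move=> d0 K20; pose c := d / (2 * (K2 + 1)).
have K21 : 0 < 2 * (K2 + 1) by lra.
have c0 : 0 < c by rewrite divr_gt0.
have Kc : K2 * c <= d / 2.
  have e : (K2 + 1) * c = d / 2.
    by rewrite /c; field; lra.
  nra.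
pose K3 := K1 + K2 * (c * L%:R - 1 + ln c^-1).
exists (Num.Def.truncn (`|K3| / (d / 2))).+1 => n Nn n0.
have n3 : K3 <= d / 2 * n%:R.
  apply: le_trans (ler_norm _) _.
  rewrite mulrC -ler_pdivrMr ?divr_gt0 //.
  apply: le_trans (ltW (truncnS_gt _)) _; by rewrite ler_nat.
have nL : 0 < (n + L)%:R :> R by rewrite ltr0n addn_gt0 n0.
have h : ln (n + L)%:R <= c * (n + L)%:R - 1 + ln c^-1.
  have ci : 0 < c^-1 by rewrite invr_gt0.
  have := @ln_tangent R (n + L)%:R c^-1 nL ci.
  rewrite -(ler_pM2l c0) mulrA mulfV ?lt0r_neq0 // mul1r mulrBr mulfV
    ?lt0r_neq0 //.
  lra.
have := ler_wpM2l K20 h; rewrite natrD mulrDr !(mulrDr K2) mulrA.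
have : K2 * c * n%:R <= d / 2 * n%:R by rewrite ler_wpM2r.
move: n3; rewrite /K3; set a := ln _; set b := ln _ => *; lra.
Qed.

Lemma shannon_nentropy L m (lam : seq nat) : (0 < m)%N -> (size lam <= L)%N ->
  nentropy R m (fun i : 'I_L => nth 0%N lam i) =
  m%:R * ln 2 * shannon (normalize R m lam).
Proof.
move=> m0 leL; rewrite /shannon /normalize big_map mulrN -mulNr mulr_sumr.
rewrite (big_nth 0%N) big_mkord.
rewrite (big_ord_widen L (fun i =>
  - (m%:R * ln 2) * ((nth 0%N lam i)%:R / m%:R *
   (ln ((nth 0%N lam i)%:R / m%:R) / ln 2))) leL) big_mkcond.
apply: eq_bigr => i _; case: ltnP => [lt|ge];
  last by rewrite nth_default // mul0r.
have [->|pos] := posnP (nth 0%N lam i); first by rewrite !mul0r mulr0.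
rewrite ln_div ?posrE ?ltr0n //.
have l2 := lt0r_neq0 ln2_gt0.
have mn : m%:R != 0 :> R by rewrite pnatr_eq0 -lt0n.
by move: (ln _) (ln m%:R) => x y; field; rewrite l2.
Qed.

(** By [ln_tangent] each of the [L] terms of [nentropy] is at most [m]. Any uniform bound would
    serve: it feeds [approachability] and the continuity of the support function. *)
Lemma shannon_bounds L m (lam : seq nat) : (0 < m)%N -> (size lam <= L)%N ->
  is_partition m lam ->
  0 <= shannon (normalize R m lam) <= L%:R / ln 2.
Proof.
move=> m0 leL /and3P[_ _ /eqP sumE].
have e := shannon_nentropy m0 leL.
have p0 : 0 < m%:R * ln 2 :> R by rewrite mulr_gt0 ?ltr0n // ln2_gt0.
have sumL : (\sum_(i < L) nth 0%N lam i = m)%N.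
  rewrite -sumE sumnE [RHS](big_nth 0%N) big_mkord.
  rewrite (big_ord_widen L (fun i => nth 0%N lam i) leL) [RHS]big_mkcond.
  by apply: eq_bigr => i _; case: ltnP => // ge; rewrite nth_default.
apply/andP; split.
  by rewrite -(pmulr_rge0 _ p0) -e nentropy_ge0.
rewrite ler_pdivlMr ?ln2_gt0 // -(ler_pM2l (_ : 0 < m%:R)) ?ltr0n //.
rewrite mulrA mulrAC -e.
rewrite /nentropy mulr_natr -[in leRHS](card_ord L) -sumr_const;
  apply: ler_sum => i _.
have [->|pos] := posnP (nth 0%N lam i); first by rewrite mul0r.
apply: le_trans (ln_tangent _ _) _; rewrite ?ltr0n //.
by rewrite gerBl.
Qed.
End Rates.

(** * Entropy points and the growth rate *)

Section Points.
Variables (R : realType) (k : nat) (I : 'I_k -> finType) (L : nat).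
Variable t : tensor R I.
Hypothesis leL : forall j, (#|I j| <= L)%N.

(** The upper functional is the support function of this set, which places the minimax argument in
    [R^k]. *)
Definition entropy_point (a : 'I_k -> R) : Prop :=
  exists (m : nat) (lam : 'I_k -> seq nat),
    [/\ (0 < m)%N, forall j, is_partition m (lam j),
        tensor_map (fun j => isotypic_proj R (I j) m (lam j)) (tensor_pow m t)
          != 0
      & forall j, a j = shannon (normalize R m (lam j))].

Lemma upper_functionalE theta : upper_functional theta t =
  ereal_sup [set (\sum_j theta j * a j)%:E | a in entropy_point].
Proof.
rewrite /upper_functional; congr ereal_sup; apply/seteqP; split=> e.
  move=> [m [lam [m0 lamP nz ->]]].
  by exists (fun j => shannon (normalize R m (lam j))) => //; exists m, lam.
move=> [a [m [lam [m0 lamP nz ha]]] <-]; exists m, lam; split => //.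
by congr EFin; apply: eq_bigr => j _; rewrite ha.
Qed.

Lemma entropy_point_bounds a j : entropy_point a -> 0 <= a j <= L%:R / ln 2.
Proof.
move=> [m [lam [m0 lamP nz ->]]]; apply: shannon_bounds (lamP j) => //.
have [sz _] := projection_point leL lamP nz.
exact: leq_trans (sz j) (leL j).
Qed.

Lemma entropy_point_neq0 a : entropy_point a -> exists y, t y != 0.
Proof.
move=> [m [lam [m0 lamP nz _]]]; apply: contrapT => /forallNP h; case/eqP: nz.
apply/ffunP => x; rewrite !ffunE big1 // => y _.
rewrite ffunE (bigD1 (Ordinal m0)) //=.
by have /negP/negbNE/eqP -> := h [ffun j => y j (Ordinal m0)]; rewrite !mul0r.
Qed.

(** The points returned by [approachability] must count equally, so each weight is first multiplied
    up to the common degree [M], the product of all degrees. The weights are then added at one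
    common [g], and the log-sum inequality bounds the entropy of the sum from below by the sum of
    the entropies. *)
Lemma combined_weight (v e : R) : (0 < k)%N -> 0 < e ->
  (forall theta, is_prob theta ->
     exists2 a, entropy_point a & v <= \sum_j theta j * a j) ->
  exists m (g : forall j, 'I_L -> I j -> R[i]%C) (Lam :
    'I_k -> {ffun 'I_L -> nat}),
    [/\ (0 < m)%N, has_weight (contract g t) m (fun j => Lam j)
      & forall j, m%:R * ln 2 * (v - e) <= nentropy R m (Lam j)].
Proof.
move=> k0 e0 ans.
have bd a j : entropy_point a -> `|v - a j| <= `|v| + L%:R / ln 2.
  move=> /(@entropy_point_bounds a j) /andP[a0 a1].
  by apply: le_trans (ler_normB _ _) _; rewrite lerD2l ger0_norm.
have [T [a [T0 aP aT]]] := approachability k0 e0 bd ans.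
have [m hm] := choice aP; have [lam hlam] := choice hm.
have m0 p : (0 < m p)%N by case: (hlam p).
have lamP p j : is_partition (m p) (lam p j) by case: (hlam p).
have aE p j : a p j = shannon (normalize R (m p) (lam p j)) by case: (hlam p).
have nz p : tensor_map (fun j => isotypic_proj R (I j) (m p) (lam p j))
    (tensor_pow (m p) t) != 0 by case: (hlam p).
have pp p := projection_point leL (lamP p) (nz p).
have sz p j : (size (lam p j) <= L)%N by apply: leq_trans (leL j);
  case: (pp p) => /(_ j).
pose rP p := cid (proj2 (pp p)); pose r p := projT1 (rP p).
pose cP p := cid (projT2 (rP p)); pose c p := projT1 (cP p).
have hc p := projT2 (cP p).
have [|g hg] := @common_nonzero _ _ _ _ T (fun p => poly_form t (r p) (c p))
    (fun p => poly_form_poly_on_lines t (r p) (c p)).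
  by move=> p _; have [g [_ _ h]] := hc p; exists g.
pose M := (\prod_(p < T) m p)%N; pose N p := (M %/ m p)%N.
have M0 : (0 < M)%N by apply: prodn_gt0.
have NM p : (p < T)%N -> (N p * m p = M)%N.
  by move=> lt; rewrite divnK // /M (bigD1 (Ordinal lt)) //= dvdn_mulr.
pose Lp p j (i : 'I_L) : nat := (N p * nth 0 (lam p j) i)%N.
have wt p : (p < T)%N -> has_weight (contract g t) M (Lp p).
  move=> lt; rewrite -(NM p lt); apply: has_weightM.
  have [g' [Tp Cp _]] := hc p; exists (r p), (c p); split => //.
  by rewrite -poly_formE; apply: hg.
have := @has_weight_sum _ _ _ _ T (fun=> M) Lp wt.
rewrite sum_nat_const card_ord => wT.
exists (T * M)%N, g, (fun j => [ffun i => \sum_(p < T) Lp p j i]%N); split.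
- by rewrite muln_gt0 T0.
- by apply: eq_has_weight wT => j i; rewrite ffunE.
move=> j; apply: le_trans (_ : nentropy R (T * M) (fun i =>
  \sum_(p < T) Lp p j i)%N <= _);
  last by rewrite le_eqVlt /nentropy; apply/orP; left; apply/eqP;
    apply: eq_bigr => i _; rewrite ffunE.
apply: le_trans (nentropy_sum R T (fun p => Lp p j) M0).
have -> : \sum_(p < T) nentropy R M (Lp p j) = M%:R * ln 2 * \sum_(p < T) a p j.
  rewrite mulr_sumr; apply: eq_bigr => p _.
  rewrite -{1}(NM p (ltn_ord p)) nentropyM // shannon_nentropy //.
  by rewrite aE !mulrA -natrM NM.
have -> : (T * M)%:R * ln 2 * (v - e) = M%:R * ln 2 * (T%:R * (v - e)).
  by rewrite natrM; ring.
by rewrite ler_wpM2l ?aT // mulr_ge0 // ltW // ln2_gt0.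
Qed.

Lemma slice_rank_rate (v w : R) : (0 < k)%N -> v < w ->
  (forall theta, is_prob theta ->
     exists2 a, entropy_point a & w <= \sum_j theta j * a j) ->
  exists N, forall n, (N <= n)%N ->
    2 `^ v <= (slice_rank (tensor_pow n t))%:R `^ (n%:R^-1).
Proof.
move=> k0 vw ans.
pose j0 := Ordinal k0.
have [y0 ty0] : exists y, t y != 0.
  have [|a /entropy_point_neq0 //] := ans (fun j => (j == j0)%:R).
  split=> [j|]; first by rewrite ler0n.
  by rewrite (bigD1 j0) //= ?eqxx big1 ?addr0 // => j /negbTE ->.
have vw2 : 0 < (w - v) / 2 by lra.
have [m [g [Lam [m0 wt ent]]]] := combined_weight k0 vw2 ans.
(* The midpoint of [v] and [w], cut off at 0 so that the inequality [n - m <= q m] can be multiplied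
   by it. *)
pose u := Num.max (w - (w - v) / 2) 0.
have vu : v < u by rewrite lt_max; apply/orP; left; lra.
have u0 : 0 <= u by rewrite le_max lexx orbT.
have l2 := ln2_gt0 R.
have [r [c [T rL _]]] := wt.
have LamE j : Lam j = content (r j) by apply/ffunP => i; rewrite rL.
have sumL j : (\sum_i Lam j i = m)%N by rewrite LamE sum_content.
have entu j : m%:R * ln 2 * u <= nentropy R m (Lam j).
  rewrite /u; case: (lerP (w - (w - v) / 2) 0) => _; last exact: ent.
  by rewrite mulr0 nentropy_ge0.
have L0 : (0 < L)%N.
  rewrite lt0n; apply/eqP => Le; have := sumL j0; rewrite big1 => [e|[i lt]].
    by rewrite -e in m0.
  by exfalso; rewrite Le in lt.
have K20 : 0 <= L%:R * L.+1%:R :> R by rewrite mulr_ge0.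
have d0 : 0 < ln 2 * (u - v) by rewrite mulr_gt0 // subr_gt0.
(* The term [m ln 2 u] is lost by rounding [n] down to a multiple of [m], the rest in
   [ln_ballot_words_ge]. The gap [d = ln 2 (u - v)] per factor has to pay for both. *)
have [N0 hN0] := log_negligible (m%:R * ln 2 * u + L%:R) L d0 K20.
exists N0.+1 => n nN; have n0 : (0 < n)%N by apply: leq_trans nN.
have {hN0}hn := hN0 n (ltnW nN) n0.
pose q := (n %/ m)%N; pose Lq j : {ffun 'I_L -> nat} := [ffun i =>
  q * Lam j i]%N.
have nE : (n = q * m + n %% m)%N := divn_eq n m.
have wq : has_weight (contract g t) (q * m) (fun j => Lq j).
  by apply: eq_has_weight (has_weightM q wt) => j i; rewrite ffunE.
pose sz j := size (ballot_words (q * m) (Lq j)).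
case: (@arg_minnP _ j0 xpredT sz isT) => j1 _ jmin.
have hD : (sz j1 <= slice_rank (tensor_pow (q * m + n %% m) t))%N.
  by apply: (@slice_rank_ge R k I L t g y0 _ _ Lq (sz j1) k0 ty0 wq) =>
    j _ _; apply: jmin.
rewrite -nE in hD.
have niq : nonincr (Lq j1).
  move=> i i' h; rewrite !ffunE leq_mul2l LamE (content_nonincr (T j1)) ?orbT
    //.
have sumq : (\sum_i Lq j1 i = q * m)%N.
  by rewrite -(sumL j1) big_distrr; apply: eq_bigr => i _; rewrite ffunE.
have sz0 : (0 < sz j1)%N := ballot_words_gt0 niq sumq.
have sr0 : (0 < slice_rank (tensor_pow n t))%N := leq_trans sz0 hD.
have lsr : ln (sz j1)%:R <= ln (slice_rank (tensor_pow n t))%:R :> R.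
  by rewrite ler_ln ?posrE ?ltr0n // ler_nat.
have := ln_ballot_words_ge R niq sumq L0.
have -> : nentropy R (q * m) (Lq j1) = q%:R * nentropy R m (Lam j1).
  by rewrite -nentropyM //; apply: eq_bigr => i _; rewrite ffunE.
have lnM : ln (q * m + L)%:R <= ln (n + L)%:R :> R.
  rewrite ler_ln ?posrE ?ltr0n ?addn_gt0 ?L0 ?orbT // ler_nat leq_add2r.
  exact: leq_trunc_div.
have qm : n%:R - m%:R <= q%:R * m%:R :> R.
  rewrite lerBlDr -natrM -natrD ler_nat {1}nE leq_add2l ltnW //.
  by rewrite ltn_pmod.
have qent : q%:R * m%:R * (ln 2 * u) <= q%:R * nentropy R m (Lam j1).
  by rewrite -mulrA ler_wpM2l // mulrA entu.
have qmu : (n%:R - m%:R) * (ln 2 * u) <= q%:R * m%:R * (ln 2 * u).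
  by rewrite ler_wpM2r // mulr_ge0 // ltW.
have Llog := ler_wpM2l K20 lnM.
rewrite /powR (gt_eqF (_ : 0 < 2)) // (gt_eqF (_ :
  0 < (slice_rank _)%:R)) ?ltr0n //.
move=> hb; rewrite ler_expR mulrC -(ler_pM2l (_ : 0 < n%:R)) ?ltr0n //.
rewrite [leRHS]mulrA mulfV ?mul1r ?pnatr_eq0 -?lt0n //.
move: hb hn lsr qent qmu Llog; rewrite /sz.
set a1 := ln (size _)%:R; set a2 := ln (slice_rank _)%:R;
  set a3 := nentropy _ _ _.
set a4 := ln (q * m + L)%:R; set a5 := ln (n + L)%:R; set a6 := ln 2.
by move=> *; lra.
Qed.
End Points.

(** * Existence of a minimizing theta *)

Section Minimizer.
Variables (R : realType) (k : nat).
Local Open Scope classical_set_scope.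

Lemma lipschitz_rV_continuous (f : 'rV[R]_k -> R) (K : R) : 0 <= K ->
  (forall x y, f x <= f y + K * \sum_j `|x ord0 j - y ord0 j|) -> continuous f.
Proof.
move=> K0 lip x; apply/(@cvgrPdist_le _ _ _ _ (nbhs_filter x)) => e e0.
pose M := K * k%:R + 1.
have M0 : 0 < M by rewrite ltr_wpDl // mulr_ge0.
have cc (j : 'I_k) : nbhs x [set y :
  'rV[R]_k | `|x ord0 j - y ord0 j| <= e / M].
  have := @coord_continuous R 1 k ord0 j x.
  move/(@cvgrPdist_le _ _ _ _ (nbhs_filter x)).
  by apply; rewrite divr_gt0.
have : nbhs x [set y : 'rV[R]_k | forall j :
  'I_k, `|x ord0 j - y ord0 j| <= e / M].
  exact: (@filter_forall _ _ (fun (j : 'I_k) (y : 'rV[R]_k) =>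
    `|x ord0 j - y ord0 j| <= e / M) _ (nbhs_filter x) cc).
apply: (@filterS _ _ (nbhs_filter x)) => y hy.
have hs : K * \sum_j `|x ord0 j - y ord0 j| <= e.
  apply: le_trans (_ : K * (k%:R * (e / M)) <= _).
    rewrite ler_wpM2l // -[k in k%:R]card_ord mulr_natl -sumr_const.
    by apply: ler_sum => j _; apply: hy.
  rewrite !mulrA ler_pdivrMr // /M; lra.
have hs' : K * \sum_j `|y ord0 j - x ord0 j| <= e.
  by under eq_bigr do rewrite distrC.
rewrite ler_norml; have := lip x y; have := lip y x; lra.
Qed.

Lemma simplex_compact : compact [set x : 'rV[R]_k | is_prob (x ord0)].
Proof.
have -> : [set x : 'rV[R]_k | is_prob (x ord0)] =
    [set x : 'rV[R]_k | \sum_j x ord0 j = 1] `&`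
    [set x : 'rV[R]_k | forall j, `[0, 1]%classic (x ord0 j)].
  apply/seteqP; split=> x /=.
    move=> [x0 x1]; split=> // j; rewrite /= in_itv /= x0 /= -x1.
    by rewrite (bigD1 j) //= lerDl sumr_ge0.
  by move=> [x1 x0]; split=> // j; have := x0 j;
    rewrite /= in_itv /= => /andP[].
rewrite setIC; apply: compact_closedI.
  apply: (@rV_compact _ _ (fun=> `[(0 : R), 1]%classic)) => j.
  exact: segment_compact.
have cf : continuous (fun x : 'rV[R]_k => \sum_j x ord0 j).
  apply: (@lipschitz_rV_continuous _ 1) => // x y.
  rewrite mul1r -big_split; apply: ler_sum => j _ /=.
  by rewrite -lerBlDl ler_norm.
move/continuous_closedP : cf => /(_ [set 1]); apply.
exact: closed_eq.
Qed.

(** As [A] is nonempty and bounded, its support function is real-valued and Lipschitz with constant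
    [B] for the $\ell_1$ norm, so it attains its minimum on the compact simplex. *)
Lemma min_support_function (A : ('I_k -> R) -> Prop) (B : R) a0 : (0 < k)%N ->
  A a0 -> (forall a j, A a -> 0 <= a j <= B) ->
  exists2 theta : 'I_k -> R, is_prob theta &
    forall theta', is_prob theta' ->
     (ereal_sup [set (\sum_j theta j * a j)%:E | a in A] <=
      ereal_sup [set (\sum_j theta' j * a j)%:E | a in A])%E.
Proof.
move=> k0 Aa0 bd.
have B0 : 0 <= B by have /andP[h1 h2] := bd _ (Ordinal k0) Aa0;
  apply: le_trans h2.
pose S (th : 'I_k -> R) := [set \sum_j th j * a j | a in A].
have Sne th : S th !=set0 by exists (\sum_j th j * a0 j), a0.
have lipS (x y : 'I_k -> R) a :
  A a -> \sum_j x j * a j <= \sum_j y j * a j + B * \sum_j `|x j - y j|.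
  move=> Aa; rewrite mulr_sumr -big_split; apply: ler_sum => j _ /=.
  have /andP[a1 a2] := bd a j Aa.
  rewrite -lerBlDl -mulrBl mulrC; apply: le_trans (_ : a j * `|x j - y j| <= _).
    by rewrite ler_wpM2l // ler_norm.
  by rewrite ler_wpM2r.
have Sub th : has_ubound (S th).
  exists (\sum_j (fun=> 0) j * a0 j + B * \sum_j `|th j - 0|) => _ [a Aa <-].
  apply: le_trans (lipS th (fun=> 0) a Aa) _; rewrite lerD2r.
  by rewrite !big1 // => j _; rewrite mul0r.
have supE th : ereal_sup [set (\sum_j th j * a j)%:E | a in A] = (sup (S
  th))%:E.
  rewrite -ereal_sup_EFin //; congr ereal_sup; apply/seteqP; split=> e.
    by move=> [a Aa <-]; exists (\sum_j th j * a j) => //; exists a.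
  by move=> [_ [a Aa <-] <-]; exists a.
pose f (x : 'rV[R]_k) := sup (S (x ord0)).
have cf : continuous f.
  apply: (lipschitz_rV_continuous B0) => x y; apply: ge_sup => // _ [a Aa <-].
  apply: le_trans (lipS _ (y ord0) a Aa) _; rewrite lerD2r.
  by apply: ub_le_sup => //; exists a.
have ne : [set x : 'rV[R]_k | is_prob (x ord0)] !=set0.
  exists (\row_j (j == Ordinal k0)%:R) => /=; split=> [j|].
    by rewrite mxE ler0n.
  rewrite (bigD1 (Ordinal k0)) //= mxE eqxx big1 ?addr0 // => j /negbTE nj.
  by rewrite mxE nj.
have [x] := EVT_min_rV ne simplex_compact (continuous_subspaceT cf).
rewrite inE => /= px xmin; exists (x ord0) => // th pth.
have thE : (\row_j th j) ord0 = th.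
  by apply/funext => j; rewrite mxE.
rewrite !supE lee_fin -/(f x) -[in leRHS]thE -/(f _); apply: xmin.
by rewrite inE /= thE.
Qed.
End Minimizer.

Lemma le_pow2e (R : realType) (x y : \bar R) :
  (x <= y)%E -> (pow2e x <= pow2e y)%E.
Proof.
case: x => [r||]; case: y => [s||] //=; rewrite ?leey //.
  by rewrite !lee_fin => h; apply: ler_powR => //; rewrite ler1n.
Qed.

Unset Implicit Arguments.

Theorem theorem5p6 (R : realType) (k : nat) (hk : (3 <= k)%N)
    (d : 'I_k -> nat) (t : tensor R (fun j : 'I_k => 'I_(d j))) :
  exists theta : 'I_k -> R,
    [/\ is_prob theta,
        forall theta' : 'I_k -> R, is_prob theta' ->
          (pow2e (upper_functional theta t)
             <= pow2e (upper_functional theta' t))%E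
      & (pow2e (upper_functional theta t)
           <= limn_einf (fun n : nat =>
                ((slice_rank (tensor_pow n t))%:R `^ (n%:R^-1))%:E))%E].
Proof.
have k0 : (0 < k)%N by apply: leq_trans hk.
pose L := \max_j d j.
have leL (j : 'I_k) : (#|'I_(d j)| <= L)%N by rewrite card_ord leq_bigmax.
pose u (n : nat) : \bar R := ((slice_rank (tensor_pow n t))%:R `^ (n%:R^-1))%:E.
rewrite -/u; have liminf0 : (0 <= limn_einf u)%E.
  apply: (@limn_einf_ge R u 0%E 0%N).
  by move=> n _; rewrite lee_fin powR_ge0.
have [[a0 Aa0]|nA] := pselect (exists a, entropy_point t a); last first.
  (* Without entropy points the bound to prove is 0 for every [theta], and a vertex of the simplex
     serves as minimizer. *)
  have UE theta : upper_functional theta t = -oo%E.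
    rewrite upper_functionalE -(@ereal_sup0 R); congr ereal_sup.
    by apply/seteqP; split=> // e [a Aa]; case: nA; exists a.
  exists (fun j => (j == Ordinal k0)%:R); split.
  - split=> [j|]; first by rewrite ler0n.
    by rewrite (bigD1 (Ordinal k0)) //= ?eqxx big1 ?addr0 // => j /negbTE ->.
  - by move=> theta' _; rewrite !UE.
  - by rewrite UE.
have [theta pth thmin] := min_support_function k0 Aa0
  (fun a j => @entropy_point_bounds _ _ _ L t leL a j).
have Umin theta' : is_prob theta' ->
    (upper_functional theta t <= upper_functional theta' t)%E.
  by move=> p; rewrite !upper_functionalE; apply: thmin.
exists theta; split => //.
  by move=> theta' p; apply/le_pow2e/Umin.
have key (v : R) : (v%:E < upper_functional theta t)%E ->
    ((2 `^ v)%:E <= limn_einf u)%E.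
  move=> lt.
  (* [slice_rank_rate] needs room above [v]. Since [theta] is a minimizer, [w] also lies below the
     functional at every other [theta']. *)
  have [w vw wU] : exists2 w : R, v < w & (w%:E < upper_functional theta t)%E.
    move: lt; case: (upper_functional theta t) => [b||] //.
      by rewrite lte_fin => vb; exists ((v + b) / 2); rewrite ?lte_fin; lra.
    by exists (v + 1); rewrite ?ltry //; lra.
  have [|N hN] := slice_rank_rate leL k0 vw (t := t).
    move=> theta' p; have := lt_le_trans wU (Umin _ p).
    rewrite upper_functionalE => /ereal_sup_gt[_ [a Aa <-]].
    by rewrite lte_fin => /ltW h; exists a.
  by apply: (limn_einf_ge (N := N)) => n /hN h; rewrite lee_fin.
have log2 (y : R) : 0 < y -> 2 `^ (ln y / ln 2) = y.
  move=> y0; rewrite /powR (gt_eqF (_ : 0 < 2)) // divfK ?lnK ?posrE //.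
  exact: lt0r_neq0 (ln2_gt0 R).
rewrite leNgt; apply/negP => ltX.
have [x Xx] : exists x : R, limn_einf u = x%:E.
  move: liminf0 ltX; case: (limn_einf _) => [x||] //; first by exists x.
  by move=> _; rewrite ltNge leey.
rewrite Xx in key liminf0 ltX; rewrite lee_fin in liminf0.
(* If the liminf [x] were too small, [key] at a suitable [v] would contradict it: [2^v] is the
   midpoint of [x] and [2^b], or [x + 1] when the functional is infinite. *)
case E: (upper_functional theta t) ltX key => [b||] /=.
- rewrite lte_fin => xu /(_ (ln ((x + 2 `^ b) / 2) / ln 2)).
  have y0 : 0 < (x + 2 `^ b) / 2 by lra.
  rewrite log2 // lte_fin lee_fin => key.
  suff : (x + 2 `^ b) / 2 <= x by lra.
  apply: key; rewrite ltr_pdivrMr ?ln2_gt0 // -ln_powR ltr_ln ?posrE //; lra.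
- move=> _ /(_ (ln (x + 1) / ln 2)); rewrite log2 ?ltry; last by lra.
  by rewrite lee_fin => /(_ isT); lra.
- by rewrite lte_fin ltNge liminf0.
Qed.
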